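(* Let $p\in[1,+\infty)$, $\theta\in[0,2p-1)$ and $\delta\ge 0$. Let $\mathcal O$ and $\mathcal A$ be such that the domain hypothesis, the kernel hypothesis and the weighted Gaussian integral hypothesis of the context are satisfied. Then: (i) For each $t$, the operator $S(t)$, defined on compactly supported functions by $S(t)\psi(x)=\int_{\mathcal O}G(t,x,y)\psi(y)\,\mathrm{d}y$, has a unique extension to a bounded linear operator, denoted still by $S(t)$, acting from $L^p_{\theta,\delta}$ into $L^p_{\theta,\delta}$. Moreover, $S=(S(t))$ forms a $C_0$-semigroup on $L^p_{\theta,\delta}$. (ii) There exists a constant $C>0$ such that for all $t\in(0,1]$ and $\psi\in L^p_{\theta,\delta}$, $S(t)\psi(x)$ is differentiable for each $x\in\mathcal O$ and $$\Big|\frac{\partial}{\partial x_i}S(t)\psi\Big|_{L^p_{\theta,\delta}}\le\frac{C}{\sqrt t}\,|\psi|_{L^p_{\theta,\delta}},\qquad i=1,\ldots,d.$$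
   Context: Notation. $\mathcal O\subset\mathbb R^d$, $\mathcal O\ne\mathbb R^d$, is an open connected set; $\rho(z)=\mathrm{dist}(z,\partial\mathcal O)$; $m_t(z)=\min\{1,\rho(z)/\sqrt t\}$; $g_t(z)=(2\pi t)^{-d/2}e^{-|z|^2/(2t)}$. For $p\ge1$, $\theta,\delta\ge0$: $L^p_{\theta,\delta}=L^p(\mathcal O,w_{\theta,\delta}(x)\,\mathrm{d}x)$ with norm $|\cdot|_{L^p_{\theta,\delta}}$, where $w_{\theta,\delta}(x)=\min\{\rho(x)^\theta,(1+|x|^2)^{-\delta}\}$. Domain hypothesis. $\mathcal O$ is a $C^{1,\alpha}$-domain for some $\alpha\in(0,1)$ and satisfies the connected line condition: there is a constant $\chi\ge1$ such that any $x,y\in\mathcal O$ can be joined by a rectifiable curve contained in $\mathcal O$ of length at most $\chi|x-y|$. (It holds for bounded $C^{1,\alpha}$-domains, domains above the graph of a $C^{1,\alpha}$ function, half-spaces, slabs.) Kernel hypothesis. $\mathcal A\phi(x)=\sum_{i,j=1}^d\frac{\partial}{\partial x_i}\big(a_{ij}(x)\frac{\partial\phi}{\partial x_j}(x)\big)+\sum_{i=1}^d\mu^i(x)\frac{\partial\phi}{\partial x_i}(x)$. The homogeneous Dirichlet problem $\partial_tu=\mathcal Au$ in $\mathcal O$ for $t>0$, $u=0$ on $\partial\mathcal O$, $u(0)=f$, generates a $C_0$-semigroup $(S(t))$ on $L^2(\mathcal O,\mathrm{d}x)$, represented by a Green kernel $G$: $S(t)\psi(x)=\int_{\mathcal O}G(t,x,y)\psi(y)\,\mathrm{d}y$.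 There is $\lambda>0$ with $\lambda|h|^2\le\langle a(x)a^T(x)h,h\rangle\le\lambda^{-1}|h|^2$ for all $x,h\in\mathbb R^d$, and there are constants $C,c>0$ such that for all $t\in(0,1]$, $x,y\in\mathcal O$, $$G(t,x,y)\le C\,m_t(y)\,g_{ct}(x-y),\qquad |\nabla_xG(t,x,y)|\le C\,\frac{m_t(y)}{\sqrt t}\,g_{ct}(x-y).$$ Weighted Gaussian integral hypothesis. For any $c>0$ and $\alpha\in(-1,0)$ there is $C<+\infty$ such that $$\sup_{x\in\mathcal O}\int_{\mathcal O}\rho^\alpha(y)g_{ct}(x-y)\,\mathrm{d}y\le Ct^{\alpha/2}\qquad\forall\,t\in(0,1].$$ *)

(* Defs.v *)
From HB Require Import structures.
From mathcomp Require Import all_boot all_order all_algebra.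
From mathcomp Require Import all_classical all_reals all_analysis.
From mathcomp Require Import measurable_realfun.

Set Implicit Arguments.
Unset Strict Implicit.
Unset Printing Implicit Defensive.

Import Order.TTheory GRing.Theory Num.Theory.
Import numFieldNormedType.Exports.

Local Open Scope classical_set_scope.
Local Open Scope ring_scope.

Definition borel_display : measure_display.
Proof. exact: default_measure_display. Qed.

Section Borel.
Context {R : realType} {n : nat}.

Definition borel : set (set 'rV[R]_n) := <<s @open 'rV[R]_n >>.

Let borel0 : borel set0.
Proof. exact: sigma_algebra0. Qed.

Let borelC A : borel A -> borel (~` A).
Proof. exact: sigma_algebraC. Qed.

Let borel_bigcup (F : (set 'rV[R]_n)^nat) :
  (forall i, borel (F i)) -> borel (\bigcup_i F i).
Proof. exact: sigma_algebra_bigcup. Qed.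

HB.instance Definition _ :=
  @isMeasurable.Build borel_display 'rV[R]_n borel borel0 borelC borel_bigcup.

End Borel.

Lemma open_measurable_rV (R : realType) n (U : set 'rV[R]_n) :
  open U -> measurable U.
Proof. by move=> oU; exact: sub_sigma_algebra. Qed.

Definition rV_cons (R : realType) n (z : R * 'rV[R]_n) : 'rV[R]_n.+1 :=
  row_mx z.1%:M z.2.

Lemma measurable_fun_rV d (T : measurableType d) (R : realType) n
    (f : T -> 'rV[R]_n) :
  (forall i, measurable_fun setT (fun x => f x ord0 i)) ->
  measurable_fun setT f.
Proof.
move=> mf; apply: (@measurability _ _ _ _ _ _ (@open 'rV[R]_n)) => //.
move=> _ [U oU <-]; rewrite setTI.
pose B (q : 'rV[rat]_n) (k : nat) : set 'rV[R]_n :=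
  [set y | forall i, `|ratr (q ord0 i) - y ord0 i| < k.+1%:R^-1].
have -> : f @^-1` U = \bigcup_(qk : 'rV[rat]_n * nat)
    [set x | B qk.1 qk.2 `<=` U /\ B qk.1 qk.2 (f x)].
  apply/seteqP; split => [x Ux|x [[q k] _ [/= BU]]]; last exact: BU.
  have /nbhs_ballP[e /= e0 eU] : nbhs (f x) U.
    by rewrite nbhsE; exists U.
  have [k ke] : exists k : nat, k.+1%:R^-1 < e / 2.
    near \oo => k; exists k; near: k.
    by apply: near_infty_natSinv_lt (PosNum _); rewrite divr_gt0.
  have k0 : 0 < k.+1%:R^-1 :> R by rewrite invr_gt0.
  have /choice[q qP] : forall i, exists q : rat,
      `|ratr q - f x ord0 i| < k.+1%:R^-1.
    move=> i; have [|q] := @rat_in_itvoo R (f x ord0 i - k.+1%:R^-1)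
      (f x ord0 i + k.+1%:R^-1).
      by rewrite ltrBlDr -addrA ltrDl addr_gt0.
    rewrite in_itv/= => /andP[q1 q2]; exists q.
    by rewrite ltr_distl q1 q2.
  exists (\row_i q i, k) => //=; split; last by move=> i; rewrite mxE.
  move=> y /= By; apply: eU; split => // i j; rewrite ord1.
  rewrite /ball/=; have := By j; rewrite mxE => yq.
  rewrite (splitr e) (le_lt_trans (ler_distD (ratr (q j)) _ _))//.
  by rewrite ltrD// ?(lt_trans yq)// distrC (lt_trans (qP j)).
apply: countable_bigcupT_measurable => [|[q k]]/=; first exact: countableP.
have [BU|nBU] := pselect (B q k `<=` U); last first.
  by rewrite (_ : mkset _ = set0) ?measurable0//; apply/seteqP; split=> // x [].
rewrite (_ : mkset _ = \bigcap_(i : 'I_n)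
    ((fun x => f x ord0 i) @^-1` ball (ratr (q ord0 i) : R) k.+1%:R^-1)).
  apply: fin_bigcap_measurable => // i _; rewrite -[X in measurable X]setTI.
  by apply: mf => //; apply: open_measurable; exact: ball_open.
apply/seteqP; split => [x [_ Bx] i _|x Bx]; first exact: Bx.
by split => // i; exact: Bx.
Unshelve. all: by end_near.
Qed.

Lemma continuous_measurable_rV (R : realType) n (f : 'rV[R]_n -> R) :
  continuous f -> measurable_fun setT f.
Proof.
move=> /continuousP cf.
apply: (measurability _ (RGenOpens.measurableE R)).
move=> _ [_ [a [b ->] <-]]; rewrite setTI.
by apply: open_measurable_rV; apply: cf; apply: interval_open.
Qed.

Lemma measurable_rV_cons (R : realType) n :
  measurable_fun setT (@rV_cons R n).
Proof.
apply: measurable_fun_rV => i; rewrite /rV_cons.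
have [j ->|j ->] := split_ordP (i : 'I_(1 + n)).
  rewrite (_ : (fun _ => _) = fst); first exact: measurable_fst.
  by apply/funext => z; rewrite (@row_mxEl _ 1 1 n) mxE (ord1 j).
rewrite (_ : (fun _ => _) = (fun z : R * 'rV[R]_n => z.2 ord0 j)).
  apply: (@measurableT_comp _ _ _ _ _ _ (fun v : 'rV[R]_n => v ord0 j)).
    by apply: continuous_measurable_rV; apply: coord_continuous.
  exact: measurable_snd.
by apply/funext => z; rewrite (@row_mxEr _ 1 1 n).
Qed.

Definition rV_uncons (R : realType) n (v : 'rV[R]_n.+1) : R * 'rV[R]_n :=
  (v ord0 ord0, \row_j v ord0 (lift ord0 j)).

Lemma rV_consK (R : realType) n : cancel (@rV_cons R n) (@rV_uncons R n).
Proof.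
case=> x v; rewrite /rV_uncons /rV_cons/=; congr pair.
  have -> : ord0 = lshift n (ord0 : 'I_1) by exact/val_inj.
  by rewrite (@row_mxEl _ 1 1 n) mxE ord1.
apply/rowP => j; rewrite mxE.
have -> : lift ord0 j = rshift 1 j by exact/val_inj.
by rewrite (@row_mxEr _ 1 1 n).
Qed.

Lemma measurable_rV_uncons (R : realType) n :
  measurable_fun setT (@rV_uncons R n).
Proof.
apply: measurable_fun_pair.
  by apply: continuous_measurable_rV; apply: coord_continuous.
apply: measurable_fun_rV => i; under eq_fun do rewrite mxE.
by apply: continuous_measurable_rV; apply: coord_continuous.
Qed.

Section lebesgue_rV_step.
Local Open Scope ereal_scope.
Context {R : realType} {n : nat}.
Variable mu : {sigma_finite_measure set 'rV[R]_n -> \bar R}.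

Definition lebesgue_rV_S : set 'rV[R]_n.+1 -> \bar R :=
  pushforward (lebesgue_measure \x mu) (@rV_cons R n).

Let mcons (A : set 'rV[R]_n.+1) :
  measurable A -> measurable (@rV_cons R n @^-1` A).
Proof. by move=> mA; rewrite -[X in measurable X]setTI; exact: measurable_rV_cons. Qed.

Let lebesgue_rV_S0 : lebesgue_rV_S set0 = 0.
Proof. by rewrite /lebesgue_rV_S /pushforward preimage_set0 measure0. Qed.

Let lebesgue_rV_S_ge0 A : 0 <= lebesgue_rV_S A.
Proof. by rewrite /lebesgue_rV_S /pushforward; apply: measure_ge0. Qed.

Let lebesgue_rV_S_sigma_additive : semi_sigma_additive lebesgue_rV_S.
Proof.
move=> F mF tF mUF; rewrite /lebesgue_rV_S /pushforward preimage_bigcup.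
apply: measure_semi_sigma_additive => [i||]; first exact: mcons.
- apply/trivIsetP => /= i j _ _ ij; rewrite -preimage_setI.
  by move/trivIsetP : tF => /(_ _ _ _ _ ij) ->//; rewrite preimage_set0.
- by rewrite -preimage_bigcup; exact: mcons.
Qed.

HB.instance Definition _ := isMeasure.Build _ _ _ lebesgue_rV_S
  lebesgue_rV_S0 lebesgue_rV_S_ge0 lebesgue_rV_S_sigma_additive.

Let lebesgue_rV_S_sigma_finite : sigma_finite setT lebesgue_rV_S.
Proof.
have /sigma_finiteP[F [TF ndF Foo]] := sigma_finiteT (@lebesgue_measure R).
have /sigma_finiteP[G [TG ndG Goo]] := sigma_finiteT mu.
exists (fun k => @rV_uncons R n @^-1` (F k `*` G k)).
  apply/seteqP; split => // v _.
  have [i _ Fi] : (\bigcup_i F i) (rV_uncons v).1 by rewrite -TF.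
  have [j _ Gj] : (\bigcup_i G i) (rV_uncons v).2 by rewrite -TG.
  exists (maxn i j) => //; split.
    by move: Fi; exact/subsetPset/ndF/leq_maxl.
  by move: Gj; exact/subsetPset/ndG/leq_maxr.
move=> k; have [mFk Fkoo] := Foo k; have [mGk Gkoo] := Goo k; split.
  rewrite -[X in measurable X]setTI; apply: measurable_rV_uncons => //.
  exact: measurableX.
rewrite /lebesgue_rV_S /pushforward -comp_preimage.
rewrite (_ : _ \o _ = id); last exact/funext/rV_consK.
by rewrite preimage_id product_measure1E// lte_mul_pinfty// ge0_fin_numE.
Qed.

HB.instance Definition _ := Measure_isSigmaFinite.Build _ _ _ lebesgue_rV_S
  lebesgue_rV_S_sigma_finite.

End lebesgue_rV_step.

(** The n-fold product of the one-dimensional Lebesgue measure, on the Borel sets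
    of ['rV[R]_n], transported along [rV_cons : R * 'rV_n -> 'rV_n.+1]. *)
Fixpoint lebesgue_rV (R : realType) (n : nat) :
    {sigma_finite_measure set 'rV[R]_n -> \bar R} :=
  match n with
  | 0%N => dirac (0 : 'rV[R]_0)
  | m.+1 => lebesgue_rV_S (lebesgue_rV R m)
  end.

(** The library norm on ['rV[R]_n] is the sup norm: it induces the right
    topology and the right notion of differentiability, but the Euclidean norm
    has to be introduced separately. *)

Definition enorm (R : realType) n (x : 'rV[R]_n) : R :=
  Num.sqrt (\sum_(i < n) x ord0 i ^+ 2).

Definition boundary (T : topologicalType) (A : set T) : set T :=
  closure A `\` A^°.

Definition boundary_dist (R : realType) n (A : set 'rV[R]_n) (z : 'rV[R]_n) : R :=
  inf [set enorm (z - y) | y in boundary A].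

Record domain (R : realType) (n : nat) := Domain {
  domain_set :> set 'rV[R]_n ;
  domain_open : open domain_set ;
  domain_connected : connected domain_set ;
  domain_proper : domain_set <> setT }.
Arguments domain_open {R n} d.

Definition domain_mem (R : realType) n (O : domain R n) (x : 'rV[R]_n) : Prop :=
  domain_set O x.
Coercion domain_mem : domain >-> Funclass.

Definition partial (R : realType) n (i : 'I_n) (f : 'rV[R]_n -> R)
  (x : 'rV[R]_n) : R := 'D_(delta_mx ord0 i) f x.

Definition grad (R : realType) n (f : 'rV[R]_n -> R) (x : 'rV[R]_n) : 'rV[R]_n :=
  \row_(i < n) partial i f x.

Definition C1alpha (R : realType) n (alpha : R) (f : 'rV[R]_n -> R) :=
  (forall u, differentiable f u) /\
  exists K : R, forall u v,
    enorm (grad f u - grad f v) <= K * enorm (u - v) `^ alpha.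

(** Near every boundary point [x0] and after an orthogonal change of coordinates
    [x |-> (x - x0) *m Q], the set is the region above the graph of a
    [C1alpha] function of the first [n] coordinates. *)
Definition C1alpha_domain (R : realType) n (alpha : R) (A : set 'rV[R]_n.+1) :=
  forall x0, boundary A x0 ->
  exists (Q : 'M[R]_n.+1) (r : R) (gamma : 'rV[R]_n -> R),
    [/\ Q *m Q^T = 1%:M, 0 < r, C1alpha alpha gamma &
      forall x, enorm (x - x0) < r ->
        let y := (x - x0) *m Q in
        A x <-> gamma (col' ord_max y) < y ord0 ord_max].

Definition curve_length (R : realType) n (c : R -> 'rV[R]_n) (a b : R) : \bar R :=
  ereal_sup [set (\sum_(0 <= k < size s)
                    enorm (c (nth b (a :: s) k.+1) - c (nth b (a :: s) k)))%:E
            | s in itv_partition a b].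

Definition connected_line_condition (R : realType) n (A : set 'rV[R]_n) :=
  exists2 chi : R, 1 <= chi & forall x y, A x -> A y ->
    exists c : R -> 'rV[R]_n,
      [/\ {within `[0, 1], continuous c}, c 0 = x, c 1 = y,
          forall s, 0 <= s <= 1 -> A (c s) &
          (curve_length c 0 1 <= (chi * enorm (x - y))%:E)%E].

Definition weight (R : realType) n (A : set 'rV[R]_n) (theta delta : R)
    (x : 'rV[R]_n) : R :=
  Num.min (boundary_dist A x `^ theta) ((1 + enorm x ^+ 2) `^ (- delta)).

Section weighted_lebesgue.
Context {R : realType} {n : nat}.

Lemma enorm_ge0 (x : 'rV[R]_n) : 0 <= enorm x.
Proof. exact: sqrtr_ge0. Qed.

Lemma continuous_enorm : continuous (@enorm R n).
Proof.
move=> x; apply: (@continuous_comp _ _ _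
  (fun x : 'rV[R]_n => \sum_(i < n) x ord0 i ^+ 2) Num.sqrt); last first.
  exact: sqrt_continuous.
apply: (@continuous_big _ _ +%R 0 xpredT _ _ _
  (fun i (x : 'rV[R]_n) => x ord0 i ^+ 2)) => [|i _ y].
  exact: add_continuous.
apply: (@continuous_comp _ _ _ (fun x : 'rV[R]_n => x ord0 i)
  (fun t : R => t ^+ 2)); first exact: coord_continuous.
exact: exprn_continuous.
Qed.

Lemma measurable_boundary_dist (A : set 'rV[R]_n) :
  measurable_fun setT (boundary_dist A).
Proof.
have [A0|/set0P A0] := eqVneq (boundary A) set0.
  rewrite (_ : boundary_dist A = cst (inf set0)); first exact: measurable_cst.
  by apply/funext => z; rewrite /boundary_dist A0 image_set0.
apply: (measurability _ (RGenInftyO.measurableE R)).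
move=> _ [_ [r ->] <-]; rewrite setTI.
have -> : boundary_dist A @^-1` `]-oo, r[%classic =
    \bigcup_(y in boundary A) [set z | enorm (z - y) < r].
  apply/seteqP; split => [z|z [y Ay /= zy]]; rewrite /= in_itv/=.
    move=> /inf_lt[|_ [y Ay <-] zy]; last by exists y.
    by case: A0 => y Ay; exists (enorm (z - y)), y.
  apply: le_lt_trans zy; apply: ge_inf; last by exists y.
  by exists 0 => _ [y' _ <-]; exact: enorm_ge0.
apply: open_measurable_rV; apply: bigcup_open => y _.
have cf : continuous (fun z : 'rV[R]_n => enorm (z - y)).
  move=> z; apply: (@continuous_comp _ _ _ (fun z : 'rV[R]_n => z - y)).
    apply: (@continuousB R 'rV[R]_n 'rV[R]_n id (cst y)).
      exact: cvg_id.
    exact: cst_continuous.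
  exact: continuous_enorm.
by move/continuousP : cf => /(_ _ (@open_lt R r)).
Qed.

Lemma measurable_weight (A : set 'rV[R]_n) (theta delta : R) :
  measurable_fun setT (weight A theta delta).
Proof.
apply: measurable_minr.
  exact: (measurableT_comp (measurable_powR theta) (measurable_boundary_dist A)).
apply: (measurableT_comp (measurable_powR (- delta))).
apply: measurable_funD; first exact: measurable_cst.
apply: measurable_funX; apply: continuous_measurable_rV.
exact: continuous_enorm.
Qed.

Lemma weight_ge0 (A : set 'rV[R]_n) (theta delta : R) x :
  0 <= weight A theta delta x.
Proof. by rewrite /weight le_min !powR_ge0. Qed.

Definition lebesgue_on (O : domain R n) : set 'rV[R]_n -> \bar R :=
  mrestr (lebesgue_rV R n) (open_measurable_rV (domain_open O)).

HB.instance Definition _ (O : domain R n) := Measure.on (lebesgue_on O).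

Definition weighted_lebesgue (O : domain R n) (theta delta : R)
    (A : set 'rV[R]_n) : \bar R :=
  (\int[lebesgue_on O]_(x in A) (weight O theta delta x)%:E)%E.

Section measure.
Local Open Scope ereal_scope.
Variables (O : domain R n) (theta delta : R).

Let weighted_lebesgue0 : weighted_lebesgue O theta delta set0 = 0.
Proof. exact: integral_set0. Qed.

Let weighted_lebesgue_ge0 A : 0 <= weighted_lebesgue O theta delta A.
Proof. by apply: integral_ge0 => x _; rewrite lee_fin weight_ge0. Qed.

Let weighted_lebesgue_sigma_additive :
  semi_sigma_additive (weighted_lebesgue O theta delta).
Proof.
apply: semi_sigma_additive_nng_induced => [|x]; last by rewrite lee_fin weight_ge0.
by apply/measurable_EFinP; apply: measurable_weight.
Qed.

HB.instance Definition _ := isMeasure.Build _ _ _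
  (weighted_lebesgue O theta delta)
  weighted_lebesgue0 weighted_lebesgue_ge0 weighted_lebesgue_sigma_additive.

End measure.

End weighted_lebesgue.

(** Elements of L^p are represented by [LfunType], i.e. by measurable functions
    with finite norm; all identities between them are meant almost everywhere.
    An element of L^p on a domain is a function on the whole space, whose values
    outside the domain are irrelevant since the measure does not charge them. *)

Section Lp_operators.
Context {d} {T : measurableType d} {R : realType}.
Variables (mu : {measure set T -> \bar R}) (p : \bar R) (p1 : (1 <= p)%E).
Local Notation Lp := (LfunType mu p1).

Definition bounded_linear (A : Lp -> Lp) :=
  (forall (k : R) (f g : Lp), A (k *: f + g) = k *: A f + A g %[ae mu]) /\
  exists K : R, forall f : Lp,
    ('N[mu]_p[EFin \o A f] <= K%:E * 'N[mu]_p[EFin \o f])%E.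

Definition C0_semigroup (S : R -> Lp -> Lp) :=
  [/\ forall t, 0 <= t -> bounded_linear (S t),
      forall f, S 0 f = f %[ae mu],
      forall s t, 0 <= s -> 0 <= t -> forall f, S (s + t) f = S s (S t f) %[ae mu] &
      forall f, ('N[mu]_p[EFin \o (S t f - f)%R])%E @[t --> 0^'+] --> 0%E].

End Lp_operators.

Section Dirichlet.
Context {R : realType} {n : nat}.
Implicit Types (O : domain R n).

Definition smooth (f : 'rV[R]_n -> R) :=
  forall (s : seq 'I_n) x, differentiable (foldr (@partial R n) f s) x.

Definition compactly_supported O (f : 'rV[R]_n -> R) :=
  exists K : set 'rV[R]_n,
    [/\ compact K, K `<=` O & forall x, O x -> ~ K x -> f x = 0].

Definition test_function O (phi : 'rV[R]_n -> R) :=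
  [/\ smooth phi, compactly_supported O phi & forall x, ~ O x -> phi x = 0].

Definition L2 O := LfunType (lebesgue_on O) (lee1n 2).

(** [u] belongs to H^1_0, the closure of the test functions in H^1, and [g] is
    its weak gradient. *)
Definition H10 O (u : L2 O) (g : 'I_n -> L2 O) :=
  exists phi : nat -> 'rV[R]_n -> R,
    [/\ forall k, test_function O (phi k),
        ('N[lebesgue_on O]_2%:E[EFin \o (phi k \- u)%R])%E @[k --> \oo] --> 0%E &
        forall i, ('N[lebesgue_on O]_2%:E[EFin \o (partial i (phi k) \- g i)%R])%E
                    @[k --> \oo] --> 0%E].

(** Integrand of the weak form of [A u] tested against [phi], where [g] is the
    gradient of [u]; the divergence is integrated by parts. *)
Definition weak_form (a : 'rV[R]_n -> 'M[R]_n) (b : 'rV[R]_n -> 'rV[R]_n)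
    (g : 'I_n -> 'rV[R]_n -> R) (phi : 'rV[R]_n -> R) (x : 'rV[R]_n) : R :=
  - (\sum_(i < n) \sum_(j < n) a x i j * g j x * partial i phi x)
  + \sum_(i < n) b x ord0 i * g i x * phi x.

(** [u(t) = S t f] solves [d/dt u = A u] in the weak sense, vanishes on the
    boundary in the sense of H^1_0, and starts from [f] because [S] is a
    C_0-semigroup. *)
Definition Dirichlet_semigroup O (a : 'rV[R]_n -> 'M[R]_n)
    (b : 'rV[R]_n -> 'rV[R]_n) (S : R -> L2 O -> L2 O) :=
  C0_semigroup S /\
  forall (f : L2 O) (t : R), 0 < t ->
    exists2 g : 'I_n -> L2 O, H10 (S t f) g &
      forall phi, test_function O phi ->
        (lebesgue_rV R n).-integrable O (EFin \o weak_form a b (fun i => g i) phi) /\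
        is_derive t 1
          (fun s => \int[lebesgue_rV R n]_(x in O) (S s f x * phi x))
          (\int[lebesgue_rV R n]_(x in O) weak_form a b (fun i => g i) phi x).

Definition kernel_integral O (K : 'rV[R]_n -> 'rV[R]_n -> R)
    (f v : 'rV[R]_n -> R) :=
  {ae lebesgue_rV R n, forall x, O x ->
    (lebesgue_rV R n).-integrable O (EFin \o (fun y => K x y * f y)) /\
    v x = \int[lebesgue_rV R n]_(y in O) (K x y * f y)}.

Definition Green_kernel O (S : R -> L2 O -> L2 O)
    (G : R -> 'rV[R]_n -> 'rV[R]_n -> R) :=
  forall t, 0 < t ->
    measurable_fun (O `*` O) (fun xy : 'rV[R]_n * 'rV[R]_n => G t xy.1 xy.2) /\
    forall f : L2 O, kernel_integral O (G t) f (S t f).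

(** The bounds are on [a a^T], not on the quadratic form of [a] itself. *)
Definition elliptic (a : 'rV[R]_n -> 'M[R]_n) :=
  exists2 lambda : R, 0 < lambda & forall (x : 'rV[R]_n) (h : 'cV[R]_n),
    let q := (h^T *m (a x *m (a x)^T) *m h) ord0 ord0 in
    lambda * enorm h^T ^+ 2 <= q <= lambda^-1 * enorm h^T ^+ 2.

Definition gaussian (t : R) (z : 'rV[R]_n) : R :=
  (2 * pi * t) `^ (- (n%:R / 2)) * expR (- enorm z ^+ 2 / (2 * t)).

Definition boundary_factor O (t : R) (z : 'rV[R]_n) : R :=
  Num.min 1 (boundary_dist O z / Num.sqrt t).

Definition Gaussian_bounds O (G : R -> 'rV[R]_n -> 'rV[R]_n -> R) :=
  exists C c : R, [/\ 0 < C, 0 < c &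
    forall t x y, 0 < t <= 1 -> O x -> O y ->
      [/\ G t x y <= C * boundary_factor O t y * gaussian (c * t) (x - y),
          differentiable (fun x' => G t x' y) x &
          enorm (grad (fun x' => G t x' y) x) <=
            C * (boundary_factor O t y / Num.sqrt t) * gaussian (c * t) (x - y)]].

Definition weighted_Gaussian_bound O :=
  forall c alpha : R, 0 < c -> -1 < alpha < 0 ->
    exists C : R, forall t x, 0 < t <= 1 -> O x ->
      (\int[lebesgue_rV R n]_(y in O)
         (boundary_dist O y `^ alpha * gaussian (c * t) (x - y))%:E
       <= (C * t `^ (alpha / 2))%:E)%E.

End Dirichlet.

Definition Lw (R : realType) n (O : domain R n) (theta delta p : R)
    (p1 : (1 <= p%:E)%E) :=
  LfunType (weighted_lebesgue O theta delta) p1.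

(* Main.v *)
Require Import Defs.
From HB Require Import structures.
From mathcomp Require Import all_boot all_order all_algebra.
From mathcomp Require Import all_classical all_reals all_analysis.
From mathcomp Require Import measurable_realfun.
From mathcomp Require Import ring lra.

(** The hypotheses bound the Green kernel from above and its gradient in absolute
    value, but give no lower bound on the kernel itself.  The bound
    |G(t,x,y)| <= C m_t(y) g_{2ct}(x-y) is recovered as follows.  For bounded f supported
    in a compact subset of O and in a half-space, u = S(t) f lies in H^1_0, so on almost
    every line orthogonal to the half-space it is continuous, square integrable, and
    zero off O.  Following such a line away from the support of f until it leaves O or u
    becomes small, and integrating the gradient bound, which decays along the line,
    one gets |u(x)| <= C int m_t(y) g_{ct}(x-y) |f(y)| dy; f = sgn G(t,x,.) 1_A then
    gives the kernel bound.

    The integral operator with kernel m_t(y) g_{ct}(x-y) is bounded on L^p_{theta,delta}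
    uniformly in t <= 1, by Hoelder's inequality with a power of m_t, the weighted
    Gaussian bound and w(x) g_s(x-y) <= C w(y) m_t(y)^(-theta) g_{2s}(x-y).  It
    dominates both S(t) and sqrt t times the derivatives of S(t); for t > 1, S(t) is
    a power of S(t/N).  The semigroup law, uniqueness and strong continuity are inherited
    from L^2 on bounded functions with compact support in O, which are dense. *)

Set Implicit Arguments.
Unset Strict Implicit.
Unset Printing Implicit Defensive.

Import Order.TTheory GRing.Theory Num.Theory.
Import numFieldNormedType.Exports.

Local Open Scope classical_set_scope.
Local Open Scope ring_scope.

(** * Euclidean norm and distance to the boundary *)

(** Arguments through H^1_0, Tonelli's theorem or L^p norms only give information at almost every x,
    whereas kernel bounds, finiteness and derivatives are needed at every x. The remedy is always
    the same. Moving x by at most sqrt t changes a Gaussian of variance c t by a constant factor,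
    provided that the variance is doubled; an estimate known at some good point within sqrt t is
    therefore carried to x. This is why pairs of constants c and 2 c run through the file, and why
    the sizes of Gaussian constants are never tracked.

    A second obstacle is the representation by G for t > 1. There G is known only through its action
    on L^2, while a compactly supported function of the weighted space need not be square integrable
    when p < 2. The kernel of the iterated operator is bounded, so that it acts on integrable
    functions; G(t,x,.) is shown to coincide with it almost everywhere. *)

Section euclidean_norm.
Context {R : realType} {n : nat}.
Implicit Types x y : 'rV[R]_n.

Lemma enorm_sqr x : enorm x ^+ 2 = \sum_(i < n) x ord0 i ^+ 2.
Proof. by rewrite sqr_sqrtr// sumr_ge0// => i _; exact: sqr_ge0. Qed.

Lemma enormN x : enorm (- x) = enorm x.
Proof.
by congr Num.sqrt; apply: eq_bigr => i _; rewrite mxE sqrrN.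
Qed.

Lemma enormC x y : enorm (x - y) = enorm (y - x).
Proof. by rewrite -enormN opprB. Qed.

Lemma enorm0 : enorm (0 : 'rV[R]_n) = 0.
Proof.
by rewrite /enorm big1 ?sqrtr0// => i _; rewrite mxE expr0n.
Qed.

(** Cauchy-Schwarz: the sum of the squares of |y| x_i - |x| y_i equals 2 |x| |y| (|x| |y| - d). The
    factor |x| |y| is cancelled when it is positive; otherwise one vector is zero. *)
Lemma dot_le_enorm x y :
  \sum_(i < n) x ord0 i * y ord0 i <= enorm x * enorm y.
Proof.
set d := \sum_(i < n) _.
have a0 := enorm_ge0 x; have b0 := enorm_ge0 y.
have key : 0 <= (enorm x * enorm y) * (enorm x * enorm y - d).
  have : 0 <= \sum_(i < n) (enorm y * x ord0 i - enorm x * y ord0 i) ^+ 2.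
    by apply: sumr_ge0 => i _; exact: sqr_ge0.
  rewrite (_ : \sum_(i < n) _ = enorm y ^+ 2 * (enorm x ^+ 2)
     + enorm x ^+ 2 * (enorm y ^+ 2) - 2 * enorm x * enorm y * d).
    nra.
  rewrite {1}(enorm_sqr x) {2}(enorm_sqr y) /d !mulr_sumr -big_split/=.
  by rewrite -sumrB; apply: eq_bigr => i _; ring.
have [ab0|ab0] := ltP 0 (enorm x * enorm y).
  by move: key; rewrite pmulr_rge0// subr_ge0.
have {}ab0 : enorm x * enorm y = 0.
  by apply/eqP; rewrite eq_le ab0 mulr_ge0.
rewrite ab0.
have z0 (z : 'rV[R]_n) : enorm z = 0 -> z = 0.
  move=> z0; apply/rowP => i; rewrite mxE; apply/eqP; rewrite -sqrf_eq0.
  have := enorm_sqr z; rewrite z0 expr0n/= => /esym/eqP.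
  rewrite psumr_eq0 => [/allP/(_ i)|j _]; last exact: sqr_ge0.
  by rewrite mem_index_enum => /(_ isT).
move/eqP: ab0; rewrite mulf_eq0 => /orP[/eqP/z0|/eqP/z0] e;
  by rewrite /d e big1// => i _; rewrite mxE ?mul0r ?mulr0.
Qed.

Lemma ler_enormD x y : enorm (x + y) <= enorm x + enorm y.
Proof.
rewrite -ler_sqr ?nnegrE ?addr_ge0 ?enorm_ge0//.
rewrite enorm_sqr sqrrD !enorm_sqr.
rewrite (eq_bigr (fun i => x ord0 i ^+ 2 + y ord0 i ^+ 2
   + 2 * (x ord0 i * y ord0 i))); last by move=> i _; rewrite mxE; ring.
rewrite !big_split/= -mulr_sumr.
have := dot_le_enorm x y; rewrite mulr2n; lra.
Qed.

Lemma ler_enorm_sub x y z : enorm (x - z) <= enorm (x - y) + enorm (y - z).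
Proof. by rewrite (le_trans _ (ler_enormD _ _))// addrA subrK. Qed.

Lemma coord_le_enorm x i : `|x ord0 i| <= enorm x.
Proof.
rewrite -ler_sqr ?nnegrE ?enorm_ge0// enorm_sqr (bigD1 i)//=.
by rewrite -normrX ger0_norm ?sqr_ge0// lerDl sumr_ge0// => j _; exact: sqr_ge0.
Qed.

Lemma coord_le_norm x i : `|x ord0 i| <= `|x|.
Proof.
rewrite [leRHS]/Num.norm/= mx_normrE.
by apply/bigmax_geP; right; exists (ord0, i).
Qed.

Lemma norm_le_enorm x : `|x| <= enorm x.
Proof.
rewrite [leLHS]/Num.norm/= mx_normrE; apply/bigmax_leP; split=> [|[i j] _ /=].
  exact: enorm_ge0.
by rewrite ord1 coord_le_enorm.
Qed.

Lemma enorm_le_norm x : enorm x <= n.+1%:R * `|x|.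
Proof.
rewrite -ler_sqr ?nnegrE ?enorm_ge0 ?mulr_ge0// enorm_sqr.
apply: (@le_trans _ _ (\sum_(i < n) `|x| ^+ 2)).
  apply: ler_sum => i _; rewrite -real_normK ?num_real// ler_sqr ?nnegrE//.
  exact: coord_le_norm.
rewrite sumr_const card_ord -[leLHS]mulr_natl [leRHS]exprMn; apply: ler_wpM2r; first exact: sqr_ge0.
by rewrite -natrX ler_nat expnS expn1 (leq_trans (leqnSn n))// leq_pmulr.
Qed.

End euclidean_norm.

Section boundary_distance.
Context {R : realType} {n : nat}.
Implicit Types (A : set 'rV[R]_n) (x y : 'rV[R]_n).

Lemma boundary_dist_ge0 A x : 0 <= boundary_dist A x.
Proof. have [A0|/set0P[z Az]] := eqVneq (boundary A) set0.
  by rewrite /boundary_dist A0 image_set0 inf0.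
apply: lb_le_inf; first by exists (enorm (x - z)), z.
by move=> _ [y _ <-]; exact: enorm_ge0. Qed.

Lemma boundary_dist_le A x y :
  boundary_dist A x <= boundary_dist A y + enorm (x - y).
Proof.
have [A0|/set0P[z Az]] := eqVneq (boundary A) set0.
  by rewrite /boundary_dist A0 !image_set0 inf0 add0r enorm_ge0.
rewrite -lerBlDr; apply: lb_le_inf; first by exists (enorm (y - z)), z.
move=> _ [z' Az' <-]; rewrite lerBlDr.
apply: (@le_trans _ _ (enorm (x - z'))).
  by apply: ge_inf; [exists 0 => _ [w _ <-]; exact: enorm_ge0|exists z'].
by rewrite [leRHS]addrC; exact: ler_enorm_sub.
Qed.

Lemma continuous_boundary_dist A : continuous (boundary_dist A).
Proof.
move=> x; apply/(@cvgrPdist_le R R _ (nbhs x)) => e e0.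
have : \forall z \near x, enorm (z - x) <= e.
  have c0 : (fun z : 'rV[R]_n => enorm (z - x)) z @[z --> x] --> enorm (x - x).
    apply: (@continuous_comp _ _ _ (fun z : 'rV[R]_n => z - x)).
      by move=> z; apply: (@continuousB R 'rV[R]_n 'rV[R]_n id (cst x)); [exact: cvg_id|exact: cst_continuous].
    exact: continuous_enorm.
  move/(@cvgrPdist_le R R _ (nbhs x)): c0 => /(_ _ e0); apply: filterS => z.
  rewrite subrr enorm0 add0r normrN ger0_norm//; exact: enorm_ge0.
apply: filterS => z ze; rewrite ler_norml; apply/andP; split.
  by have := boundary_dist_le A z x; lra.
by have := boundary_dist_le A x z; rewrite enormC; lra.
Qed.

(** With an empty boundary [A] would be clopen. Its preimage under the line through [x] and an
    arbitrary [z] would be a nonempty clopen subset of the reals, hence everything, and [A] would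
    contain [z]. *)
Lemma boundary_neq0 A x : open A -> A x -> A <> setT -> boundary A !=set0.
Proof.
move=> oA Ax AT; apply/set0P/eqP => bA; apply: AT.
have iA : A^° = A by exact/interior_id.
have cA : closed A.
  apply/closure_id; apply/seteqP; split=> [|z cz]; first exact: subset_closure.
  apply: contrapT => Az; have : boundary A z by split=> //; rewrite iA.
  by rewrite bA.
apply/seteqP; split=> // z _.
pose f (t : R) : 'rV[R]_n := x + t *: (z - x).
have cf : continuous f.
  move=> t; apply: cvgD; first exact: cvg_cst.
  by apply: cvgZr_tmp; exact: cvg_id.
have /continuousP of_ := cf.
have : f @^-1` A = setT.
  have cT : connected [set: R].
    by apply/connected_intervalP => // a b _ _ c _.
  apply: cT => //.
  - by exists 0; rewrite /= /f scale0r addr0.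
  - by exists (f @^-1` A); [exact: of_|rewrite setTI].
  - by exists (f @^-1` A); [by apply: preimage_closed => // t _; exact: cf|rewrite setTI].
move=> /seteqP[_ /(_ 1 I)]; rewrite /= /f scale1r addrC subrK//.
Qed.

Lemma boundary_dist_gt0 A x :
  open A -> A x -> A <> setT -> 0 < boundary_dist A x.
Proof.
move=> oA Ax AT; have [b Ab] := boundary_neq0 oA Ax AT.
have /nbhs_ballP[e /= e0 eA] : nbhs x A by exact: open_nbhs_nbhs.
apply: (lt_le_trans e0); apply: lb_le_inf; first by exists (enorm (x - b)), b.
move=> _ [y [_ Ay] <-]; rewrite leNgt; apply/negP => xy; apply: Ay.
have -> : A^° = A by exact/interior_id.
apply: eA; rewrite -ball_normE/=.
exact: le_lt_trans (norm_le_enorm _) xy.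
Qed.

End boundary_distance.

(** * Pointwise bounds on Gaussians and weights *)

Section gaussian_bounds.
Context {R : realType} {n : nat}.
Implicit Types z : 'rV[R]_n.

Lemma gaussian_gt0 (s : R) z : 0 < s -> 0 < gaussian s z.
Proof.
by move=> s0; rewrite mulr_gt0 ?expR_gt0// powR_gt0// !mulr_gt0// pi_gt0.
Qed.

Lemma gaussian_ge0 (s : R) z : 0 <= gaussian s z.
Proof. by rewrite mulr_ge0 ?powR_ge0 ?expR_ge0. Qed.

Lemma gaussianN (s : R) z : gaussian s (- z) = gaussian s z.
Proof. by rewrite /gaussian enormN. Qed.

(** Half of the exponent is set aside: the factor exp(-|z|^2 / (4 s)) absorbs shifts and polynomial
    growth, and gives smallness far away, at the price of a doubled variance. *)
Lemma gaussian_double (s : R) z : 0 < s ->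
  gaussian s z = 2 `^ (n%:R / 2) * expR (- (enorm z ^+ 2 / (4 * s))) *
                 gaussian (2 * s) z.
Proof.
move=> s0; rewrite /gaussian.
have -> : 2 * pi * (2 * s) = 2 * (2 * pi * s) :> R by ring.
rewrite [in RHS]powRM// ?powRN; last by rewrite !mulr_ge0 ?pi_ge0 ?ltW.
have p2 : 2 `^ (n%:R / 2) != 0 :> R by rewrite gt_eqF// powR_gt0.
have p3 : (2 * pi * s) `^ (n%:R / 2) != 0 :> R.
  by rewrite gt_eqF// powR_gt0// !mulr_gt0// pi_gt0.
rewrite (_ : - enorm z ^+ 2 / (2 * s) =
  - (enorm z ^+ 2 / (4 * s)) + (- enorm z ^+ 2 / (2 * (2 * s)))); last first.
  by field; rewrite gt_eqF.
rewrite expRD; field.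
by rewrite p2 p3.
Qed.

(** Rests on |z2|^2 <= 2 |z1|^2 + 2 |z1 - z2|^2. For s = c t and a shift of length at most sqrt t,
    the exponential factor is bounded independently of t. *)
Lemma gaussian_shift (s : R) (z1 z2 : 'rV[R]_n) : 0 < s ->
  gaussian s z1 <=
    2 `^ (n%:R / 2) * expR (enorm (z1 - z2) ^+ 2 / (2 * s)) * gaussian (2 * s) z2.
Proof.
move=> s0; rewrite gaussian_double// -[leLHS]mulrA -[leRHS]mulrA ler_pM2l ?powR_gt0//.
rewrite /gaussian [leLHS]mulrCA [leRHS]mulrCA ler_pM2l; last first.
  by rewrite powR_gt0// !mulr_gt0// pi_gt0.
rewrite -!expRD ler_expR.
rewrite -(ler_pM2r (_ : 0 < 4 * s)); last by rewrite mulr_gt0.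
rewrite [leLHS]mulrDl [leRHS]mulrDl.
have -> : - (enorm z1 ^+ 2 / (4 * s)) * (4 * s) = - enorm z1 ^+ 2.
  by field; rewrite gt_eqF.
have -> : - enorm z1 ^+ 2 / (2 * (2 * s)) * (4 * s) = - enorm z1 ^+ 2.
  by field; rewrite gt_eqF.
have -> : enorm (z1 - z2) ^+ 2 / (2 * s) * (4 * s) = 2 * enorm (z1 - z2) ^+ 2.
  by field; rewrite gt_eqF.
have -> : - enorm z2 ^+ 2 / (2 * (2 * s)) * (4 * s) = - enorm z2 ^+ 2.
  by field; rewrite gt_eqF.
have : enorm z2 <= enorm z1 + enorm (z1 - z2).
  by rewrite enormC -[X in enorm X <= _](subrK z1) addrC ler_enormD.
move=> h; have := sqr_ge0 (enorm z1 - enorm (z1 - z2)).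
have : enorm z2 ^+ 2 <= (enorm z1 + enorm (z1 - z2)) ^+ 2.
  by rewrite ler_sqr ?nnegrE ?addr_ge0 ?enorm_ge0.
nra.
Qed.

(** With r = |z| / sqrt t, one has q ln(1 + r) <= q r <= c q^2 + r^2 / (4 c), and the last term is
    the exponent set aside by [gaussian_double]. *)
Lemma gaussian_poly (q c t : R) z : 0 <= q -> 0 < c -> 0 < t ->
  (1 + enorm z / Num.sqrt t) `^ q * gaussian (c * t) z <=
    (2 `^ (n%:R / 2) * expR (c * q ^+ 2)) * gaussian (2 * (c * t)) z.
Proof.
move=> q0 c0 t0; have ct0 : 0 < c * t by rewrite mulr_gt0.
rewrite gaussian_double//; set G := gaussian _ _.
have G0 : 0 < G by rewrite gaussian_gt0// mulr_gt0.
rewrite mulrA ler_pM2r// mulrCA ler_pM2l ?powR_gt0//.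
set r := enorm z / Num.sqrt t.
have r0 : 0 <= r by rewrite divr_ge0 ?enorm_ge0 ?sqrtr_ge0.
have -> : enorm z ^+ 2 / (4 * (c * t)) = r ^+ 2 / (4 * c).
  rewrite /r expr_div_n (sqr_sqrtr (ltW t0)).
  by field; rewrite !gt_eqF.
have r1 : 0 < 1 + r by rewrite ltr_wpDr.
rewrite /powR gt_eqF// -expRD ler_expR.
have lnr : ln (1 + r) <= r by apply: le_ln1Dx; rewrite (lt_le_trans _ r0)// ltrN10.
have : q * ln (1 + r) <= q * r by rewrite ler_wpM2l.
have : q * r <= c * q ^+ 2 + r ^+ 2 / (4 * c).
  have c4 : 0 < 4 * c by rewrite mulr_gt0.
  rewrite -(ler_pM2r c4) [leRHS]mulrDl divfK ?gt_eqF//.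
  have := sqr_ge0 (2 * c * q - r); nra.
lra.
Qed.

End gaussian_bounds.

(** Peetre's inequality in scalar form; it moves the factor (1 + |x|^2)^(-delta) of the weight from
    one point to another. *)
Lemma peetre (R : realType) (x y r : R) : 0 <= x -> 0 <= y -> 0 <= r ->
  y <= x + r -> 1 + y ^+ 2 <= 2 * (1 + r) ^+ 2 * (1 + x ^+ 2).
Proof.
move=> x0 y0 r0 h; have {}h : y ^+ 2 <= (x + r) ^+ 2.
  by rewrite ler_sqr ?nnegrE ?addr_ge0.
have := sqr_ge0 (x - r).
have : 0 <= r * x ^+ 2 by rewrite mulr_ge0 ?sqr_ge0.
have : 0 <= r ^+ 2 * x ^+ 2 by rewrite mulr_ge0 ?sqr_ge0.
lra.
Qed.

Section weight_bounds.
Context {R : realType} {n : nat}.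
Variable O : domain R n.
Implicit Types x y : 'rV[R]_n.

Lemma domain_dist_gt0 x : O x -> 0 < boundary_dist O x.
Proof. by move=> Ox; apply: boundary_dist_gt0 => //; [exact: domain_open|exact: domain_proper]. Qed.

Lemma boundary_factor_ge0 (t : R) x : 0 <= boundary_factor O t x.
Proof. by rewrite le_min ler01 divr_ge0 ?boundary_dist_ge0 ?sqrtr_ge0. Qed.

Lemma boundary_factor_le1 (t : R) x : boundary_factor O t x <= 1.
Proof. by rewrite ge_min lexx. Qed.

Lemma boundary_factor_gt0 (t : R) x : 0 < t -> O x -> 0 < boundary_factor O t x.
Proof.
by move=> t0 Ox; rewrite lt_min ltr01 divr_gt0 ?domain_dist_gt0 ?sqrtr_gt0.
Qed.

(** The left side is one of the two terms on the right, according to which entry of the minimum is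
    attained. The power t^(beta / 2) later cancels the t^(-beta / 2) of the weighted Gaussian
    bound. *)
Lemma boundary_factor_powN (beta t : R) x : 0 <= beta -> 0 < t -> O x ->
  boundary_factor O t x `^ (- beta) <=
    1 + t `^ (beta / 2) * boundary_dist O x `^ (- beta).
Proof.
move=> b0 t0 Ox; rewrite /boundary_factor.
have d0 := domain_dist_gt0 Ox; have s0 : 0 < Num.sqrt t by rewrite sqrtr_gt0.
have [h|h] := leP 1 (boundary_dist O x / Num.sqrt t).
  by rewrite powR1 lerDl mulr_ge0 ?powR_ge0.
rewrite ler_wpDl// powRM ?invr_ge0 ?(ltW d0) ?(ltW s0)//.
rewrite mulrC ler_wpM2r ?powR_ge0// -[(Num.sqrt t)^-1]powR_inv1 ?(ltW s0)// -powRrM mulN1r opprK.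
by rewrite -powR12_sqrt ?(ltW t0)// -powRrM mulrC.
Qed.

Lemma weight_gt0 (theta delta : R) x : O x -> 0 < weight O theta delta x.
Proof.
move=> Ox; rewrite lt_min !powR_gt0 ?domain_dist_gt0//.
by rewrite ltr_wpDr// sqr_ge0.
Qed.

Lemma weight_le1 (theta delta : R) x : 0 <= delta -> weight O theta delta x <= 1.
Proof.
move=> d0; rewrite ge_min; apply/orP; right.
rewrite -[leRHS](powRr0 (1 + enorm x ^+ 2)); apply: ler_powR.
  by rewrite lerDl sqr_ge0.
by rewrite oppr_le0.
Qed.

(** Both rho(y) and sqrt t are at most rho(y) / m_t(y), hence rho(x) <= rho(y) + |x - y| <= (1 + r)
    rho(y) / m_t(y) with r = |x - y| / sqrt t. The polynomial part of the weight is moved by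
    [peetre]. Each entry of the minimum is bounded with the same constant. *)
Lemma weight_le_dist (theta delta t : R) x y :
  0 <= theta -> 0 <= delta -> 0 < t <= 1 -> O x -> O y ->
  weight O theta delta x <= 2 `^ delta *
    (1 + enorm (x - y) / Num.sqrt t) `^ (theta + 2 * delta) *
    boundary_factor O t y `^ (- theta) * weight O theta delta y.
Proof.
move=> th0 d0 /andP[t0 t1] Ox Oy.
set r := _ / Num.sqrt t; set m := boundary_factor O t y.
have s0 : 0 < Num.sqrt t by rewrite sqrtr_gt0.
have s1 : Num.sqrt t <= 1 by rewrite -sqrtr1 ler_sqrt.
have rE : enorm (x - y) = r * Num.sqrt t by rewrite divfK ?gt_eqF.
have r0 : 0 <= r by rewrite divr_ge0 ?enorm_ge0 ?sqrtr_ge0.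
have m0 : 0 < m by exact: boundary_factor_gt0.
have m1 : m <= 1 by exact: boundary_factor_le1.
have y0 := domain_dist_gt0 Oy; have x0 := domain_dist_gt0 Ox.
have r1 : 1 <= 1 + r by rewrite lerDl.
have r2 : 0 <= 1 + r by exact: le_trans r1.
have two1 : 1 <= 2 `^ delta :> R.
  by rewrite -[leLHS](powRr0 2); apply: ler_powR => //; rewrite ler1n.
have m2 : 1 <= m `^ (- theta).
  rewrite powRN invf_ge1 ?powR_gt0//.
  have <- : 1 `^ theta = 1 :> R by rewrite powR1.
  by rewrite ge0_ler_powR// nnegrE ltW.
have H1 : boundary_dist O x `^ theta <= (2 `^ delta *
    (1 + r) `^ (theta + 2 * delta) * m `^ (- theta)) * boundary_dist O y `^ theta.
  have h : boundary_dist O x <= (1 + r) * m^-1 * boundary_dist O y.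
    have my : boundary_dist O y <= m^-1 * boundary_dist O y.
      by rewrite ler_peMl ?(ltW y0)// invf_ge1.
    have mt : Num.sqrt t <= m^-1 * boundary_dist O y.
      rewrite mulrC ler_pdivlMr// mulrC -ler_pdivlMr//.
      by rewrite /m /boundary_factor ge_min lexx orbT.
    have := boundary_dist_le O x y; rewrite rE.
    have : r * Num.sqrt t <= r * (m^-1 * boundary_dist O y) by rewrite ler_wpM2l.
    nra.
  apply: (@le_trans _ _ (((1 + r) * m^-1 * boundary_dist O y) `^ theta)).
    by rewrite ge0_ler_powR// nnegrE ?ltW// !mulr_gt0 ?invr_gt0// (lt_le_trans _ r1).
  rewrite !powRM ?mulr_ge0 ?invr_ge0 ?(ltW m0) ?(ltW y0)//.
  rewrite ler_wpM2r ?powR_ge0// -[m^-1]powR_inv1 ?(ltW m0)// -powRrM mulN1r.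
  rewrite ler_wpM2r ?powR_ge0// -[leLHS]mul1r ler_pM ?powR_ge0//.
  by rewrite ler_powR// lerDl mulr_ge0.
have H2 : (1 + enorm x ^+ 2) `^ (- delta) <= (2 `^ delta *
    (1 + r) `^ (theta + 2 * delta) * m `^ (- theta)) *
    (1 + enorm y ^+ 2) `^ (- delta).
  have px : 0 < 1 + enorm x ^+ 2 by rewrite ltr_wpDr// sqr_ge0.
  have py : 0 < 1 + enorm y ^+ 2 by rewrite ltr_wpDr// sqr_ge0.
  apply: (@le_trans _ _ (2 `^ delta * (1 + r) `^ (2 * delta) *
      (1 + enorm y ^+ 2) `^ (- delta))); last first.
    rewrite ler_wpM2r ?powR_ge0// -mulrA ler_wpM2l ?powR_ge0//.
    rewrite -[leLHS]mulr1 ler_pM ?powR_ge0//.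
    by rewrite ler_powR// lerDr.
  rewrite !powRN -[leLHS]mul1r.
  rewrite ler_pdivrMr ?powR_gt0// mulrAC ler_pdivlMr ?powR_gt0// mul1r.
  rewrite powRrM powR_mulrn ?(le_trans ler01 r1)//.
  rewrite -!powRM ?mulr_ge0 ?sqr_ge0 ?(ltW px)//.
  rewrite ge0_ler_powR ?nnegrE ?mulr_ge0 ?sqr_ge0 ?(ltW px) ?(ltW py)//.
  (* Here t <= 1 matters: |x - y| = r sqrt t is at most r. *)
  have : enorm y <= enorm x + r.
    apply: (@le_trans _ _ (enorm x + enorm (x - y))).
      by rewrite enormC -[X in enorm X <= _](subrK x) addrC ler_enormD.
    by rewrite lerD2l rE ler_piMr.
  by move=> h; rewrite peetre// enorm_ge0.
rewrite {1}/weight.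
set k := 2 `^ delta * _ * _ in H1 H2 *.
have k0 : 0 <= k by rewrite !mulr_ge0 ?powR_ge0.
by rewrite minr_pMr// le_min !ge_min H1 H2 orbT.
Qed.

Lemma weight_gaussian (theta delta c : R) :
  0 <= theta -> 0 <= delta -> 0 < c ->
  exists2 C, 0 < C & forall t x y, 0 < t <= 1 -> O x -> O y ->
  weight O theta delta x * gaussian (c * t) (x - y) <=
    C * (boundary_factor O t y `^ (- theta) * weight O theta delta y *
         gaussian (2 * c * t) (x - y)).
Proof.
move=> th0 d0 c0.
exists (2 `^ delta * (2 `^ (n%:R / 2) * expR (c * (theta + 2 * delta) ^+ 2))).
  by rewrite !mulr_gt0 ?powR_gt0 ?expR_gt0.
move=> t x y t01 Ox Oy; have /andP[t0 _] := t01.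
have h1 := weight_le_dist th0 d0 t01 Ox Oy.
have q0 : 0 <= theta + 2 * delta by rewrite addr_ge0 ?mulr_ge0.
have h2 := gaussian_poly (x - y) q0 c0 t0.
apply: (le_trans (ler_wpM2r (gaussian_ge0 _ _) h1)).
set P := _ `^ (theta + 2 * delta) in h2 *.
set m := _ `^ (- theta); set w := weight _ _ _ y.
have mw : 0 <= 2 `^ delta * m * w by rewrite !mulr_ge0 ?powR_ge0 ?weight_ge0.
have := ler_wpM2l mw h2.
rewrite -[2 * c * t]mulrA.
set g1 := gaussian _ _; set g2 := gaussian _ _.
congr (_ <= _); ring.
Qed.

End weight_bounds.

(** * Lebesgue measure on a domain and on row vectors *)

Lemma ge0_le_integralZ d (T : measurableType d) (R : realType)
    (m : {measure set T -> \bar R}) (f g : T -> R) (k : R) :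
  measurable_fun setT f -> measurable_fun setT g ->
  (forall x, 0 <= f x) -> (forall x, 0 <= g x) -> 0 <= k ->
  {ae m, forall x, f x <= k * g x} ->
  (\int[m]_x (f x)%:E <= k%:E * \int[m]_x (g x)%:E)%E.
Proof.
move=> mf mg f0 g0 k0 fg; rewrite -ge0_integralZl_EFin//; last 2 first.
- by move=> x _; rewrite lee_fin.
- exact/measurable_EFinP.
apply: ae_ge0_le_integral => //.
- by move=> x _; rewrite lee_fin.
- exact/measurable_EFinP.
- by move=> x _; rewrite -EFinM lee_fin mulr_ge0.
- by apply/measurable_EFinP; exact: measurable_funM.
- by apply: filterS fg => x fgx _; rewrite -EFinM lee_fin.
Qed.

Section density.
Local Open Scope ereal_scope.
Context d (T : measurableType d) (R : realType).
Variables (m m' : {measure set T -> \bar R}) (w : T -> R).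
Hypothesis mw : measurable_fun setT w.
Hypothesis w0 : forall x, (0 <= w x)%R.
Hypothesis m'E : forall A, measurable A -> m' A = \int[m]_(x in A) (w x)%:E.

Import HBNNSimple.

(** From sets to simple functions to monotone limits. Both [lebesgue_on], whose density is the
    indicator of the domain, and [weighted_lebesgue] are instances. *)
Lemma ge0_integral_density (f : T -> \bar R) :
  measurable_fun setT f -> (forall x, 0 <= f x) ->
  \int[m']_x f x = \int[m]_x (f x * (w x)%:E).
Proof.
move=> mf f0; pose h := nnsfun_approx measurableT mf.
have mw' : measurable_fun setT (EFin \o w) by exact/measurable_EFinP.
have -> : \int[m']_x f x = lim (\int[m']_x (h n x)%:E @[n --> \oo]).
  have fE x : f x = lim ((EFin \o h n) x @[n --> \oo]).
    by apply/esym/cvg_lim => //; exact: cvg_nnsfun_approx.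
  under eq_integral => x _ do rewrite fE.
  apply: monotone_convergence => //.
  - by move=> n; exact/measurable_EFinP.
  - by move=> n x _ /=; rewrite lee_fin.
  - by move=> x _ a b ab; rewrite lee_fin; exact/lefP/nd_nnsfun_approx.
have -> : \int[m]_x (f x * (w x)%:E) =
    lim (\int[m]_x ((h n x)%:E * (w x)%:E) @[n --> \oo]).
  have fE x : f x * (w x)%:E = lim (((h n x)%:E * (w x)%:E) @[n --> \oo]).
    apply/esym/cvg_lim => //; apply: cvgeZr => //.
    exact: cvg_nnsfun_approx.
  under eq_integral => x _ do rewrite fE.
  apply: monotone_convergence => //.
  - by move=> n; apply: emeasurable_funM => //; exact/measurable_EFinP.
  - by move=> n x _ /=; rewrite mule_ge0 ?lee_fin.
  - move=> x _ a b ab; rewrite lee_wpmul2r ?lee_fin//.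
    exact/lefP/nd_nnsfun_approx.
congr (limn _); apply/funext => n.
have indich r : measurable_fun setT (fun x => (r * \1_(h n @^-1` [set r]) x)%:E).
  by apply/measurable_EFinP; exact: measurable_funM.
transitivity (\int[m']_x
   (\sum_(y \in range (h n)) (y * \1_(h n @^-1` [set y]) x)%:E)).
  by apply: eq_integral => t tE; rewrite /= fimfunE -fsumEFin.
rewrite ge0_integral_fsum//; last by move=> y x _; exact: nnfun_muleindic_ge0.
transitivity (\int[m]_x (\sum_(y \in range (h n))
    (y * \1_(h n @^-1` [set y]) x)%:E * (w x)%:E)); last first.
  apply: eq_integral => x _.
  rewrite -ge0_mule_fsuml => [|y]; last exact: nnfun_muleindic_ge0.
  by rewrite fsumEFin // -(fimfunE _ x).
rewrite ge0_integral_fsum//; last 2 first.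
  - by move=> y; apply: emeasurable_funM.
  - by move=> y x _; rewrite mule_ge0 ?nnfun_muleindic_ge0// lee_fin.
apply: eq_fsbigr => r rhn.
under eq_integral do rewrite EFinM.
rewrite integralZl_indic_nnsfun//.
under [RHS]eq_integral do rewrite EFinM -muleA.
have r0 : (0 <= r)%R by move: rhn; rewrite inE => -[t _ <-].
rewrite ge0_integralZl//.
- rewrite integral_indic// setIT m'E// integral_mkcond; congr (_ * _).
  by apply: eq_integral => x _; rewrite epatch_indic/= muleC.
- by apply: emeasurable_funM => //; exact/measurable_EFinP.
- by move=> t _; rewrite mule_ge0 ?lee_fin.
Qed.

End density.

Section lebesgue_on.
Context {R : realType} {n : nat}.
Variable O : domain R n.
Local Notation L := (lebesgue_rV R n).
Local Notation nu := (lebesgue_on O).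

Lemma measurable_domain : measurable (O : set 'rV[R]_n).
Proof. exact: open_measurable_rV (domain_open O). Qed.

Lemma lebesgue_on_sigma_finite : sigma_finite setT nu.
Proof.
have /sigma_finiteP[F [TF ndF Foo]] := sigma_finiteT L.
exists F => // k; have [mF Fk] := Foo k; split => //.
apply: le_lt_trans Fk; rewrite /lebesgue_on /mrestr le_measure ?inE//.
by apply: measurableI => //; exact: measurable_domain.
Qed.

HB.instance Definition _ := Measure_isSigmaFinite.Build _ _ _ nu
  lebesgue_on_sigma_finite.

Lemma ge0_integral_lebesgue_on (f : 'rV[R]_n -> \bar R) :
  measurable_fun setT f -> (forall x, 0 <= f x)%E ->
  (\int[nu]_x f x = \int[L]_(x in O) f x)%E.
Proof.
move=> mf f0.
rewrite (@ge0_integral_density _ _ _ L nu (\1_O))//.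
- rewrite [RHS]integral_mkcond; apply: eq_integral => x _.
  by rewrite epatch_indic.
- by apply: measurable_indic; exact: measurable_domain.
- by move=> A mA; rewrite (integral_indic L mA measurable_domain) setIC.
Qed.

Lemma lebesgue_on_ae (P : 'rV[R]_n -> Prop) :
  {ae nu, forall x, P x} <-> {ae L, forall x, O x -> P x}.
Proof.
have mO := measurable_domain.
split=> [[N [mN N0 PN]]|[N [mN N0 PN]]].
  exists (N `&` O); split=> //; first exact: measurableI.
  by move=> x /not_implyP[Ox nPx]; split => //; exact: PN.
exists (N `|` ~` O); split.
- by apply: measurableU => //; exact: measurableC.
- rewrite /lebesgue_on /mrestr setIUl setICl setU0.
  by apply: (subset_measure0 _ _ _ N0) => //; exact: measurableI.
- move=> x nPx; have [Ox|] := pselect (O x); last by right.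
  by left; apply: PN => /(_ Ox).
Qed.

Lemma ae_in_domain : {ae nu, forall x, O x}.
Proof. by apply/lebesgue_on_ae; exact: aeW. Qed.

Variables (theta delta : R).
Local Notation w := (weight O theta delta).
Local Notation mu := (weighted_lebesgue O theta delta).

Lemma ge0_integral_weighted (f : 'rV[R]_n -> \bar R) :
  measurable_fun setT f -> (forall x, 0 <= f x)%E ->
  (\int[mu]_x f x = \int[nu]_x (f x * (w x)%:E))%E.
Proof.
move=> mf f0; apply: ge0_integral_density => //.
- exact: measurable_weight.
- by move=> x; exact: weight_ge0.
Qed.

(** The weight is positive on the domain, so that both measures have the same null sets and
    statements pass freely between L^2 and the weighted space. *)
Lemma weighted_ae (P : 'rV[R]_n -> Prop) :
  {ae mu, forall x, P x} <-> {ae nu, forall x, P x}.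
Proof.
have mO := measurable_domain.
have mw A : measurable A -> measurable_fun A (EFin \o w).
  move=> mA; apply/measurable_EFinP; apply: measurable_funTS.
  exact: measurable_weight.
split=> [[N [mN N0 PN]]|[N [mN N0 PN]]]; last first.
  exists N; split => //; rewrite /= /weighted_lebesgue.
  transitivity (\int[nu]_(x in N) `|(EFin \o w) x|)%E.
    by apply: eq_integral => x _; rewrite /= ger0_norm// weight_ge0.
  by apply: integral_abs_eq0 => //; exact: mw.
have {N0} : (\int[nu]_(x in N) `|(EFin \o w) x| = 0)%E.
  rewrite -[RHS]N0 /= /weighted_lebesgue.
  by apply: eq_integral => x _; rewrite /= ger0_norm// weight_ge0.
move=> /(ae_eq_integral_abs nu mN (mw _ mN)) H.
have := ae_in_domain; apply: filterS2 H => x wx Ox.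
apply: contrapT => nPx; have /wx /= [] : N x by exact: PN.
by apply/eqP; rewrite gt_eqF// weight_gt0.
Qed.

End lebesgue_on.

(** * Slicing row vectors along the first coordinate *)

Section rV_cons_theory.
Context {R : realType} {n : nat}.
Implicit Types (z : R * 'rV[R]_n).

Lemma rV_cons0 z i : rV_cons z i ord0 = z.1.
Proof. by rewrite (ord1 i); have := rV_consK z => /(congr1 fst). Qed.

Lemma rV_cons_lift z i j : rV_cons z i (lift ord0 j) = z.2 ord0 j.
Proof.
rewrite (ord1 i); have := rV_consK z => /(congr1 snd).
by move=> /(congr1 (fun v : 'rV[R]_n => v ord0 j)); rewrite mxE.
Qed.

Lemma rV_unconsK : cancel (@rV_uncons R n) (@rV_cons R n).
Proof.
move=> x; apply/rowP => j; case: (unliftP ord0 j) => [k|] ->.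
  by rewrite rV_cons_lift mxE.
by rewrite rV_cons0.
Qed.

Lemma rV_consB z z' : rV_cons z - rV_cons z' = rV_cons (z.1 - z'.1, z.2 - z'.2).
Proof.
apply/rowP => j; case: (unliftP ord0 j) => [k|] ->.
  by rewrite mxE [X in _ + X]mxE !rV_cons_lift !mxE.
by rewrite mxE [X in _ + X]mxE !rV_cons0.
Qed.

Lemma rV_cons_shift (s h : R) (v : 'rV[R]_n) :
  rV_cons (s + h, v) = rV_cons (s, v) + h *: delta_mx ord0 ord0.
Proof.
apply/rowP => j; case: (unliftP ord0 j) => [k|] ->.
  by rewrite [RHS]mxE [X in _ = _ + X]mxE !rV_cons_lift !mxE/= mulr0 addr0.
by rewrite [RHS]mxE [X in _ = _ + X]mxE !rV_cons0 !mxE/= mulr1.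
Qed.

Lemma enorm_cons z : enorm (rV_cons z) ^+ 2 = z.1 ^+ 2 + enorm z.2 ^+ 2.
Proof.
rewrite !enorm_sqr big_ord_recl rV_cons0; congr (_ + _).
by apply: eq_bigr => j _; rewrite rV_cons_lift.
Qed.

Lemma gaussian_cons (s : R) z : 0 < s ->
  gaussian s (rV_cons z) = normal_pdf 0 (Num.sqrt s) z.1 * gaussian s z.2.
Proof.
move=> s0; have ss : Num.sqrt s != 0 by rewrite gt_eqF// sqrtr_gt0.
rewrite normal_pdfE// /normal_peak /normal_fun /gaussian enorm_cons subr0.
rewrite (sqr_sqrtr (ltW s0)).
have p0 : 0 < 2 * pi * s by rewrite !mulr_gt0// pi_gt0.
have -> : - (n.+1%:R / 2) = - (2^-1) + - (n%:R / 2) :> R by rewrite -natr1; field.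
rewrite powRD; last by rewrite (gt_eqF p0) implybT.
have -> : (2 * pi * s) `^ (- 2^-1) = (Num.sqrt (s * pi *+ 2))^-1.
  by rewrite powRN powR12_sqrt ?(ltW p0)//; congr (Num.sqrt _)^-1; rewrite -mulr_natl; ring.
rewrite mulrACA -expRD; congr (_ * expR _).
by rewrite -mulr_natl; field; rewrite gt_eqF.
Qed.

Lemma ge0_integral_rV_S (f : 'rV[R]_n.+1 -> \bar R) :
  measurable_fun setT f -> (forall x, 0 <= f x)%E ->
  (\int[lebesgue_rV R n.+1]_x f x =
   \int[lebesgue_measure]_s \int[lebesgue_rV R n]_v f (rV_cons (s, v)))%E.
Proof.
move=> mf f0.
transitivity (\int[lebesgue_measure \x lebesgue_rV R n]_z f (rV_cons z))%E.
  have := @ge0_integral_pushforward _ _ (measurableTypeR R * 'rV[R]_n)%type _ R (@rV_cons R n)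
    (@measurable_rV_cons R n) (lebesgue_measure \x lebesgue_rV R n)%E setT f
    measurableT mf (fun y _ => f0 y).
  by rewrite preimage_setT => <-.
apply: (fubini_tonelli1 (m1 := lebesgue_measure) (m2 := lebesgue_rV R n)
  (f \o @rV_cons R n)) => [|z]; last exact: f0.
by apply: measurableT_comp => //; exact: measurable_rV_cons.
Qed.

End rV_cons_theory.

Lemma continuous_enorm_sub (R : realType) n (x : 'rV[R]_n) :
  continuous (fun y : 'rV[R]_n => enorm (x - y)).
Proof.
move=> y; apply: (@continuous_comp _ _ _ (fun y : 'rV[R]_n => x - y)); last first.
  exact: continuous_enorm.
apply: (@continuousB R 'rV[R]_n 'rV[R]_n (cst x) id); last exact: cvg_id.
exact: cst_continuous.
Qed.

Lemma measurable_enorm_sub (R : realType) n :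
  measurable_fun setT (fun xy : 'rV[R]_n * 'rV[R]_n => enorm (xy.1 - xy.2)).
Proof.
apply: (measurableT_comp (f := fun z : 'rV[R]_n => enorm z)
  (g := fun xy : 'rV[R]_n * 'rV[R]_n => xy.1 - xy.2)).
  by apply: continuous_measurable_rV; exact: continuous_enorm.
apply: measurable_fun_rV => i.
have mc : measurable_fun setT (fun v : 'rV[R]_n => v ord0 i).
  by apply: continuous_measurable_rV; apply: coord_continuous.
under eq_fun do rewrite mxE.
apply: measurable_funD; first exact: (measurableT_comp mc measurable_fst).
under eq_fun do rewrite mxE.
by apply: measurableT_comp => //; exact: (measurableT_comp mc measurable_snd).
Qed.

Lemma measurable_gaussian_sub (R : realType) n (s : R) :
  measurable_fun setT (fun xy : 'rV[R]_n * 'rV[R]_n => gaussian s (xy.1 - xy.2)).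
Proof.
apply: measurable_funM; first exact: measurable_cst.
apply: measurableT_comp; first exact: measurable_expR.
apply: measurable_funM; last exact: measurable_cst.
apply: measurableT_comp => //; apply: measurable_funX.
exact: measurable_enorm_sub.
Qed.

Lemma measurable_gaussian_subr (R : realType) n (s : R) (x : 'rV[R]_n) :
  measurable_fun setT (fun y : 'rV[R]_n => gaussian s (x - y)).
Proof.
exact: (measurableT_comp (@measurable_gaussian_sub R n s) (pair1_measurable x)).
Qed.

Lemma integral_gaussian (R : realType) n (s : R) (x : 'rV[R]_n) : 0 < s ->
  (\int[lebesgue_rV R n]_y (gaussian s (x - y))%:E = 1)%E.
Proof.
move=> s0; elim: n x => [|n IH] x.
  rewrite integral_dirac//; last first.
    by apply/measurable_EFinP; exact: measurable_gaussian_subr.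
  rewrite diracT mul1e /gaussian mul0r oppr0 powRr0 mul1r.
  by rewrite (_ : enorm _ = 0) ?expr0n ?oppr0 ?mul0r ?expR0// /enorm big_ord0 sqrtr0.
rewrite ge0_integral_rV_S//; last 2 first.
- by apply/measurable_EFinP; exact: measurable_gaussian_subr.
- by move=> y; rewrite lee_fin gaussian_ge0.
rewrite -[x]rV_unconsK; move: (rV_uncons x) => [u v] {x}.
transitivity (\int[lebesgue_measure]_t (normal_pdf u (Num.sqrt s) t)%:E)%E; last first.
  exact: integral_normal_pdf.
apply: eq_integral => t _.
under eq_integral do rewrite rV_consB/= gaussian_cons//= EFinM.
rewrite ge0_integralZl_EFin//; last 3 first.
- by move=> y _; rewrite lee_fin gaussian_ge0.
- by apply/measurable_EFinP; exact: measurable_gaussian_subr.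
- exact: normal_pdf_ge0.
rewrite IH mule1; congr EFin.
have ss : Num.sqrt s != 0 by rewrite gt_eqF// sqrtr_gt0.
rewrite !normal_pdfE//; congr (_ * expR _).
by rewrite subr0 -sqrrN opprB.
Qed.

(** * Open sets and hyperplanes under Lebesgue measure *)

Section positivity.
Context {R : realType}.

Lemma lebesgue_rV_box_gt0 n (x : 'rV[R]_n) (e : R) : 0 < e ->
  (0 < lebesgue_rV R n [set y : 'rV[R]_n | forall i, (`|x ord0 i - y ord0 i| < e)%R])%E.
Proof.
move=> e0; elim: n x => [|n IH] x.
  by rewrite /= diracE mem_set// => -[].
rewrite /= /lebesgue_rV_S /pushforward.
have -> : @rV_cons R n @^-1` [set y : 'rV[R]_n.+1 | forall i, `|x ord0 i - y ord0 i| < e] =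
    ball (x ord0 ord0) e `*`
    [set v : 'rV[R]_n | forall i, `|(rV_uncons x).2 ord0 i - v ord0 i| < e].
  apply/seteqP; split => [[s v] /= h|[s v] /= [h1 h2] i].
    split; first by have := h ord0; rewrite rV_cons0.
    by move=> i; have := h (lift ord0 i); rewrite rV_cons_lift mxE.
  case: (unliftP ord0 i) => [k|] ->; last by rewrite rV_cons0.
  by rewrite rV_cons_lift; have := h2 k; rewrite mxE.
have mB m (x' : 'rV[R]_m) : measurable [set v : 'rV[R]_m |
    forall i, `|x' ord0 i - v ord0 i| < e].
  rewrite (_ : mkset _ = \bigcap_(i in [set: 'I_m])
    ((fun v : 'rV[R]_m => v ord0 i) @^-1` ball (x' ord0 i : R) e)).
    apply: fin_bigcap_measurable => // i _; rewrite -[X in measurable X]setTI.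
    have := @continuous_measurable_rV R m (fun v => v ord0 i).
    apply=> //; first by apply: coord_continuous.
    by apply: open_measurable; exact: ball_open.
  by apply/seteqP; split => [v h i _|v h i]; exact: h.
rewrite product_measure1E; [|exact: measurable_ball|exact: mB].
apply: mule_gt0; last exact: IH.
apply: (@lt_le_trans _ _ (e *+ 2)%:E); first by rewrite lte_fin mulrn_wgt0.
by rewrite -(lebesgue_measure_ball (x ord0 ord0) (ltW e0)).
Qed.

(** Full support of the measure is what allows an almost everywhere statement to be used at some
    point arbitrarily close to a prescribed one, as in [ae_open_point]. *)
Lemma lebesgue_rV_open_gt0 n (U : set 'rV[R]_n) (x : 'rV[R]_n) :
  open U -> U x -> (0 < lebesgue_rV R n U)%E.
Proof.
move=> oU Ux.
have /nbhs_ballP[e /= e0 eU] : nbhs x U by exact: open_nbhs_nbhs.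
apply: (lt_le_trans (lebesgue_rV_box_gt0 x e0)).
have bE : [set y : 'rV[R]_n | forall i, `|x ord0 i - y ord0 i| < e] = ball x e.
  apply/seteqP; split => y /= h; first by split => // i j; rewrite ord1; exact: h.
  by move=> i; case: h => _ /(_ ord0 i).
rewrite bE le_measure// inE; apply: open_measurable_rV => //.
exact: ball_open.
Qed.

(** Discards the points y with the same first coordinate as x, which no half-space argument in
    [kernel_bound] reaches. *)
Lemma lebesgue_rV_hyperplane n (a : R) :
  lebesgue_rV R n.+1 [set y : 'rV[R]_n.+1 | y ord0 ord0 = a] = 0%E.
Proof.
rewrite /= /lebesgue_rV_S /pushforward.
rewrite (_ : _ @^-1` _ = [set a] `*` setT).
  by rewrite product_measure1E// [X in (X * _)%E](lebesgue_measure_set1 a) mul0e.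
apply/seteqP; split => [[s v]/=|[s v]/= [h _]]; by rewrite rV_cons0.
Qed.

End positivity.

(** * A countable family of boxes generating the Borel sets *)

Section rational_boxes.
Context {R : realType} {n : nat}.

Definition rational_box (q r : 'rV[rat]_n) : set 'rV[R]_n :=
  [set y | forall i, ratr (q ord0 i) < y ord0 i < ratr (r ord0 i)].

Lemma measurable_rational_box q r : measurable (rational_box q r).
Proof.
rewrite (_ : rational_box q r = \bigcap_(i in [set: 'I_n])
    ((fun v : 'rV[R]_n => v ord0 i) @^-1`
      `]ratr (q ord0 i), ratr (r ord0 i)[%classic)).
  apply: fin_bigcap_measurable => // i _; rewrite -[X in measurable X]setTI.
  have := @continuous_measurable_rV R n (fun v => v ord0 i).
  by apply=> //; apply: coord_continuous.
apply/seteqP; split => [v h i _|v h i] /=; first by rewrite in_itv/=; exact: h.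
by have := h i I; rewrite /= in_itv.
Qed.

Lemma open_bigcup_rational_box (U : set 'rV[R]_n) : open U ->
  U = \bigcup_(qr in [set qr | rational_box qr.1 qr.2 `<=` U])
        rational_box qr.1 qr.2.
Proof.
move=> oU; apply/seteqP; split => [y Uy|y [qr /= qrU /qrU]//].
have /nbhs_ballP[e /= e0 eU] : nbhs y U by exact: open_nbhs_nbhs.
have e20 : 0 < e / 2 by rewrite divr_gt0.
have /choice[q qP] : forall i, exists q : rat,
    ratr q < y ord0 i < ratr q + e / 2.
  move=> i; have [|q] := @rat_in_itvoo R (y ord0 i - e / 2) (y ord0 i).
    by rewrite ltrBlDr ltrDl.
  by rewrite in_itv/= => /andP[q1 q2]; exists q; rewrite q2 -ltrBlDr.
have /choice[r rP] : forall i, exists r : rat,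
    y ord0 i < ratr r < y ord0 i + e / 2.
  move=> i; have [|r] := @rat_in_itvoo R (y ord0 i) (y ord0 i + e / 2).
    by rewrite ltrDl.
  by rewrite in_itv/= => h; exists r.
exists (\row_i q i, \row_i r i) => /= [z /= zB|i]; last first.
  by rewrite !mxE; have /andP[-> _] := qP i; have /andP[-> _] := rP i.
apply: eU; split => // i j; rewrite ord1 /ball/= ltr_distlC.
have := zB j; have := qP j; have := rP j; rewrite !mxE.
by move=> /andP[h1 h2] /andP[h3 h4] /andP[h5 h6]; apply/andP; split; lra.
Qed.

Definition rational_boxes : set (set 'rV[R]_n) :=
  [set rational_box qr.1 qr.2 | qr in [set: 'rV[rat]_n * 'rV[rat]_n]].

Lemma setI_closed_rational_boxes : setI_closed rational_boxes.
Proof.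
move=> _ _ [[q r] _ <-] [[q' r'] _ <-] /=.
exists (\row_i Num.max (q ord0 i) (q' ord0 i),
        \row_i Num.min (r ord0 i) (r' ord0 i)) => //=.
apply/seteqP; split => [y h|y [h h'] i].
  split=> i; have := h i; rewrite !mxE => /andP[].
    by rewrite maxEge minEge; do 2 case: ifP;
       rewrite -(@ler_rat R) => h1; rewrite -(@ler_rat R) => h2 h3 h4;
       apply/andP; split => //; lra.
  by rewrite maxEge minEge; do 2 case: ifP;
       rewrite -(@ler_rat R) => h1; rewrite -(@ler_rat R) => h2 h3 h4;
       apply/andP; split => //; lra.
rewrite !mxE; have /andP[h1 h2] := h i; have /andP[h3 h4] := h' i.
by apply/andP; split; [rewrite maxEge|rewrite minEge]; case: ifP.
Qed.

Lemma measurable_rational_boxes :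
  @measurable _ 'rV[R]_n = <<s rational_boxes >>.
Proof.
apply/seteqP; split; last first.
  apply: smallest_sub; first exact: sigma_algebra_measurable.
  by move=> _ [[q r] _ <-]; exact: measurable_rational_box.
apply: smallest_sub; first exact: smallest_sigma_algebra.
move=> U oU; rewrite (open_bigcup_rational_box oU) bigcup_mkcond.
apply: (@countable_bigcupT_measurable _ (g_sigma_algebraType rational_boxes)).
  exact: countableP.
move=> [q r]; case: ifP => _; last exact: measurable0.
by apply: sub_sigma_algebra; exists (q, r).
Qed.

(* The boxes form a countable family, so that this can be applied to almost every
   section of a kernel simultaneously. *)
Lemma ae_eq0_of_box_integral (m : {measure set 'rV[R]_n -> \bar R})
    (h : 'rV[R]_n -> R) :
  m.-integrable setT (EFin \o h) ->
  (\int[m]_y (h y)%:E = 0)%E ->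
  (forall q r, (\int[m]_(y in rational_box q r) (h y)%:E = 0)%E) ->
  {ae m, forall y, h y = 0}.
Proof.
move=> ih hT hB.
have hS (A : set 'rV[R]_n) : measurable A -> (\int[m]_(y in A) (h y)%:E = 0)%E.
  move=> mA.
  apply: (@dynkin_induction _ _ rational_boxes
    (fun A => (\int[m]_(y in A) (h y)%:E = 0)%E)) => //.
  - exact: measurable_rational_boxes.
  - exact: setI_closed_rational_boxes.
  - by move=> _ [[q r] _ <-]; exact: hB.
  - move=> S mS S0; move: hT; rewrite -(setUv S) integral_setU//.
    + by rewrite S0 add0e.
    + exact: measurableC.
    + by apply: measurable_funTS; exact: measurable_int ih.
    + by apply/disj_setPCl.
  - move=> F mF tF F0; rewrite integral_bigcup//.
      by under eq_eseriesr do rewrite F0; rewrite eseries0.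
    by apply: integrableS ih => //; exact: bigcupT_measurable.
  - by rewrite -measurable_rational_boxes.
have := @integral_ae_eq _ _ _ m setT measurableT (cst 0%E) _ ih.
move=> /(_ (measurable_cst _)) [E _ mE|].
  by rewrite hS// integral0.
by move=> N [mN N0 hN]; exists N; split => // y hy; apply: hN => /(_ I) /= [].
Qed.

End rational_boxes.

(** * The Schur test *)

(** Hoelder's inequality for q u = q^(1/p') (q^(1/p) u). The case p = 1 is separate since the
    conjugate exponent p' = p / (p - 1) is then infinite. *)
Lemma integral_powR_le d (T : measurableType d) (R : realType)
    (m : {measure set T -> \bar R}) (q u : T -> R) (A p : R) :
  measurable_fun setT q -> measurable_fun setT u ->
  (forall x, 0 <= q x) -> (forall x, 0 <= u x) -> 0 < A -> 1 <= p ->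
  (\int[m]_x (q x)%:E <= A%:E)%E ->
  ((\int[m]_x (q x * u x)%:E) `^ p <=
    (A `^ (p - 1))%:E * \int[m]_x (q x * u x `^ p)%:E)%E.
Proof.
move=> mq mu q0 u0 A0 p1 qA.
have quI0 : (0 <= \int[m]_x (q x * u x)%:E)%E.
  by apply: integral_ge0 => x _; rewrite lee_fin mulr_ge0.
move: p1; rewrite le_eqVlt => /predU1P[<-|p1].
  rewrite subrr powRr0 mul1e poweRe1//.
  by under [leRHS]eq_integral do rewrite powRr1//.
have p0 : 0 < p by exact: lt_trans p1.
have p10 : 0 < p - 1 by rewrite subr_gt0.
pose p' := p / (p - 1).
have p'0 : 0 < p' by rewrite divr_gt0.
have pE : p'^-1 + p^-1 = 1.
  by rewrite /p'; field; rewrite !gt_eqF.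
have mqp r : measurable_fun setT (fun x => q x `^ r).
  by apply: (measurableT_comp (measurable_powR r)).
have mg : measurable_fun setT (fun x => q x `^ p^-1 * u x).
  exact: measurable_funM.
have := @hoelder _ _ _ m (fun x => q x `^ p'^-1) (fun x => q x `^ p^-1 * u x)
  p' p (mqp _) mg p'0 p0 pE.
rewrite Lnorm1.
have -> : (\int[m]_x `|(EFin \o ((fun x => q x `^ p'^-1) \*
    (fun x => q x `^ p^-1 * u x))%R) x| = \int[m]_x (q x * u x)%:E)%E.
  apply: eq_integral => x _ /=; rewrite ger0_norm ?mulr_ge0 ?powR_ge0//.
  by rewrite mulrA -powRD ?pE ?oner_eq0// powRr1.
move=> H.
have powP r (x y : \bar R) : (0 <= r)%R -> (0 <= x -> 0 <= y -> x <= y -> x `^ r <= y `^ r)%E.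
  by move=> r0 x0 y0 xy; apply: gt0_ler_poweR => //; rewrite in_itv/= ?x0 ?y0 leey.
apply: (le_trans (powP p _ _ (ltW p0) quI0 _ H)).
  by rewrite mule_ge0 ?Lnorm_ge0.
rewrite poweRM ?Lnorm_ge0// poweR_Lnorm ?gt_eqF//.
have -> : (\int[m]_x `|(EFin \o (fun x => (q x `^ p^-1 * u x)%R)) x| `^ p =
    \int[m]_x (q x * u x `^ p)%:E)%E.
  apply: eq_integral => x _ /=; rewrite ger0_norm ?mulr_ge0 ?powR_ge0//.
  by rewrite powRM ?powR_ge0// -powRrM mulVf ?gt_eqF// powRr1.
apply: lee_wpmul2r.
  by apply: integral_ge0 => x _; rewrite lee_fin mulr_ge0 ?powR_ge0.
have -> : p = p' * (p - 1) by rewrite /p' divfK// gt_eqF.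
rewrite [in leLHS]poweRrM poweR_Lnorm ?gt_eqF// -poweR_EFin.
have -> : p' * (p - 1) - 1 = p - 1 by rewrite /p' divfK// gt_eqF.
apply: powP; [exact: ltW| |by rewrite lee_fin ltW|].
  by apply: integral_ge0 => x _; exact: poweR_ge0.
apply: le_trans qA; rewrite le_eqVlt; apply/orP; left; apply/eqP.
apply: eq_integral => x _ /=; rewrite ger0_norm ?powR_ge0//.
by rewrite -powRrM mulVf ?gt_eqF// powRr1.
Qed.

Section schur.
Context {R : realType} {n : nat}.
Variable O : domain R n.
Local Notation nu := (lebesgue_on O).
Local Notation L := (lebesgue_rV R n).
Local Notation bf := (boundary_factor O).

Lemma measurable_boundary_factor (t : R) : measurable_fun setT (bf t).
Proof.
apply: measurable_minr; first exact: measurable_cst.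
apply: measurable_funM; first exact: measurable_boundary_dist.
exact: measurable_cst.
Qed.

Lemma measurable_gaussian_subl (s : R) (y : 'rV[R]_n) :
  measurable_fun setT (fun x : 'rV[R]_n => gaussian s (x - y)).
Proof.
exact: (measurableT_comp (@measurable_gaussian_sub R n s) (pair2_measurable y)).
Qed.

Lemma ge0_integral_lebesgue_on_le (f : 'rV[R]_n -> \bar R) :
  measurable_fun setT f -> (forall x, 0 <= f x)%E ->
  (\int[nu]_x f x <= \int[L]_x f x)%E.
Proof.
move=> mf f0; rewrite ge0_integral_lebesgue_on//.
by apply: ge0_subset_integral => //; exact: measurable_domain.
Qed.

Lemma integral_gaussian_on (s : R) (x : 'rV[R]_n) : 0 < s ->
  (\int[nu]_y (gaussian s (x - y))%:E <= 1)%E.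
Proof.
move=> s0; rewrite -(integral_gaussian x s0); apply: ge0_integral_lebesgue_on_le.
  by apply/measurable_EFinP; exact: measurable_gaussian_subr.
by move=> y; rewrite lee_fin gaussian_ge0.
Qed.

Lemma integral_gaussian_onl (s : R) (y : 'rV[R]_n) : 0 < s ->
  (\int[nu]_x (gaussian s (x - y))%:E <= 1)%E.
Proof.
move=> s0; apply: le_trans (integral_gaussian_on y s0).
rewrite le_eqVlt; apply/orP; left; apply/eqP; apply: eq_integral => x _.
by rewrite -gaussianN opprB.
Qed.

(** The common majorant of S(t) f and of sqrt t times its derivatives. Extended real values let it
    be manipulated before it is known to be finite. *)
Definition heat_bound (c t : R) (f : 'rV[R]_n -> R) (x : 'rV[R]_n) : \bar R :=
  (\int[nu]_y (bf t y * gaussian (c * t) (x - y) * `|f y|)%:E)%E.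

Lemma measurable_heat_integrand (c t : R) (f : 'rV[R]_n -> R) :
  measurable_fun setT f ->
  measurable_fun setT (fun xy : 'rV[R]_n * 'rV[R]_n =>
    bf t xy.2 * gaussian (c * t) (xy.1 - xy.2) * `|f xy.2|).
Proof.
move=> mf; apply: measurable_funM.
  apply: measurable_funM; last exact: measurable_gaussian_sub.
  exact: (measurableT_comp (measurable_boundary_factor t) measurable_snd).
by apply: measurableT_comp => //; exact: (measurableT_comp mf measurable_snd).
Qed.

Lemma heat_integrand_ge0 (c t : R) (f : 'rV[R]_n -> R) x y :
  0 <= bf t y * gaussian (c * t) (x - y) * `|f y|.
Proof.
apply: mulr_ge0 => //; apply: mulr_ge0; last exact: gaussian_ge0.
exact: boundary_factor_ge0.
Qed.

Lemma measurable_heat_bound (c t : R) (f : 'rV[R]_n -> R) :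
  measurable_fun setT f -> measurable_fun setT (heat_bound c t f).
Proof.
move=> mf.
apply: (measurable_fun_fubini_tonelli_F (m2 := nu)
  (fun xy : 'rV[R]_n * 'rV[R]_n =>
   (bf t xy.2 * gaussian (c * t) (xy.1 - xy.2) * `|f xy.2|)%:E)).
  by apply/measurable_EFinP; exact: measurable_heat_integrand.
by move=> [x y]; rewrite lee_fin heat_integrand_ge0.
Qed.

Lemma heat_bound_ge0 (c t : R) (f : 'rV[R]_n -> R) x : (0 <= heat_bound c t f x)%E.
Proof. by apply: integral_ge0 => y _; rewrite lee_fin heat_integrand_ge0. Qed.

(** Integrating [boundary_factor_powN] gives at most 1 + |C|: the powers of t cancel, so the bound
    is uniform. The absolute value is there because the constant C of the hypothesis has no
    prescribed sign. *)
Lemma integral_boundary_factor_gaussian (c beta : R) :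
  weighted_Gaussian_bound O -> 0 < c -> 0 < beta < 1 ->
  exists2 A : R, 0 < A & forall t x, 0 < t <= 1 -> O x ->
    (\int[nu]_y (gaussian (c * t) (x - y) * bf t y `^ (- beta))%:E <= A%:E)%E.
Proof.
move=> hg c0 /andP[b0 b1].
have [|C hC] := hg c (- beta) c0; first by rewrite ltrN2 b1 oppr_lt0.
exists (1 + `|C|) => [|t x t01 Ox]; first by rewrite ltr_wpDr.
have /andP[t0 _] := t01.
have mg := @measurable_gaussian_subr R n (c * t) x.
have mb : measurable_fun setT (fun y => boundary_dist O y `^ (- beta)).
  apply: (measurableT_comp (measurable_powR _)); exact: measurable_boundary_dist.
pose F y := boundary_dist O y `^ (- beta) * gaussian (c * t) (x - y).
have mF : measurable_fun setT F by exact: measurable_funM.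
have F0 y : 0 <= F y by rewrite mulr_ge0 ?powR_ge0 ?gaussian_ge0.
apply: (@le_trans _ _ (\int[nu]_y ((gaussian (c * t) (x - y))%:E +
   (t `^ (beta / 2))%:E * (F y)%:E))%E).
  apply: ae_ge0_le_integral => //.
  - by move=> y _; rewrite lee_fin mulr_ge0 ?powR_ge0 ?gaussian_ge0.
  - apply/measurable_EFinP; apply: measurable_funM => //.
    apply: (measurableT_comp (measurable_powR _)).
    exact: measurable_boundary_factor.
  - by move=> y _; rewrite adde_ge0 ?mule_ge0 ?lee_fin ?powR_ge0 ?gaussian_ge0.
  - apply: emeasurable_funD; first exact/measurable_EFinP.
    by apply: emeasurable_funM => //; exact/measurable_EFinP.
  - have := ae_in_domain O; apply: filterS => y Oy _.
    rewrite -EFinM -EFinD lee_fin.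
    have := boundary_factor_powN (ltW b0) t0 Oy.
    move=> /(ler_wpM2l (gaussian_ge0 (c * t) (x - y))) /le_trans; apply.
    by rewrite mulrDr mulr1 lerD2l /F mulrCA [X in _ * X]mulrC.
rewrite ge0_integralD//; last 4 first.
- by move=> y _; rewrite lee_fin gaussian_ge0.
- exact/measurable_EFinP.
- by move=> y _; rewrite mule_ge0 ?lee_fin ?powR_ge0.
- by apply: emeasurable_funM => //; exact/measurable_EFinP.
rewrite EFinD; apply: leeD.
  by apply: integral_gaussian_on; rewrite mulr_gt0.
rewrite ge0_integralZl_EFin//; last 3 first.
- by move=> y _; rewrite lee_fin.
- exact/measurable_EFinP.
- exact: powR_ge0.
rewrite ge0_integral_lebesgue_on//; last exact/measurable_EFinP.
apply: (le_trans (lee_wpmul2l _ (hC t x t01 Ox))).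
  by rewrite lee_fin powR_ge0.
rewrite -EFinM lee_fin mulrCA mulNr powRN mulfV ?mulr1 ?ler_norm//.
by rewrite gt_eqF// powR_gt0.
Qed.

(* Schur test with the Hoelder weight [bf t ^ (- beta)]: the first factor is integrable
   by the weighted Gaussian bound as beta < 1, and the powers of [bf t] that remain on
   [f] absorb the [bf t ^ (- theta)] lost in [weight_gaussian] as soon as
   theta <= p + beta (p - 1), which is possible because theta < 2 p - 1. *)
Lemma heat_bound_powR (p theta delta c : R) :
  weighted_Gaussian_bound O -> 1 <= p -> 0 <= theta < 2 * p - 1 ->
  0 <= delta -> 0 < c ->
  exists2 C : R, 0 < C & forall t f, 0 < t <= 1 -> measurable_fun setT f ->
    (\int[nu]_x (heat_bound c t f x `^ p * (weight O theta delta x)%:E) <=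
     C%:E * \int[nu]_y (`|f y| `^ p * weight O theta delta y)%:E)%E.
Proof.
move=> hg p1 /andP[th0 thp] d0 c0.
have p0 : 0 < p by exact: lt_le_trans p1.
have [beta [/andP[b0 b1] bp]] : exists beta : R,
    0 < beta < 1 /\ theta <= p + beta * (p - 1).
  move: p1; rewrite le_eqVlt => /predU1P[pE|p1].
    exists (2^-1); rewrite -pE subrr mulr0 addr0; split; last lra.
    by rewrite invr_gt0 ltr0n /= invf_lt1 ?ltr1n.
  have p10 : 0 < p - 1 by rewrite subr_gt0.
  (* The second entry is below 1 precisely because theta < 2 p - 1; the entry 1/2 only ensures that
     beta is positive. *)
  exists (Num.max 2^-1 ((theta - p) / (p - 1))); split.
    rewrite lt_max invr_gt0 ltr0n/= gt_max invf_lt1 ?ltr1n//=.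
    by rewrite ltr_pdivrMr// mul1r; lra.
  rewrite -lerBlDl -ler_pdivrMr// le_max lexx orbT//.
have [A A0 hA] : exists2 A : R, 0 < A & forall t x, 0 < t <= 1 -> O x ->
    (\int[nu]_y (gaussian (c * t) (x - y) * bf t y `^ (- beta))%:E <= A%:E)%E.
  by apply: integral_boundary_factor_gaussian => //; rewrite b0.
have [C2 C20 hC2] := weight_gaussian O th0 d0 c0.
exists (A `^ (p - 1) * C2) => [|t f t01 mf]; first by rewrite mulr_gt0 ?powR_gt0.
have /andP[t0 _] := t01.
have ct0 : 0 < c * t by rewrite mulr_gt0.
(* [kap] = p (1 + beta) - beta is the power of m_t left on |f|^p after Hoelder's inequality. Since
   kap >= theta and m_t <= 1, it compensates the factor m_t^(-theta) at the end. *)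
set w := weight O theta delta; set kap := p + beta * (p - 1).
have k0 : 0 < kap by rewrite ltr_pwDl// mulr_ge0 ?subr_ge0// ltW.
have mw : measurable_fun setT w by exact: measurable_weight.
have w0 x : 0 <= w x by exact: weight_ge0.
have mbp r : measurable_fun setT (fun y => bf t y `^ r).
  by apply: (measurableT_comp (measurable_powR _)); exact: measurable_boundary_factor.
have mfp : measurable_fun setT (fun y => `|f y| `^ p).
  by apply: (measurableT_comp (measurable_powR _)); exact: measurableT_comp.
pose H (xy : 'rV[R]_n * 'rV[R]_n) :=
  gaussian (c * t) (xy.1 - xy.2) * (bf t xy.2 `^ kap * `|f xy.2| `^ p).
have mH : measurable_fun setT H.
  apply: measurable_funM; first exact: measurable_gaussian_sub.
  apply: measurable_funM.
    exact: (measurableT_comp (mbp _) measurable_snd).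
  exact: (measurableT_comp mfp measurable_snd).
have H0 xy : 0 <= H xy by rewrite !mulr_ge0 ?powR_ge0 ?gaussian_ge0.
have mHx x : measurable_fun setT (fun y => H (x, y)).
  exact: (measurableT_comp mH (pair1_measurable x)).
have bE y : bf t y `^ (- beta) * bf t y `^ (1 + beta) = bf t y.
  rewrite -powRD; last by rewrite addrCA addNr addr0 oner_eq0.
  by rewrite addrCA addNr addr0 powRr1// boundary_factor_ge0.
have bE2 y : bf t y `^ (- beta) * (bf t y `^ (1 + beta)) `^ p = bf t y `^ kap.
  have kE : - beta + (1 + beta) * p = kap by rewrite /kap; ring.
  by rewrite -powRrM -powRD ?kE // (gt_eqF k0).
have step1 x : O x -> (heat_bound c t f x `^ p <=
    (A `^ (p - 1))%:E * \int[nu]_y (H (x, y))%:E)%E.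
  move=> Ox.
  have := @integral_powR_le _ _ R nu
    (fun y => gaussian (c * t) (x - y) * bf t y `^ (- beta))
    (fun y => bf t y `^ (1 + beta) * `|f y|) A p.
  have -> : (\int[nu]_y (gaussian (c * t) (x - y) * bf t y `^ (- beta) *
      (bf t y `^ (1 + beta) * `|f y|))%:E = heat_bound c t f x)%E.
    apply: eq_integral => y _; congr EFin.
    by rewrite -[in RHS](bE y); ring.
  have -> : (\int[nu]_y (gaussian (c * t) (x - y) * bf t y `^ (- beta) *
      (bf t y `^ (1 + beta) * `|f y|) `^ p)%:E = \int[nu]_y (H (x, y))%:E)%E.
    apply: eq_integral => y _; congr EFin; rewrite /H/=.
    by rewrite powRM ?powR_ge0// -bE2; ring.
  apply => //.
  - by apply: measurable_funM => //; exact: measurable_gaussian_subr.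
  - by apply: measurable_funM => //; exact: measurableT_comp.
  - by move=> y; rewrite mulr_ge0 ?powR_ge0 ?gaussian_ge0.
  - by move=> y; rewrite mulr_ge0 ?powR_ge0.
  - exact: hA.
have mI : measurable_fun setT (fun x => \int[nu]_y (H (x, y))%:E)%E.
  apply: (measurable_fun_fubini_tonelli_F (m2 := nu) (EFin \o H)).
    exact/measurable_EFinP.
  by move=> xy; rewrite /= lee_fin.
apply: (@le_trans _ _ (\int[nu]_x ((A `^ (p - 1))%:E *
    \int[nu]_y (H (x, y) * w x)%:E))%E).
  apply: ae_ge0_le_integral => //.
  - by move=> x _; rewrite mule_ge0 ?poweR_ge0 ?lee_fin.
  - apply: emeasurable_funM; last exact/measurable_EFinP.
    apply: (measurableT_comp (measurable_poweR p)).
    exact: measurable_heat_bound.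
  - move=> x _; rewrite mule_ge0 ?lee_fin ?powR_ge0//.
    by apply: integral_ge0 => y _; rewrite lee_fin mulr_ge0.
  - apply: emeasurable_funM => //.
    apply: (measurable_fun_fubini_tonelli_F (m2 := nu)
      (fun xy => (H xy * w xy.1)%:E)).
      apply/measurable_EFinP; apply: measurable_funM => //.
      exact: (measurableT_comp mw measurable_fst).
    by move=> xy; rewrite lee_fin mulr_ge0.
  - have := ae_in_domain O; apply: filterS => x Ox _.
    apply: (le_trans (lee_wpmul2r _ (step1 x Ox))); first by rewrite lee_fin.
    rewrite -muleA lee_wpmul2l ?lee_fin ?powR_ge0// muleC.
    rewrite -ge0_integralZl_EFin//; last 2 first.
    + by move=> y _; rewrite lee_fin.
    + exact/measurable_EFinP.
    apply: ge0_le_integral => //.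
    + by move=> y _; rewrite mule_ge0 ?lee_fin.
    + by apply: emeasurable_funM => //; exact/measurable_EFinP.
    + apply/measurable_EFinP; apply: measurable_funM => //.
    + by move=> y _; rewrite -EFinM mulrC.
rewrite ge0_integralZl_EFin ?powR_ge0//; last 2 first.
- by move=> x _; apply: integral_ge0 => y _; rewrite lee_fin mulr_ge0.
- apply: (measurable_fun_fubini_tonelli_F (m2 := nu)
    (fun xy => (H xy * w xy.1)%:E)).
    apply/measurable_EFinP; apply: measurable_funM => //.
    exact: (measurableT_comp mw measurable_fst).
  by move=> xy; rewrite lee_fin mulr_ge0.
rewrite EFinM -muleA lee_wpmul2l ?lee_fin ?powR_ge0//.
rewrite (fubini_tonelli (m1 := nu) (m2 := nu) (fun xy => (H xy * w xy.1)%:E));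
  last 2 first.
- apply/measurable_EFinP; apply: measurable_funM => //.
  exact: (measurableT_comp mw measurable_fst).
- by move=> xy; rewrite lee_fin mulr_ge0.
rewrite -ge0_integralZl_EFin//; last 3 first.
- by move=> x _; rewrite lee_fin mulr_ge0 ?powR_ge0.
- by apply/measurable_EFinP; exact: measurable_funM.
- exact: ltW.
apply: ae_ge0_le_integral => //.
- by move=> y _; apply: integral_ge0 => x _; rewrite lee_fin mulr_ge0.
- apply: (measurable_fun_fubini_tonelli_G (m1 := nu)
    (fun xy => (H xy * w xy.1)%:E)).
    apply/measurable_EFinP; apply: measurable_funM => //.
    exact: (measurableT_comp mw measurable_fst).
  by move=> xy; rewrite lee_fin mulr_ge0.
- by move=> y _; rewrite lee_fin !mulr_ge0 ?powR_ge0// ltW.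
- apply: emeasurable_funM => //; apply/measurable_EFinP.
  exact: measurable_funM.
have := ae_in_domain O; apply: filterS => y Oy _.
set e := bf t y `^ kap * `|f y| `^ p.
have e0 : 0 <= e by rewrite mulr_ge0 ?powR_ge0.
apply: (@le_trans _ _ (\int[nu]_x ((e * (C2 * (bf t y `^ (- theta) * w y)))%:E *
    (gaussian (2 * c * t) (x - y))%:E))%E).
  apply: ae_ge0_le_integral => //.
  - by move=> x _; rewrite lee_fin mulr_ge0.
  - apply/measurable_EFinP; apply: measurable_funM => //.
    exact: (measurableT_comp mH (pair2_measurable y)).
  - by move=> x _; rewrite mule_ge0 ?lee_fin ?gaussian_ge0 ?mulr_ge0 ?powR_ge0 ?(ltW C20).
  - apply: emeasurable_funM => //; apply/measurable_EFinP.
    exact: measurable_gaussian_subl.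
  - have := ae_in_domain O; apply: filterS => x Ox _.
    rewrite -EFinM lee_fin /H/= -/e.
    have := ler_wpM2l e0 (hC2 t x y t01 Ox Oy); rewrite -/w.
    by congr (_ <= _); rewrite /e; ring.
rewrite ge0_integralZl_EFin//; last 3 first.
- by move=> x _; rewrite lee_fin gaussian_ge0.
- by apply/measurable_EFinP; exact: measurable_gaussian_subl.
- by rewrite !mulr_ge0 ?powR_ge0 ?(ltW C20).
apply: (@le_trans _ _ (e * (C2 * (bf t y `^ (- theta) * w y)))%:E).
  rewrite -[leRHS]mule1; apply: lee_wpmul2l.
    by rewrite lee_fin !mulr_ge0 ?powR_ge0 ?(ltW C20).
  by apply: integral_gaussian_onl; rewrite !mulr_gt0.
rewrite -EFinM lee_fin /e.
have -> : bf t y `^ kap * `|f y| `^ p * (C2 * (bf t y `^ (- theta) * w y)) =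
  (bf t y `^ kap * bf t y `^ (- theta)) * (C2 * (`|f y| `^ p * w y)) by ring.
rewrite ler_piMl ?mulr_ge0 ?powR_ge0 ?(ltW C20)//.
rewrite -powRD; last by rewrite (gt_eqF (boundary_factor_gt0 t0 Oy)) implybT.
rewrite -[leRHS](powRr0 (bf t y)); apply: ger_powR.
  by rewrite boundary_factor_gt0// boundary_factor_le1.
by rewrite subr_ge0.
Qed.

End schur.

(** * Functions on a line *)

Lemma cvge0_near_lt (R : realType) (u : nat -> \bar R) (e : \bar R) :
  (u k @[k --> \oo] --> 0)%E -> (0 < e)%E -> \forall k \near \oo, (u k < e)%E.
Proof. by move=> cu e0; exact: (cu _ (open_ereal_lt' e0)). Qed.

Section line.
Context {R : realType}.
Implicit Types (F phi : R -> R) (V : set R).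
Local Notation lam := (@lebesgue_measure R).

(** The auxiliary [be] is a primitive of the decaying bound, so that the derivative of F + be is
    nonnegative; [be] increases by at most B sig in total, whence the error term. *)
Lemma le_add_expdecay F (s tau B sig : R) : s < tau -> 0 < sig -> 0 <= B ->
  continuous F ->
  (forall x, s < x < tau ->
    derivable F x 1 /\ - (B * expR (- (x - s) / sig)) <= 'D_1 F x) ->
  F s <= F tau + B * sig.
Proof.
move=> st sig0 B0 cF dF.
pose be x := - (B * sig) * expR (- (x - s) / sig).
have dbe x : is_derive x (1 : R) be (B * expR (- (x - s) / sig)).
  apply: is_derive_eq; rewrite /GRing.scale /= subr0.
  by field; rewrite gt_eqF.
have cbe : continuous be.
  by move=> x; apply/differentiable_continuous/derivable1_diffP.
have [x|x|c] := @MVT R (F \+ be) (fun x => 'D_1 F x + B * expR (- (x - s) / sig))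
  s tau st.
- rewrite in_itv => xst; have [dFx _] := dF x xst.
  by apply: is_deriveD; exact/derivableP.
- by apply: continuous_subspaceT => {}x; apply: cvgD; [exact: cF|exact: cbe].
rewrite in_itv => cst; have [_ h] := dF c cst.
move=> /= e.
have : 0 <= F tau + be tau - (F s + be s).
  by rewrite e mulr_ge0 ?subr_ge0 ?(ltW st)//; lra.
have -> : be s = - (B * sig) by rewrite /be subrr oppr0 mul0r expR0 mulr1.
have : be tau <= 0 by rewrite /be mulNr oppr_le0 mulr_ge0 ?expR_ge0// mulr_ge0// ltW.
lra.
Qed.

(* The line is followed until it leaves V, where F vanishes, or until it reaches T. *)
Lemma line_exit V F (s T B sig : R) : open V -> continuous F ->
  (forall x, ~ V x -> F x = 0) -> V s -> s < T -> 0 < sig -> 0 <= B ->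
  (forall x, s <= x -> V x ->
    derivable F x 1 /\ `|'D_1 F x| <= B * expR (- (x - s) / sig)) ->
  `|F s| <= `|F T| + B * sig.
Proof.
move=> oV cF F0 Vs sT sig0 B0 dF.
have key tau : s < tau -> (forall x, s < x < tau -> V x) ->
    `|F s| <= `|F tau| + B * sig.
  move=> st h.
  have h1 : F s <= F tau + B * sig.
    apply: le_add_expdecay => // x xst.
    have /andP[sx _] := xst.
    have [d1 d2] := dF x (ltW sx) (h x xst); split=> //.
    by move: d2; rewrite ler_norml => /andP[].
  have h2 : - F s <= - F tau + B * sig.
    apply: (@le_add_expdecay (fun x => - F x)) => // [x|x xst].
      by apply: cvgN; exact: cF.
    have /andP[sx _] := xst.
    have [d1 d2] := dF x (ltW sx) (h x xst); split; first exact: derivableN.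
    rewrite deriveN// lerN2.
    by move: d2; rewrite ler_norml => /andP[].
  have := ler_norm (F tau); have := ler_norm (- F tau); rewrite normrN.
  by rewrite [X in X -> _]/= => ? ?; rewrite ler_norml; apply/andP; split; lra.
pose E := [set x | s <= x <= T /\ ~ V x].
have [E0|/set0P E0] := eqVneq E set0.
  apply: key => // x /andP[sx xT]; apply: contrapT => nVx.
  by have : E x; [split=> //; rewrite !ltW|rewrite E0].
have lE : has_lbound E by exists s => x [/andP[]].
(* The first exit time. It lies outside the open set V, so F vanishes there, and it is larger than s
   since V contains s. *)
set tau := inf E.
have stau : s <= tau by apply: lb_le_inf => // x [/andP[]].
have nVtau : ~ V tau.
  move=> Vtau; have /nbhs_ballP[e /= e0 eV] : nbhs tau V by exact: open_nbhs_nbhs.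
  have [x Ex xe] : exists2 x, E x & x < tau + e.
    by apply: inf_adherent => //; split.
  have taux : tau <= x by exact: ge_inf.
  case: Ex => sxT; apply; apply: eV; rewrite /ball/= ltr_distlC xe andbT.
  by rewrite (lt_le_trans _ taux)// ltrBlDr ltrDl.
have {}stau : s < tau.
  by rewrite lt_neqAle stau andbT; apply/eqP => e; apply: nVtau; rewrite -e.
suff h x : s < x < tau -> V x.
  by rewrite (le_trans (key tau stau h))// (F0 _ nVtau) normr0 add0r lerDr.
move=> /andP[sx xtau]; apply: contrapT => nVx.
have tauT : tau <= T.
  by case: E0 => z Ez; case: (Ez) => /andP[_ zT] _; rewrite (le_trans _ zT)// ge_inf.
have Ex : E x by split=> //; rewrite (ltW sx)/= (le_trans (ltW xtau)).
by have := ge_inf lE Ex; rewrite leNgt xtau.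
Qed.

Lemma square_integrable_small F (A : set R) (e : R) : measurable A -> lam A = +oo%E ->
  measurable_fun setT F -> (\int[lam]_x (F x ^+ 2)%:E < +oo)%E -> 0 < e ->
  exists2 T, A T & `|F T| < e.
Proof.
move=> mA Aoo mF F2 e0; apply: contrapT => h.
have {}h x : A x -> e <= `|F x|.
  by move=> sx; rewrite leNgt; apply/negP => ?; apply: h; exists x.
move: F2; apply/negP; rewrite -leNgt leye_eq; apply/eqP.
have mF2 : measurable_fun setT (fun x => F x ^+ 2) by exact: measurable_funX.
apply/eqP; rewrite eq_le leey/=.
apply: (@le_trans _ _ (\int[lam]_(x in A) (e ^+ 2)%:E)%E).
  by rewrite integral_cst//= Aoo mulry gtr0_sg ?mul1e// exprn_gt0.
apply: (@le_trans _ _ (\int[lam]_(x in A) (F x ^+ 2)%:E)%E).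
  apply: ge0_le_integral => //.
  - by move=> x _; rewrite lee_fin sqr_ge0.
  - by apply/measurable_EFinP; exact: measurable_funTS.
  - move=> x /h; rewrite lee_fin -[F x ^+ 2]real_normK ?num_real//.
    by rewrite ler_sqr ?nnegrE ?(ltW e0).
apply: ge0_subset_integral => //; first exact/measurable_EFinP.
by move=> x _; rewrite lee_fin sqr_ge0.
Qed.

(** The sign [r], 1 or -1, lets one argument treat both directions of a line. A square integrable
    function cannot stay above e in absolute value on a half-line, which has infinite measure. *)
Lemma square_integrable_small_ray F (r s e : R) : r ^+ 2 = 1 ->
  measurable_fun setT F -> (\int[lam]_x (F x ^+ 2)%:E < +oo)%E -> 0 < e ->
  exists2 T, s < T & `|F (r * T)| < e.
Proof.
move=> /eqP; rewrite sqrf_eq1 => /orP[/eqP->|/eqP->] mF F2 e0.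
  have [|||||T] := @square_integrable_small F `]s, +oo[ e; last first.
  - by rewrite /= in_itv/= andbT => sT FT; exists T => //; rewrite mul1r.
  - by [].
  - by [].
  - by [].
  - by rewrite lebesgue_measure_itv/= ltry.
  - exact: measurable_itv.
have [|||||T] := @square_integrable_small F `]-oo, - s[ e; last first.
- rewrite /= in_itv/= => sT FT; exists (- T); first by rewrite ltrNr.
  by rewrite mulN1r opprK.
- by [].
- by [].
- by [].
- by rewrite lebesgue_measure_itv/= ltNyr.
- exact: measurable_itv.
Qed.

(** The fundamental theorem of calculus with |phi'| <= l phi'^2 + 1 / l. The free parameter l
    replaces the square roots of the Cauchy-Schwarz inequality. *)
Lemma increment_le_energy phi (a b l M : R) : a < b -> 0 < l ->
  (forall x, derivable phi x 1) -> continuous (fun x => 'D_1 phi x) ->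
  (\int[lam]_x ('D_1 phi x ^+ 2)%:E <= M%:E)%E ->
  `|phi b - phi a| <= l * M + (b - a) / l.
Proof.
move=> ab l0 dphi cphi hM; set phi' := fun x => 'D_1 phi x in cphi hM.
have mphi : measurable_fun setT phi' by exact: continuous_measurable_fun.
have cphi0 : continuous phi.
  by move=> x; apply/differentiable_continuous/derivable1_diffP.
have FTC : (\int[lam]_(x in `[a, b]) (phi' x)%:E = (phi b)%:E - (phi a)%:E)%E.
  apply: continuous_FTC2 => //; first exact: continuous_subspaceT.
  - split; first by move=> x _; exact: dphi.
    + by apply: cvg_at_right_filter; exact: cphi0.
    + by apply: cvg_at_left_filter; exact: cphi0.
  - by move=> x _; rewrite derive1E.
rewrite -lee_fin -abse_EFin EFinB -FTC.
apply: (le_trans (le_abse_integral _ _ _)) => //.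
  by apply/measurable_EFinP; exact: measurable_funTS.
have mphi2 : measurable_fun setT (fun x => l * phi' x ^+ 2).
  by apply: measurable_funM => //; exact: measurable_funX.
apply: (@le_trans _ _ (\int[lam]_(x in `[a, b])
    ((l * phi' x ^+ 2)%:E + (l^-1)%:E))%E).
  apply: ge0_le_integral => //.
  - apply/measurable_EFinP; apply: measurable_funTS; exact: measurableT_comp.
  - apply: emeasurable_funD => //; apply/measurable_EFinP; exact: measurable_funTS.
  - move=> x _; rewrite -EFinD abse_EFin lee_fin -real_normK ?num_real//.
    have := sqr_ge0 (l * `|phi' x| - 1); have := normr_ge0 (phi' x).
    rewrite -(ler_pM2l l0) mulrDr mulfV ?gt_eqF//; nra.
rewrite ge0_integralD//; last 3 first.
- by move=> x _; rewrite lee_fin mulr_ge0 ?sqr_ge0// ltW.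
- by apply/measurable_EFinP; exact: measurable_funTS.
- by move=> x _; rewrite lee_fin invr_ge0 ltW.
rewrite EFinD; apply: leeD; last first.
  by rewrite integral_cst//= lebesgue_measure_itv/= lte_fin ab -EFinD -EFinM lee_fin mulrC.
apply: (@le_trans _ _ (\int[lam]_x (l * phi' x ^+ 2)%:E)%E).
  apply: ge0_subset_integral => //; first exact/measurable_EFinP.
  by move=> x _; rewrite lee_fin mulr_ge0 ?sqr_ge0// ltW.
under eq_integral do rewrite EFinM.
rewrite ge0_integralZl_EFin ?(ltW l0)//; last 2 first.
- by move=> x _; rewrite lee_fin sqr_ge0.
- by apply/measurable_EFinP; exact: measurable_funX.
by rewrite EFinM lee_wpmul2l// lee_fin ltW.
Qed.

(* Energy bounds make the phi_k equicontinuous, so that mean-square convergence to F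
   forces pointwise convergence wherever F is continuous. *)
Lemma cvg_of_energy (phi : nat -> R -> R) F (x M : R) :
  (forall k, forall x, derivable (phi k) x 1) ->
  (forall k, continuous (fun x => 'D_1 (phi k) x)) ->
  (forall k, \int[lam]_x ('D_1 (phi k) x ^+ 2)%:E <= M%:E)%E ->
  measurable_fun setT F ->
  (\int[lam]_x ((phi k x - F x) ^+ 2)%:E @[k --> \oo] --> 0)%E ->
  {for x, continuous F} -> phi k x @[k --> \oo] --> F x.
Proof.
move=> dphi cphi hM mF cvgF cF.
suff H (e : R) : 0 < e -> \forall k \near \oo, `|F x - phi k x| < e.
  by apply/cvgrPdist_lt => e; exact: H.
move=> e0.
have M0 : 0 <= M.
  by rewrite -lee_fin; apply: le_trans (hM 0%N); apply: integral_ge0 => y _;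
     rewrite lee_fin sqr_ge0.
have M1 : 0 < M + 1 by rewrite ltr_wpDl.
(* If |F x - phi_k x| >= 4 h, then, on an interval of length d, F moves by at most h and phi_k by at
   most 2 h, so that |phi_k - F| >= h there. This forces a squared distance of at least h^2 d, which
   is excluded for large k. The bounds on l and d make both terms of [increment_le_energy] at most
   h. *)
pose h := e / 4; have h0 : 0 < h by rewrite divr_gt0.
pose l := h / (M + 1); have l0 : 0 < l by rewrite divr_gt0.
have lM : l * M <= h by rewrite /l mulrAC ler_pdivrMr// ler_pM2l// lerDl.
have /nbhs_ballP[d1 /= d10 d1F] : \forall y \near x, `|F x - F y| < h.
  by move/cvgrPdist_lt : cF; apply.
pose d := Num.min d1 (h * l).
have d0 : 0 < d by rewrite lt_min d10 mulr_gt0.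
have hd0 : (0 < (h ^+ 2 * d)%:E)%E by rewrite lte_fin mulr_gt0 ?exprn_gt0.
have := cvge0_near_lt cvgF hd0.
apply: filterS => k; apply: contraPP => /negP; rewrite -leNgt => hk.
suff : ((h ^+ 2 * d)%:E <= \int[lam]_y ((phi k y - F y) ^+ 2)%:E)%E.
  by move=> le_d /lt_geF; rewrite le_d.
have mphi : measurable_fun setT (phi k).
  apply: continuous_measurable_fun => y.
  by apply/differentiable_continuous/derivable1_diffP.
have mD : measurable_fun setT (fun y => (phi k y - F y) ^+ 2).
  by apply: measurable_funX; exact: measurable_funB.
have hdE : ((h ^+ 2 * d)%:E = \int[lam]_(y in `]x, (x + d)%R[) (h ^+ 2)%:E)%E.
  rewrite integral_cst//= lebesgue_measure_itv/= lte_fin ltrDl d0 -EFinD -EFinM.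
  by rewrite addrAC subrr add0r.
rewrite hdE.
apply: (@le_trans _ _ (\int[lam]_(y in `]x, (x + d)%R[) ((phi k y - F y) ^+ 2)%:E)%E).
  apply: ge0_le_integral => //.
  - by move=> y _; rewrite lee_fin sqr_ge0.
  - by apply/measurable_EFinP; exact: measurable_funTS.
  - move=> y /=; rewrite in_itv/= => /andP[xy yd].
    rewrite lee_fin -[(phi k y - F y) ^+ 2]real_normK ?num_real//.
    rewrite ler_sqr ?nnegrE ?(ltW h0)//.
    have h1 : `|F x - F y| < h.
      apply: d1F; rewrite /ball/= distrC gtr0_norm ?subr_gt0//.
      by rewrite ltrBlDl (lt_le_trans yd)// lerD2l ge_min lexx.
    have h2 : `|phi k y - phi k x| <= h + h.
      apply: (le_trans (increment_le_energy xy l0 (dphi k) (cphi k) (hM k))).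
      apply: lerD => //; rewrite ler_pdivrMr// lerBlDl (le_trans (ltW yd))//.
      by rewrite lerD2l ge_min lexx orbT.
    have h3 : `|F x - phi k x| <= `|F x - F y| + (`|phi k y - F y| + `|phi k y - phi k x|).
      rewrite (le_trans (ler_distD (F y) _ _))// lerD2l.
      by rewrite (le_trans (ler_distD (phi k y) _ _))// distrC.
    have e4 : e = 4 * h by rewrite /h mulrC divfK.
    by move: hk h1 h2 h3; rewrite e4; lra.
apply: ge0_subset_integral => //; first exact/measurable_EFinP.
by move=> y _; rewrite lee_fin sqr_ge0.
Qed.

(** The phi_k converge to F everywhere: by [cvg_of_energy] on V, trivially off V. Their common
    modulus of continuity then passes to the limit, which also gives continuity at boundary points
    of V, where nothing is assumed on F beyond its vanishing off V. *)
Lemma line_continuous (phi : nat -> R -> R) V F (M : R) : open V ->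
  (forall k, forall x, derivable (phi k) x 1) ->
  (forall k, continuous (fun x => 'D_1 (phi k) x)) ->
  (forall k, \int[lam]_x ('D_1 (phi k) x ^+ 2)%:E <= M%:E)%E ->
  measurable_fun setT F ->
  (\int[lam]_x ((phi k x - F x) ^+ 2)%:E @[k --> \oo] --> 0)%E ->
  (forall x, V x -> {for x, continuous F}) ->
  (forall k x, ~ V x -> phi k x = 0) -> (forall x, ~ V x -> F x = 0) ->
  continuous F.
Proof.
move=> oV dphi cphi hM mF cvgF cF phi0 F0.
have cvgx x : phi k x @[k --> \oo] --> F x.
  have [Vx|nVx] := pselect (V x).
    by apply: (cvg_of_energy dphi cphi hM mF cvgF); exact: cF.
  rewrite F0//; under eq_fun do rewrite phi0//.
  exact: cvg_cst.
have M0 : 0 <= M.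
  by rewrite -lee_fin; apply: le_trans (hM 0%N); apply: integral_ge0 => y _;
     rewrite lee_fin sqr_ge0.
have bound x y l : x < y -> 0 < l -> `|F y - F x| <= l * M + (y - x) / l.
  move=> xy l0.
  have : `|phi k y - phi k x| @[k --> \oo] --> `|F y - F x|.
    by apply: cvg_norm; apply: cvgB; exact: cvgx.
  move=> cv; rewrite -(cvg_lim _ cv)//; apply: limr_le; first by apply/cvg_ex; eexists; exact: cv.
  apply: nearW => k; exact: increment_le_energy.
move=> x; apply/cvgrPdist_le => e e0.
have M1 : 0 < M + 1 by rewrite ltr_wpDl.
pose h := e / 2; have h0 : 0 < h by rewrite divr_gt0.
pose l := h / (M + 1); have l0 : 0 < l by rewrite divr_gt0.
have lM : l * M <= h by rewrite /l mulrAC ler_pdivrMr// ler_pM2l// lerDl.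
have hl0 : 0 < h * l by rewrite mulr_gt0.
have eh : e = h + h by rewrite /h -splitr.
near=> y.
have yx : `|x - y| < h * l by near: y; exact: (@cvgr_dist_lt _ _ _ _ _ id x).
have [xy|xy|->] := ltgtP x y; last by rewrite subrr normr0 ltW.
- rewrite distrC (le_trans (bound x y l xy l0))// eh lerD//.
  by rewrite ler_pdivrMr// (le_trans _ (ltW yx))// distrC ler_norm.
- rewrite (le_trans (bound y x l xy l0))// eh lerD//.
  by rewrite ler_pdivrMr// (le_trans _ (ltW yx))// ler_norm.
Unshelve. all: by end_near.
Qed.

End line.

Lemma ae_lty_of_integral d (T : measurableType d) (R : realType)
    (m : {measure set T -> \bar R}) (f : T -> \bar R) :
  measurable_fun setT f -> (forall x, 0 <= f x)%E ->
  (\int[m]_x f x < +oo)%E -> {ae m, forall x, (f x < +oo)%E}.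
Proof.
move=> mf f0 foo.
have fi : m.-integrable setT f.
  apply/integrableP; split=> //.
  by under eq_integral do rewrite gee0_abs//.
have := integrable_ae measurableT fi; apply: filterS => x /(_ I).
by rewrite ge0_fin_numE.
Qed.

Lemma cvge_nneseries_term (R : realType) (u : nat -> \bar R) :
  (forall k, 0 <= u k)%E -> (\sum_(k <oo) u k < +oo)%E ->
  (u k @[k --> \oo] --> 0)%E.
Proof.
move=> u0 uoo.
have := @nneseries_tail_cvg R u xpredT uoo (fun k _ => u0 k).
move=> h; apply: (squeeze_cvge _ (cvg_cst 0%E) h).
apply: nearW => k; rewrite u0/=.
rewrite (@nneseries_split _ _ k 1) ?addn1 ?big_nat1//.
by rewrite leeDl// nneseries_ge0.
Qed.

Lemma nneseries_ge_term (R : realType) (u : nat -> \bar R) k :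
  (forall k, 0 <= u k)%E -> (u k <= \sum_(j <oo) u j)%E.
Proof.
move=> u0; apply: le_trans (@nneseries_lim_ge R u xpredT 0 k.+1 _) => //.
by rewrite big_nat_recr//= leeDr// sume_ge0.
Qed.

Lemma sqr_Lnorm2 d (T : measurableType d) (R : realType)
    (m : {measure set T -> \bar R}) (f : T -> R) :
  (('N[m]_2%:E[EFin \o f] `^ 2) = \int[m]_x (f x ^+ 2)%:E)%E.
Proof.
rewrite poweR_Lnorm ?pnatr_eq0//; apply: eq_integral => x _ /=.
by rewrite powR_mulrn// real_normK// num_real.
Qed.

Lemma integral_sqr_lt d (T : measurableType d) (R : realType)
    (m : {measure set T -> \bar R}) (f : T -> R) (e : R) : 0 < e ->
  ('N[m]_2%:E[EFin \o f] < (Num.sqrt e)%:E)%E -> (\int[m]_x (f x ^+ 2)%:E < e%:E)%E.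
Proof.
move=> e0; have := Lnorm_ge0 m 2%:E (EFin \o f).
rewrite -sqr_Lnorm2; case: ('N[m]_2%:E[EFin \o f])%E => [r| |]//=.
rewrite lee_fin !lte_fin => r0 re.
by rewrite powR_mulrn// -(sqr_sqrtr (ltW e0)) ltr_sqr ?nnegrE ?sqrtr_ge0.
Qed.

(** * Restriction of H^1_0 functions to almost every line *)

Section lines.
Context {R : realType} {n : nat}.
Local Notation lam := (@lebesgue_measure R).

Lemma line_derivable (f : 'rV[R]_n.+1 -> R) (v : 'rV[R]_n) (s : R) :
  derivable (fun s => f (rV_cons (s, v))) s 1 <->
  derivable f (rV_cons (s, v)) (delta_mx ord0 ord0).
Proof.
rewrite /derivable (_ : (fun h : R => _) = (fun h : R => h^-1 *:
  ((f \o shift (rV_cons (s, v))) (h *: delta_mx ord0 ord0) - f (rV_cons (s, v)))))//.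
apply/funext => h /=; congr (_ *: (f _ - _)).
rewrite [RHS]addrC -rV_cons_shift; congr (rV_cons (_, _)).
by rewrite [RHS]addrC /GRing.scale/= mulr1.
Qed.

Lemma line_derive (f : 'rV[R]_n.+1 -> R) (v : 'rV[R]_n) (s : R) :
  'D_1 (fun s => f (rV_cons (s, v))) s = partial ord0 f (rV_cons (s, v)).
Proof.
rewrite /partial /derive (_ : (fun h : R => _) = (fun h : R => h^-1 *:
  ((f \o shift (rV_cons (s, v))) (h *: delta_mx ord0 ord0) - f (rV_cons (s, v)))))//.
apply/funext => h /=; congr (_ *: (f _ - _)).
rewrite [RHS]addrC -rV_cons_shift; congr (rV_cons (_, _)).
by rewrite [RHS]addrC /GRing.scale/= mulr1.
Qed.

Lemma continuous_rV_cons (v : 'rV[R]_n) : continuous (fun s => rV_cons (s, v)).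
Proof.
have -> : (fun s => rV_cons (s, v)) =
    (fun s => rV_cons (0, v) + s *: delta_mx ord0 ord0).
  by apply/funext => s; rewrite -rV_cons_shift add0r.
move=> s; apply: cvgD; first exact: cvg_cst.
by apply: cvgZr_tmp; exact: cvg_id.
Qed.

Lemma measurable_line (f : 'rV[R]_n.+1 -> \bar R) (v : 'rV[R]_n) :
  measurable_fun setT f ->
  measurable_fun setT (fun s => f (rV_cons (s, v))).
Proof.
move=> mf; apply: measurableT_comp => //.
exact: (measurableT_comp (@measurable_rV_cons R n) (pair2_measurable v)).
Qed.

Lemma ae_line_lty (f : 'rV[R]_n.+1 -> \bar R) :
  measurable_fun setT f -> (forall x, 0 <= f x)%E ->
  (\int[lebesgue_rV R n.+1]_x f x < +oo)%E ->
  {ae lebesgue_rV R n, forall v, (\int[lam]_s f (rV_cons (s, v)) < +oo)%E}.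
Proof.
move=> mf f0; rewrite ge0_integral_rV_S//.
have mfc : measurable_fun setT (f \o @rV_cons R n).
  by apply: measurableT_comp => //; exact: measurable_rV_cons.
have fc0 z : (0 <= (f \o @rV_cons R n) z)%E by exact: f0.
rewrite (fubini_tonelli (m1 := lam) (m2 := lebesgue_rV R n) (f \o @rV_cons R n))//.
apply: ae_lty_of_integral.
  exact: (measurable_fun_fubini_tonelli_G (m1 := lam) (f \o @rV_cons R n)).
by move=> v; apply: integral_ge0 => s _; exact: f0.
Qed.

Lemma test_function_partial_out (O : domain R n.+1) (phi : 'rV[R]_n.+1 -> R) i x :
  test_function O phi -> ~ O x -> partial i phi x = 0.
Proof.
move=> [_ [K [cK KO K0]] phi0] nOx.
have nKx : ~ K x by move/KO.
have oK : open (~` K).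
  by apply: closed_openC; apply: compact_closed => //; exact: norm_hausdorff.
have : \forall y \near x, phi y = 0.
  have : nbhs x (~` K) by exact: open_nbhs_nbhs.
  apply: filterS => y nKy; have [Oy|] := pselect (O y); first exact: K0.
  exact: phi0.
move=> h; rewrite /partial (@near_eq_derive _ _ _ phi (cst 0))//.
by rewrite derive_cst.
Qed.

Variable O : domain R n.+1.
Local Notation nu := (lebesgue_on O).
Local Notation L := (lebesgue_rV R n.+1).

Lemma continuous_measurable_partial (phi : 'rV[R]_n.+1 -> R) i :
  smooth phi -> continuous (partial i phi).
Proof. by move=> sphi x; apply/differentiable_continuous; exact: (sphi [:: i]). Qed.

Lemma Lnorm2_cvg_small (f : nat -> 'rV[R]_n.+1 -> R) (e : R) : 0 < e ->
  ('N[nu]_2%:E[EFin \o f k] @[k --> \oo] --> 0)%E ->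
  \forall k \near \oo, (\int[nu]_x (f k x ^+ 2)%:E < e%:E)%E.
Proof.
move=> e0 cf; have e0' : (0 < (Num.sqrt e)%:E)%E by rewrite lte_fin sqrtr_gt0.
by have := cvge0_near_lt cf e0'; apply: filterS => k; exact: integral_sqr_lt.
Qed.

(* The test functions approximating u converge to F along almost every line in
   the first coordinate direction, and they vanish off O: this is where the
   boundary condition enters, without any regularity of the boundary. *)
Lemma ae_line_continuous (u : L2 O) (g : 'I_n.+1 -> L2 O) (F : 'rV[R]_n.+1 -> R) :
  H10 u g -> measurable_fun setT F -> (forall x, ~ O x -> F x = 0) ->
  (forall x, O x -> {for x, continuous F}) -> (u : _ -> _) = F %[ae nu] ->
  {ae lebesgue_rV R n, forall v, continuous (fun s => F (rV_cons (s, v))) /\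
     (\int[lam]_s (F (rV_cons (s, v)) ^+ 2)%:E < +oo)%E}.
Proof.
move=> [phi [tphi cphi dphi]] mF F0 cF uF.
have mO := measurable_domain O.
pose gb x := g ord0 x * \1_O x.
have mgb : measurable_fun setT gb.
  by apply: measurable_funM => //; exact: measurable_indic.
have mphi k : measurable_fun setT (phi k).
  apply: continuous_measurable_rV => x; apply/differentiable_continuous.
  by have [sphi _ _] := tphi k; exact: (sphi [::]).
have mpphi k : measurable_fun setT (partial ord0 (phi k)).
  apply: continuous_measurable_rV; apply: continuous_measurable_partial.
  by have [] := tphi k.
(* Squared error on the function and on its first partial derivative. Everything is extended by zero
   off the domain, [gb] being the extended weak derivative, so that whole lines can be
   considered. *)
pose W k x := (phi k x - F x) ^+ 2 + (partial ord0 (phi k) x - gb x) ^+ 2.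
have mW k : measurable_fun setT (W k).
  by apply: measurable_funD; apply: measurable_funX; exact: measurable_funB.
have W0 k x : 0 <= W k x by rewrite addr_ge0 ?sqr_ge0.
have WE k : (\int[L]_x (W k x)%:E = \int[nu]_x ((phi k x - u x) ^+ 2)%:E +
    \int[nu]_x ((partial ord0 (phi k) x - g ord0 x) ^+ 2)%:E)%E.
  rewrite -ge0_integralD; last 5 first.
  - exact: measurableT.
  - by move=> x _; rewrite lee_fin sqr_ge0.
  - by apply/measurable_EFinP; apply: measurable_funX; exact: measurable_funB.
  - by move=> x _; rewrite lee_fin sqr_ge0.
  - by apply/measurable_EFinP; apply: measurable_funX; exact: measurable_funB.
  transitivity (\int[nu]_x (W k x)%:E)%E.
    rewrite ge0_integral_lebesgue_on; last 2 first.
    - by apply/measurable_EFinP; exact: mW.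
    - by move=> x; rewrite lee_fin.
    rewrite [RHS]integral_mkcond; apply: eq_integral => x _.
    rewrite patchE; case: ifPn => //; rewrite notin_setE => nOx.
    have [_ _ phi0] := tphi k.
    rewrite /W phi0// F0// (test_function_partial_out _ (tphi k))// /gb.
    by rewrite indicE memNset// mulr0 subrr expr0n/= addr0.
  apply: ge0_ae_eq_integral => //.
  - exact/measurable_EFinP.
  - apply/measurable_EFinP; apply: measurable_funD; apply: measurable_funX;
      exact: measurable_funB.
  - by move=> x _; rewrite lee_fin.
  - by move=> x _; rewrite adde_ge0// lee_fin sqr_ge0.
  - have := ae_in_domain O; apply: filterS2 uF => x ux Ox _.
    by rewrite -EFinD /W /gb indicE mem_set// mulr1 ux.
(* A subsequence with summable errors: by Tonelli's theorem the series of the line integrals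
   converges on almost every line, and the errors therefore tend to zero on that whole line. *)
have /choice[k_ hk] : forall j : nat, exists k,
    (\int[L]_x (W k x)%:E <= (1 / (2 ^ j.+1)%:R)%:E)%E.
  move=> j; pose e : R := 1 / (2 ^ j.+1)%:R.
  have e0 : 0 < e / 2 by rewrite !divr_gt0// ltr0n expn_gt0.
  have eE : (e%:E = (e / 2)%:E + (e / 2)%:E)%E by rewrite -EFinD -splitr.
  have h1 := Lnorm2_cvg_small e0 cphi.
  have h2 := Lnorm2_cvg_small e0 (dphi ord0).
  near \oo => k; exists k; rewrite WE -/e eE.
  by apply: leeD; apply: ltW; near: k.
have Woo : (\int[L]_x (\sum_(j <oo) (W (k_ j) x)%:E) < +oo)%E.
  rewrite integral_nneseries//; last 2 first.
  - by move=> j; exact/measurable_EFinP.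
  - by move=> j x _; rewrite lee_fin.
  apply: (@le_lt_trans _ _ 1%:E); last exact: ltry.
  apply: le_trans (@epsilon_trick0 R 1 xpredT ler01).
  apply: lee_nneseries => [j _|j _]; last exact: hk.
  by move=> _; apply: integral_ge0 => x _; rewrite lee_fin.
have F2oo : (\int[L]_x (F x ^+ 2 + gb x ^+ 2)%:E < +oo)%E.
  have mF2 : measurable_fun setT (fun x => (F x ^+ 2 + gb x ^+ 2)%:E).
    by apply/measurable_EFinP; apply: measurable_funD; exact: measurable_funX.
  apply: (@le_lt_trans _ _ (\int[nu]_x (u x ^+ 2)%:E +
    \int[nu]_x (g ord0 x ^+ 2)%:E)%E).
    rewrite -ge0_integralD; last 5 first.
    - exact: measurableT.
    - by move=> x _; rewrite lee_fin sqr_ge0.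
    - by apply/measurable_EFinP; exact: measurable_funX.
    - by move=> x _; rewrite lee_fin sqr_ge0.
    - by apply/measurable_EFinP; exact: measurable_funX.
    apply: (@le_trans _ _ (\int[nu]_x (F x ^+ 2 + gb x ^+ 2)%:E)%E).
      rewrite ge0_integral_lebesgue_on; last 2 first.
      - exact: mF2.
      - by move=> x; rewrite lee_fin addr_ge0 ?sqr_ge0.
      rewrite [leRHS]integral_mkcond le_eqVlt; apply/orP; left; apply/eqP.
      apply: eq_integral => x _.
      rewrite patchE; case: ifPn => //; rewrite notin_setE => nOx.
      by rewrite F0// /gb indicE memNset// mulr0 expr0n/= addr0.
    apply: ae_ge0_le_integral => //.
    - by move=> x _; rewrite lee_fin addr_ge0 ?sqr_ge0.
    - by move=> x _; rewrite adde_ge0 ?lee_fin ?sqr_ge0.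
    - by apply: emeasurable_funD; apply/measurable_EFinP; exact: measurable_funX.
    - have := ae_in_domain O; apply: filterS2 uF => x ux Ox _.
      by rewrite -EFinD /gb indicE mem_set// mulr1 ux.
  have L2oo (f : L2 O) : (\int[nu]_x (f x ^+ 2)%:E < +oo)%E.
    by rewrite -sqr_Lnorm2; apply: poweR_lty; exact: Lfunction_finite.
  by apply: lte_add_pinfty; exact: L2oo.
have mWs : measurable_fun setT (fun x => \sum_(j <oo) (W (k_ j) x)%:E)%E.
  apply: ge0_emeasurable_sum => //.
  - by move=> j x _ _; rewrite lee_fin.
  - by move=> j _; exact/measurable_EFinP.
have mF2 : measurable_fun setT (fun x => (F x ^+ 2 + gb x ^+ 2)%:E).
  by apply/measurable_EFinP; apply: measurable_funD; exact: measurable_funX.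
have h1 := ae_line_lty mWs (fun x => nneseries_ge0 (fun j _ _ =>
   (W0 (k_ j) x : (0 <= (W (k_ j) x)%:E)%E))) Woo.
have F20 x : (0 <= (F x ^+ 2 + gb x ^+ 2)%:E)%E.
  by rewrite lee_fin addr_ge0 ?sqr_ge0.
have h2 := ae_line_lty mF2 F20 F2oo.
apply: filterS2 h1 h2 => v h1 h2.
have mline (f : 'rV[R]_n.+1 -> R) : measurable_fun setT f ->
    measurable_fun setT (fun s => f (rV_cons (s, v))).
  move=> mf; apply/measurable_EFinP; apply: (@measurable_line (EFin \o f)).
  exact/measurable_EFinP.
have F2v : (\int[lam]_s (F (rV_cons (s, v)) ^+ 2)%:E < +oo)%E.
  apply: le_lt_trans h2; apply: ge0_le_integral => //.
  - by move=> s _; rewrite lee_fin sqr_ge0.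
  - apply/measurable_EFinP; apply: measurable_funX; exact: mline.
  - exact: measurable_line mF2.
  - by move=> s _; rewrite lee_fin lerDl sqr_ge0.
split => //.
have mWv j : measurable_fun setT (fun s => (W (k_ j) (rV_cons (s, v)))%:E).
  by apply/measurable_EFinP; exact: mline.
have hsum : (\sum_(j <oo) \int[lam]_s (W (k_ j) (rV_cons (s, v)))%:E < +oo)%E.
  by rewrite -integral_nneseries// => j s _; rewrite lee_fin.
have IW0 j : (0 <= \int[lam]_s (W (k_ j) (rV_cons (s, v)))%:E)%E.
  by apply: integral_ge0 => s _; rewrite lee_fin.
have termoo := cvge_nneseries_term IW0 hsum.
(* From (d phi)^2 <= 2 gb^2 + 2 W, the quantity 2 A + 2 Q bounds the energy on this line of every
   function of the subsequence. *)
pose A := (\int[lam]_s (F (rV_cons (s, v)) ^+ 2 + gb (rV_cons (s, v)) ^+ 2)%:E)%E.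
pose Q := (\sum_(j <oo) \int[lam]_s (W (k_ j) (rV_cons (s, v)))%:E)%E.
have A0 : (0 <= A)%E by apply: integral_ge0 => s _; exact: F20.
have Q0 : (0 <= Q)%E.
  by apply: nneseries_ge0 => j _ _; apply: integral_ge0 => s _; rewrite lee_fin.
have MoO : (2%:E * A + 2%:E * Q \is a fin_num)%E.
  by rewrite fin_numD !fin_numM// ge0_fin_numE.
apply: (@line_continuous R (fun j s => phi (k_ j) (rV_cons (s, v)))
  [set s | O (rV_cons (s, v))] _ (fine (2%:E * A + 2%:E * Q)%E)).
- have /continuousP := @continuous_rV_cons v; apply; exact: domain_open.
- move=> j s; apply/line_derivable; apply: diff_derivable.
  by have [sphi _ _] := tphi (k_ j); exact: (sphi [::]).
- move=> j; under eq_fun do rewrite line_derive.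
  move=> s; apply: (@continuous_comp _ _ _ (fun s => rV_cons (s, v))).
    exact: continuous_rV_cons.
  by apply: continuous_measurable_partial; have [] := tphi (k_ j).
- move=> j; rewrite fineK//; under eq_integral do rewrite line_derive.
  apply: (@le_trans _ _ (\int[lam]_s (2%:E * (F (rV_cons (s, v)) ^+ 2 +
     gb (rV_cons (s, v)) ^+ 2)%:E + 2%:E * (W (k_ j) (rV_cons (s, v)))%:E))%E).
    apply: ge0_le_integral => //.
    + by move=> s _; rewrite lee_fin sqr_ge0.
    + by apply/measurable_EFinP; apply: measurable_funX; exact: mline.
    + apply: emeasurable_funD; apply: emeasurable_funM => //.
        exact: measurable_line mF2.
      exact: mWv.
    + move=> s _; rewrite -!EFinM -EFinD lee_fin /W.
      set a := partial _ _ _; set b := gb _; set c := F _; set d := phi _ _.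
      have := sqr_ge0 c; have := sqr_ge0 (d - c); have := sqr_ge0 (a - 2 * b).
      nra.
  rewrite ge0_integralD//; last 4 first.
  - by move=> s _; rewrite mule_ge0.
  - by apply: emeasurable_funM => //; exact: measurable_line mF2.
  - by move=> s _; rewrite mule_ge0 ?lee_fin.
  - by apply: emeasurable_funM => //; exact: mWv.
  rewrite !ge0_integralZl_EFin//; last 3 first.
  - by move=> s _; rewrite lee_fin.
  - exact: mWv.
  - exact: measurable_line mF2.
  apply: leeD => //; apply: lee_wpmul2l; first by rewrite lee_fin.
  exact: (nneseries_ge_term j IW0).
- exact: mline.
- apply: (squeeze_cvge _ (cvg_cst 0%E) termoo); apply: nearW => j.
  apply/andP; split; first by apply: integral_ge0 => s _; rewrite lee_fin sqr_ge0.
  apply: ge0_le_integral => //.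
  + by move=> s _; rewrite lee_fin sqr_ge0.
  + apply/measurable_EFinP; apply: measurable_funX.
    by apply: measurable_funB; exact: mline.
  + exact: mWv.
  + by move=> s _; rewrite lee_fin lerDl sqr_ge0.
- move=> s /= Os; apply: (@continuous_comp _ _ _ (fun s => rV_cons (s, v)) F).
    exact: continuous_rV_cons.
  exact: cF.
- by move=> j s /= nOs; have [_ _ ->] := tphi (k_ j).
- by move=> s /= nOs; exact: F0.
Unshelve. all: by end_near.
Qed.

End lines.

(** * Differentiation under the integral *)

Section dot.
Context {R : realType} {n : nat}.

Definition dot (d h : 'rV[R]_n) : R := \sum_(i < n) h ord0 i * d ord0 i.

Lemma dot_is_linear (d : 'rV[R]_n) : linear (dot d : 'rV[R]_n -> R^o).
Proof.
move=> k u v; rewrite /dot scaler_sumr -big_split/=; apply: eq_bigr => i _.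
by rewrite !mxE mulrDl -mulrA.
Qed.

HB.instance Definition _ (d : 'rV[R]_n) :=
  GRing.isLinear.Build R 'rV[R]_n R^o _ (dot d) (dot_is_linear d).

Lemma dot_le (d h : 'rV[R]_n) (g : R) : (forall i, `|d ord0 i| <= g) ->
  `|dot d h| <= n%:R * g * `|h|.
Proof.
move=> dg; apply: (le_trans (ler_norm_sum _ _ _)).
apply: (@le_trans _ _ (\sum_(i < n) g * `|h|)).
  apply: ler_sum => i _; rewrite normrM mulrC ler_pM// coord_le_norm//.
by rewrite sumr_const card_ord -mulrnAl mulr_natl.
Qed.

Lemma continuous_dot (d : 'rV[R]_n) : continuous (dot d).
Proof.
apply: (@continuous_big _ _ +%R 0 xpredT _ _ _
  (fun i (x : 'rV[R]_n) => x ord0 i * d ord0 i)) => [|i _ y].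
  exact: add_continuous.
apply: (@continuous_comp _ _ _ (fun x : 'rV[R]_n => x ord0 i)
  (fun t : R => t * d ord0 i)); first exact: coord_continuous.
by apply: cvgM; [exact: cvg_id|exact: cvg_cst].
Qed.

Lemma diff_dot (f : 'rV[R]_n -> R) x h :
  differentiable f x -> 'd f x h = dot (grad f x) h.
Proof.
move=> df; rewrite [in LHS](row_sum_delta h) linear_sum /dot.
apply: eq_bigr => i _; rewrite linearZ/= mxE /partial deriveE//.
Qed.

Lemma differentiable_of_le (f : 'rV[R]_n -> R) x (d : 'rV[R]_n) :
  (forall e : R, 0 < e -> \forall h \near (0 : 'rV[R]_n),
     `|f (h + x) - f x - dot d h| <= e * `|h|) ->
  differentiable f x /\ grad f x = d.
Proof.
move=> H.
have E : f \o shift x = cst (f x) + dot d +o_ (0 : 'rV[R]_n) id.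
  apply/eqaddoP => e e0; have := H e e0; apply: filterS => h /=.
  by rewrite opprD addrA.
have dE := diff_unique (@continuous_dot d) E.
have df : differentiable f x.
  by apply/diff_locallyP; rewrite dE; split => //; exact: continuous_dot.
split => //; apply/rowP => i.
rewrite mxE /partial deriveE// dE /= /dot (bigD1 i)//= big1 ?addr0.
  by rewrite mxE !eqxx mul1r.
by move=> j ji; rewrite mxE eqxx/= (negbTE ji) mul0r.
Qed.

End dot.

(** Sampling at 1 / (k + 1) makes a directional derivative the limit of a sequence, which is what
    measurability arguments need. *)
Lemma derive_harmonic (R : realType) (V W : normedModType R) (f : V -> W) (x v : V) :
  derivable f x v ->
  (harmonic k)^-1 *: (f (harmonic k *: v + x) - f x) @[k --> \oo] --> 'D_v f x.
Proof.
move=> df.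
have hd : (harmonic k : R) @[k --> \oo] --> (0 : R)^'.
  move=> A A0.
  have H : \forall k \near \oo, harmonic k != 0 :> R -> A (harmonic k) :=
    @cvg_harmonic R _ A0.
  change (\forall k \near \oo, A (harmonic k)).
  by apply: filterS H => k; apply; rewrite /harmonic/= invr_eq0 pnatr_eq0.
exact: (cvg_comp _ _ hd df).
Qed.

Section differentiation_under_integral.
Context {R : realType} {n : nat} d (T : measurableType d).
Variables (m : {measure set T -> \bar R}) (P : 'rV[R]_n -> T -> R).
Variables (x : 'rV[R]_n) (r : R) (g : T -> R).
Hypothesis r0 : 0 < r.
Hypothesis iP : forall z, ball x r z -> m.-integrable setT (EFin \o P z).
Hypothesis dP : forall z y, ball x r z -> differentiable (P ^~ y) z.
Hypothesis ig : m.-integrable setT (EFin \o g).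
Hypothesis gP : forall z y i, ball x r z -> `|partial i (P ^~ y) z| <= g y.

Let mP z : ball x r z -> measurable_fun setT (P z).
Proof. by move=> xz; apply/measurable_EFinP; exact: measurable_int (iP xz). Qed.

Let xx : ball x r x. Proof. exact: ballxx. Qed.

Lemma increment_le_partial y h : ball x r (h + x) ->
  `|P (h + x) y - P x y| <= n%:R * g y * `|h|.
Proof.
move=> xh.
have bs (s : R) : 0 <= s <= 1 -> ball x r (s *: h + x).
  move=> /andP[s0 s1]; move: xh; rewrite -!ball_normE/= => xh.
  rewrite opprD addrCA subrr addr0 normrN normrZ (ger0_norm s0).
  move: xh; rewrite opprD addrCA subrr addr0 normrN => xh.
  by rewrite (le_lt_trans _ xh)// ler_piMl.
pose f (s : R) := P (s *: h + x) y.
have df (s : R) : 0 <= s <= 1 -> is_derive s 1 f (dot (grad (P ^~ y) (s *: h + x)) h).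
  move=> s01; have dz := dP y (bs s s01).
  have -> : dot (grad (P ^~ y) (s *: h + x)) h = 'D_h (P ^~ y) (s *: h + x).
    by rewrite deriveE// diff_dot.
  have E : (fun k : R => k^-1 *: ((f \o shift s) (k *: 1) - f s)) =
    (fun k : R => k^-1 *: (((P ^~ y) \o shift (s *: h + x)) (k *: h) - P (s *: h + x) y)).
    apply/funext => k /=; congr (_ *: (P _ _ - _)).
    have -> : k *: (1 : R) = k by rewrite /GRing.scale/= mulr1.
    by rewrite scalerDl addrA.
  split; first by rewrite /derivable E; exact: diff_derivable.
  by rewrite /derive E.
have [s||c] := @MVT R f (fun s => dot (grad (P ^~ y) (s *: h + x)) h) 0 1 ltr01.
- by rewrite in_itv/= => /andP[s0 s1]; apply: df; rewrite !ltW.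
- apply: derivable_within_continuous => s; rewrite in_itv/= => /df h1.
  exact: ex_derive.
rewrite in_itv/= => /andP[c0 c1]; rewrite /f scale1r scale0r add0r subr0 mulr1.
move=> ->; apply: dot_le => i; rewrite mxE; apply: gP.
by apply: bs; rewrite !ltW.
Qed.

Lemma near_ball_add : \forall h \near (0 : 'rV[R]_n), ball x r (h + x).
Proof.
near=> h; rewrite -ball_normE/= opprD addrCA subrr addr0 normrN.
by near: h; exact: (@nbhs0_lt R 'rV[R]_n).
Unshelve. all: by end_near. Qed.

Lemma measurable_partial i : measurable_fun setT (fun y => partial i (P ^~ y) x).
Proof.
pose h (k : nat) : 'rV[R]_n := harmonic k *: delta_mx ord0 i.
pose q (k : nat) y := if `[< ball x r (h k + x) >]
  then (harmonic k)^-1 * (P (h k + x) y - P x y) else 0.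
apply: (@measurable_fun_cvg _ _ _ _ q) => [k|y _].
  have [xh|xh] := boolP `[< ball x r (h k + x) >]; last first.
    by rewrite (_ : q k = cst 0)//; apply/funext => y; rewrite /q (negbTE xh).
  rewrite (_ : q k = fun y => (harmonic k)^-1 * (P (h k + x) y - P x y)); last first.
    by apply/funext => y; rewrite /q xh.
  move/asboolP in xh.
  by apply: measurable_funM; [exact: measurable_cst|apply: measurable_funB; exact: mP].
have := derive_harmonic (@diff_derivable _ _ _ _ _ (delta_mx ord0 i) (dP y xx)).
have hr : \forall k \near \oo, ball x r (h k + x).
  have h0 : h k @[k --> \oo] --> (0 : 'rV[R]_n).
    by rewrite -[X in _ --> X](scale0r (delta_mx ord0 i)); apply: cvgZr_tmp; exact: cvg_harmonic.
  exact: (h0 _ near_ball_add).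
apply: cvg_trans; apply: near_eq_cvg; apply: filterS hr => k hk.
by rewrite /q asboolT.
Qed.

Lemma integrable_partial i : m.-integrable setT (EFin \o (fun y => partial i (P ^~ y) x)).
Proof.
apply: (le_integrable measurableT _ _ ig).
  by apply/measurable_EFinP; exact: measurable_partial.
by move=> y _ /=; rewrite lee_fin (le_trans (gP y i xx))// ler_norm.
Qed.

Let F z := (\int[m]_y P z y)%R.
Let D : 'rV[R]_n := \row_i (\int[m]_y partial i (P ^~ y) x)%R.

Let remainder h y := P (h + x) y - P x y - dot (grad (P ^~ y) x) h.

Let integrable_dot h :
  m.-integrable setT (EFin \o (fun y => dot (grad (P ^~ y) x) h)).
Proof.
have -> : EFin \o (fun y => dot (grad (P ^~ y) x) h) =
    (fun y => \sum_(i < n) ((h ord0 i)%:E * (partial i (P ^~ y) x)%:E))%E.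
  apply/funext => y /=; rewrite /dot -sumEFin.
  by apply: eq_bigr => i _; rewrite mxE EFinM.
apply: integrable_sum => // i _.
by apply: integrableZl => //; exact: integrable_partial.
Qed.

Let integral_dot h : (\int[m]_y dot (grad (P ^~ y) x) h)%R = dot D h.
Proof.
rewrite /Rintegral; have -> : (\int[m]_y (dot (grad (P ^~ y) x) h)%:E =
    \int[m]_y (\sum_(i < n) ((h ord0 i)%:E * (partial i (P ^~ y) x)%:E)))%E.
  apply: eq_integral => y _; rewrite /dot -sumEFin.
  by apply: eq_bigr => i _; rewrite mxE EFinM.
rewrite integral_sum//; last first.
  by move=> i; apply: integrableZl => //; exact: integrable_partial.
rewrite /dot -sum_fine; last first.
  move=> i _; apply: integrable_fin_num => //.
  by apply: integrableZl => //; exact: integrable_partial.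
apply: eq_bigr => i _; rewrite mxE.
have := RintegralZl (h ord0 i) measurableT (integrable_partial i).
by rewrite /Rintegral => <-; congr fine; apply: eq_integral => y _; rewrite EFinM.
Qed.

Let integrable_remainder h : ball x r (h + x) ->
  m.-integrable setT (EFin \o remainder h).
Proof.
move=> xh; have -> : EFin \o remainder h =
    (((EFin \o P (h + x)%R) \- (EFin \o P x)) \-
    (EFin \o (fun y => dot (grad (P ^~ y) x) h)))%E by [].
apply: integrableB => //; apply: integrableB => //; exact: iP.
Qed.

Let integral_remainder h : ball x r (h + x) ->
  (\int[m]_y remainder h y)%R = F (h + x) - F x - dot D h.
Proof.
move=> xh; rewrite /remainder RintegralB//; last first.
  have -> : EFin \o (fun y => P (h + x) y - P x y) =
    ((EFin \o P (h + x)%R) \- (EFin \o P x))%E by [].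
  by apply: integrableB => //; exact: iP.
rewrite RintegralB//; [|exact: iP|exact: iP].
by rewrite integral_dot.
Qed.

(** A failure of differentiability would occur along a sequence h_k tending to 0. The remainder
    divided by |h_k| tends to 0 pointwise and is at most 2 n g: n g from the mean value inequality,
    n g from the linear part. Dominated convergence gives the contradiction, and full
    differentiability rather than mere partial derivatives. *)
Lemma differentiable_under_integral :
  differentiable (fun z => \int[m]_y P z y)%R x /\
  forall i, partial i (fun z => \int[m]_y P z y)%R x =
    (\int[m]_y partial i (P ^~ y) x)%R.
Proof.
suff [dF gF] : differentiable F x /\ grad F x = D.
  by split => // i; have /rowP/(_ i) := gF; rewrite !mxE.
apply: differentiable_of_le => e e0; apply: contrapT => nH.
have /choice[h hP] : forall k : nat, exists h : 'rV[R]_n,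
    [/\ `|h| < harmonic k, ball x r (h + x) &
      e * `|h| < `|F (h + x) - F x - dot D h|].
  move=> k; apply: contrapT => nh; apply: nH.
  have hk : 0 < harmonic k :> R by rewrite /harmonic invr_gt0.
  near=> h; rewrite leNgt; apply/negP => eh; apply: nh; exists h; split; last exact: eh.
    by near: h; exact: (@nbhs0_lt R 'rV[R]_n).
  by near: h; exact: near_ball_add.
have h0 k : 0 < `|h k|.
  rewrite lt_neqAle normr_ge0 andbT eq_sym normr_eq0; apply/eqP => hk0.
  have [_ _] := hP k; rewrite hk0 normr0 mulr0 add0r subrr sub0r normrN.
  by rewrite /dot big1 ?normr0 ?ltxx// => i _; rewrite mxE mul0r.
have ch : h k @[k --> \oo] --> (0 : 'rV[R]_n).
  apply/cvgr0Pnorm_lt => eps eps0.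
  have := @cvg_harmonic R; move=> /cvgr0Pnorm_lt/(_ eps eps0).
  apply: filterS => k; have [hk _ _] := hP k; apply: lt_trans.
  by rewrite (lt_le_trans hk)// ler_norm.
pose v k y := `|h k|^-1 * remainder (h k) y.
have iv k : m.-integrable setT (EFin \o v k).
  have -> : EFin \o v k = (fun y => (`|h k|^-1)%:E * (remainder (h k) y)%:E)%E.
    by apply/funext => y; rewrite /= EFinM.
  by apply: integrableZl => //; apply: integrable_remainder; have [] := hP k.
have cv y : v k y @[k --> \oo] --> 0.
  apply/cvgr0Pnorm_le => eps eps0.
  have /diff_locallyP[_ /eqaddoP/(_ eps eps0) H] := dP y xx.
  have {}H : \forall k \near \oo, `|((P ^~ y) \o shift x - (cst (P x y) + 'd (P ^~ y) x)) (h k)| <= eps * `|h k| := ch _ H.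
  apply: filterS H => k Hk.
  rewrite /v normrM normfV normr_id mulrC ler_pdivrMr//; apply: le_trans Hk.
  rewrite /remainder -diff_dot; last exact: dP.
  by rewrite -addrA -opprD.
have gv k y : `|v k y| <= (n%:R + n%:R) * g y.
  have [_ xh _] := hP k.
  rewrite normrM normfV normr_id mulrC ler_pdivrMr//.
  rewrite (le_trans (ler_normB _ _))// mulrDl mulrDl lerD//.
    exact: increment_le_partial.
  by apply: dot_le => i; rewrite mxE; exact: gP.
have [|||||_ _ H] := @dominated_convergence _ _ _ m setT measurableT
  (fun k => EFin \o v k) (cst 0%E) (fun y => (((n%:R + n%:R) * g y)%:E)).
- by move=> k; exact: measurable_int (iv k).
- exact: measurable_cst.
- by apply: aeW => y _; apply/cvg_EFin; [exact: nearW|exact: cv].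
- have -> : (fun y => ((n%:R + n%:R) * g y)%:E) =
    (fun y => (n%:R + n%:R)%:E * (g y)%:E)%E by apply/funext.
  exact: integrableZl.
- by apply: aeW => y k _; rewrite lee_fin.
move: H; rewrite integral0 => /fine_cvg/cvgr0Pnorm_lt/(_ e e0)[N _ /(_ N (leqnn N))].
have [_ xh eh] := hP N.
rewrite /= -/(Rintegral m setT (v N)).
have -> : (\int[m]_y v N y)%R = `|h N|^-1 * (F (h N + x) - F x - dot D (h N)).
  rewrite -integral_remainder// /v.
  by rewrite RintegralZl//; exact: integrable_remainder.
rewrite normrM normfV normr_id mulrC ltr_pdivrMr//.
by apply/negP; rewrite -leNgt ltW.
Unshelve. all: by end_near. Qed.

End differentiation_under_integral.

Lemma measurable_Rintegral_param d d' (T : measurableType d) (T' : measurableType d')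
    (R : realType) (m : {sigma_finite_measure set T' -> \bar R}) (H : T -> T' -> R) :
  measurable_fun setT (fun xy => H xy.1 xy.2) ->
  measurable_fun setT (fun x => \int[m]_y H x y)%R.
Proof.
move=> mH; rewrite /Rintegral.
have mE : measurable_fun setT (fun x : T => (\int[m]_y (H x y)%:E)%E).
  have mHE : measurable_fun setT (fun xy : T * T' => (H xy.1 xy.2)%:E) by exact/measurable_EFinP.
  have -> : (fun x : T => (\int[m]_y (H x y)%:E)%E) =
      (fun x => fubini_F m (fun xy : T * T' => (H xy.1 xy.2)%:E)^\+ x -
                fubini_F m (fun xy : T * T' => (H xy.1 xy.2)%:E)^\- x)%E.
    apply/funext => x; rewrite integralE /fubini_F.
    by congr (_ - _)%E; apply: eq_integral => y _; rewrite ?funeposE ?funenegE.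
  apply: emeasurable_funB; apply: measurable_fun_fubini_tonelli_F => //.
  - exact: measurable_funepos.
  - exact: measurable_funeneg.
exact: (measurableT_comp (@fine_measurable R setT measurableT) mE).
Qed.

(** * Comparison of heat bounds at nearby points *)

Section heat_bound_theory.
Context {R : realType} {n : nat}.
Variable O : domain R n.
Local Notation nu := (lebesgue_on O).
Local Notation L := (lebesgue_rV R n).
Local Notation bf := (boundary_factor O).
Implicit Types (c t : R) (x y z : 'rV[R]_n) (f : 'rV[R]_n -> R).

(** The factor of [gaussian_shift] for s = c t and a shift of length sqrt t; t cancels. *)
Definition shift_const c : R := 2 `^ (n%:R / 2) * expR (1 / (2 * c)).

Lemma shift_const_gt0 c : 0 < shift_const c.
Proof. by rewrite /shift_const mulr_gt0 ?powR_gt0 ?expR_gt0. Qed.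

Lemma gaussian_near c t x x' y : 0 < c -> 0 < t -> enorm (x - x') <= Num.sqrt t ->
  gaussian (c * t) (x - y) <= shift_const c * gaussian (2 * c * t) (x' - y).
Proof.
move=> c0 t0 xx'; apply: (le_trans (gaussian_shift (x - y) (x' - y) _)).
  by rewrite mulr_gt0.
rewrite mulrA; apply: ler_wpM2r; first exact: gaussian_ge0.
rewrite ler_pM2l ?powR_gt0// ler_expR.
have -> : x - y - (x' - y) = x - x' by rewrite opprB addrA subrK.
have h2 : enorm (x - x') ^+ 2 <= t.
  by rewrite -[leRHS]sqr_sqrtr ?(ltW t0)// ler_sqr ?nnegrE ?enorm_ge0 ?sqrtr_ge0.
rewrite ler_pdivrMr ?mulr_gt0//; apply: (le_trans h2).
rewrite le_eqVlt; apply/orP; left; apply/eqP; field.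
by rewrite gt_eqF.
Qed.

Lemma measurable_heat_section c t f x : measurable_fun setT f ->
  measurable_fun setT (fun y => bf t y * gaussian (c * t) (x - y) * `|f y|).
Proof. by move=> mf; exact: (measurableT_comp (@measurable_heat_integrand _ _ O c t f mf) (pair1_measurable x)). Qed.

(** Plays the role of a Harnack inequality: it transfers finiteness and bounds from a good nearby
    point to a prescribed one. *)
Lemma heat_bound_near c t f x x' : 0 < c -> 0 < t -> measurable_fun setT f ->
  enorm (x - x') <= Num.sqrt t ->
  (heat_bound O c t f x <= (shift_const c)%:E * heat_bound O (2 * c) t f x')%E.
Proof.
move=> c0 t0 mf xx'; apply: ge0_le_integralZ => //.
- exact: measurable_heat_section.
- exact: measurable_heat_section.
- by move=> y; exact: heat_integrand_ge0.
- by move=> y; exact: heat_integrand_ge0.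
- exact/ltW/shift_const_gt0.
apply: aeW => y.
rewrite [leRHS]mulrA ler_wpM2r// (mulrCA (shift_const c)).
by rewrite ler_wpM2l ?boundary_factor_ge0// gaussian_near.
Qed.

Lemma integrable_heat c t f x : measurable_fun setT f ->
  (heat_bound O c t f x < +oo)%E ->
  nu.-integrable setT
    (EFin \o (fun y => bf t y * gaussian (c * t) (x - y) * `|f y|)).
Proof.
move=> mf hf; apply/integrableP; split.
  by apply/measurable_EFinP; exact: measurable_heat_section.
apply: le_lt_trans hf; rewrite le_eqVlt; apply/orP; left; apply/eqP.
by apply: eq_integral => y _ /=; rewrite ger0_norm// heat_integrand_ge0.
Qed.

Lemma domain_ball (t : R) x : 0 < t -> O x -> exists2 r : R, 0 < r &
  forall z, ball x r z -> O z /\ enorm (z - x) <= Num.sqrt t.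
Proof.
move=> t0 Ox; have st : 0 < Num.sqrt t by rewrite sqrtr_gt0.
have h1 : \forall z \near x, O z.
  by have := domain_open O; rewrite openE => /(_ x Ox).
have h2 : \forall z \near x, enorm (x - z) < Num.sqrt t.
  have := @continuous_enorm_sub R n x x; rewrite /continuous_at subrr enorm0.
  by move=> /cvgr_lt/(_ _ st).
have /nbhs_ballP[r /= r0 rP] : nbhs x (fun z => O z /\ enorm (x - z) < Num.sqrt t).
  exact: filterI h1 h2.
exists r => // z /rP[Oz xz]; split => //.
by rewrite enormC ltW.
Qed.

Lemma ae_open_point (P U : set 'rV[R]_n) x : {ae nu, forall z, P z} ->
  O x -> nbhs x U -> exists z, [/\ U z, O z & P z].
Proof.
move=> /lebesgue_on_ae[N [mN N0 NP]] Ox xU.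
have : nbhs x (U `&` O).
  by apply: filterI => //; have := domain_open O; rewrite openE => /(_ x Ox).
rewrite nbhsE => -[W [oW Wx] WUO]; apply: contrapT => h.
have : (0 < L W)%E by exact: lebesgue_rV_open_gt0 oW Wx.
apply/negP; rewrite -leNgt -N0 le_measure ?inE//; first exact: open_measurable_rV.
move=> z /WUO[Uz Oz]; apply: NP => Pz; apply: h; exists z; split => //.
exact: Pz.
Qed.

End heat_bound_theory.
Arguments shift_const {R} n c.

Lemma partialZr (R : realType) n (f : 'rV[R]_n -> R) (k : R) i x :
  differentiable f x -> partial i (fun z => f z * k) x = partial i f x * k.
Proof.
move=> df; rewrite /partial.
have -> : (fun z => f z * k) = k *: f.
  by apply/funext => z; rewrite mulrC.
by rewrite deriveZ; [exact: mulrC|exact: diff_derivable].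
Qed.

Lemma differentiableZr (R : realType) n (f : 'rV[R]_n -> R) (k : R) x :
  differentiable f x -> differentiable (fun z => f z * k) x.
Proof.
move=> df; have -> : (fun z => f z * k) = k *: f.
  by apply/funext => z; rewrite mulrC.
exact: differentiableZ.
Qed.

(** * Integral operators whose kernel has a gradient bound *)

Section gradient_kernel.
Context {R : realType} {n : nat}.
Variable O : domain R n.
Local Notation V := 'rV[R]_n.
Local Notation nu := (lebesgue_on O).
Local Notation L := (lebesgue_rV R n).
Local Notation bf := (boundary_factor O).
Variables (c t B : R) (K : V -> V -> R).
Hypotheses (c0 : 0 < c) (t0 : 0 < t) (B0 : 0 <= B).
Hypothesis mK : measurable_fun setT (fun xy : V * V => K xy.1 xy.2).
Hypothesis dK : forall x y, O x -> differentiable (K ^~ y) x.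
Hypothesis gK : forall x y i, O x ->
  `|partial i (K ^~ y) x| <= B * (bf t y * gaussian (c * t) (x - y)).
Variable f : V -> R.
Hypothesis mf : measurable_fun setT f.

Let mKf : measurable_fun setT (fun xy : V * V => K xy.1 xy.2 * f xy.2).
Proof.
by apply: measurable_funM => //; exact: (measurableT_comp mf measurable_snd).
Qed.

Lemma measurable_kernel_section x : measurable_fun setT (fun y => K x y * f y).
Proof. exact: (measurableT_comp mKf (pair1_measurable x)). Qed.

Let dKf x y : O x -> differentiable (fun z => K z y * f y) x.
Proof. by move=> Ox; apply: differentiableZr; exact: dK. Qed.

Let gKf x y i : O x -> `|partial i (fun z => K z y * f y) x| <=
  B * (bf t y * gaussian (c * t) (x - y) * `|f y|).
Proof.
move=> Ox; rewrite partialZr; last exact: dK.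
by rewrite normrM [leRHS]mulrA ler_wpM2r// gK.
Qed.

Let gKf_near x z y i : O z -> enorm (z - x) <= Num.sqrt t ->
  `|partial i (fun z => K z y * f y) z| <=
  B * shift_const n c * (bf t y * gaussian (2 * c * t) (x - y) * `|f y|).
Proof.
move=> Oz zx; apply: (le_trans (gKf y i Oz)).
rewrite -[leRHS]mulrA ler_wpM2l// [leRHS]mulrA ler_wpM2r//.
by rewrite (mulrCA (shift_const n c)) ler_wpM2l ?boundary_factor_ge0// gaussian_near.
Qed.

(** Integrability is known at some z within sqrt t of x, and the gradient bound controls K x y f y -
    K z y f y by an integrable function of y: integrability at almost every point spreads to every
    point. *)
Lemma integrable_kernel x :
  (forall x, O x -> (heat_bound O (2 * c) t f x < +oo)%E) ->
  {ae nu, forall x, nu.-integrable setT (EFin \o (fun y => K x y * f y))} ->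
  O x -> nu.-integrable setT (EFin \o (fun y => K x y * f y)).
Proof.
move=> hf iK Ox; have [r r0 rP] := domain_ball t0 Ox.
have [z [xz Oz iz]] := ae_open_point iK Ox (nbhsx_ballx x r r0).
have [_ zx] := rP z xz.
pose g y := B * shift_const n c * (bf t y * gaussian (2 * c * t) (x - y) * `|f y|).
have ig : nu.-integrable setT (EFin \o (fun y => n%:R * `|z - x| * g y)).
  have -> : EFin \o (fun y => n%:R * `|z - x| * g y) =
    (fun y => (n%:R * `|z - x| * (B * shift_const n c))%:E *
      (bf t y * gaussian (2 * c * t) (x - y) * `|f y|)%:E)%E.
    by apply/funext => y; rewrite /= -EFinM /g !mulrA.
  by apply: integrableZl => //; apply: integrable_heat => //; exact: hf.
apply: (le_integrable measurableT _ _ (integrableD measurableT (integrable_abse iz) ig)).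
  by apply/measurable_EFinP; exact: measurable_kernel_section.
move=> y _ /=; rewrite lee_fin.
have g0 : 0 <= g y.
  by rewrite mulr_ge0 ?heat_integrand_ge0// mulr_ge0// ltW ?shift_const_gt0.
rewrite [leRHS]ger0_norm; last by apply: addr_ge0 => //; apply: mulr_ge0 => //; exact: mulr_ge0.
rewrite -[K x y * f y](subrK (K z y * f y)) [leRHS]addrC.
apply: (le_trans (ler_normD _ _)); rewrite lerD2r distrC.
have := @increment_le_partial R n _ _ (fun z y => K z y * f y) x r g _ _ y (z - x).
rewrite subrK mulrAC => h; apply: h => //.
- by move=> u v /rP[Ou _]; exact: dKf.
- by move=> u v i /rP[Ou ux]; exact: gKf_near.
Qed.

Lemma differentiable_kernel x :
  (heat_bound O (2 * c) t f x < +oo)%E ->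
  (forall x, O x -> nu.-integrable setT (EFin \o (fun y => K x y * f y))) ->
  O x ->
  differentiable (fun x => \int[nu]_y (K x y * f y))%R x /\
  forall i, (`|partial i (fun x => \int[nu]_y (K x y * f y))%R x|%:E <=
    B%:E * heat_bound O c t f x)%E.
Proof.
move=> hf iK Ox; have [r r0 rP] := domain_ball t0 Ox.
pose g y := B * shift_const n c * (bf t y * gaussian (2 * c * t) (x - y) * `|f y|).
have ig : nu.-integrable setT (EFin \o g).
  have -> : EFin \o g = (fun y => (B * shift_const n c)%:E *
      (bf t y * gaussian (2 * c * t) (x - y) * `|f y|)%:E)%E by apply/funext.
  by apply: integrableZl => //; exact: integrable_heat.
have iP z : ball x r z -> nu.-integrable setT (EFin \o (fun y => K z y * f y)).
  by move=> /rP[Oz _]; exact: iK.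
have dP z y : ball x r z -> differentiable (fun z => K z y * f y) z.
  by move=> /rP[Oz _]; exact: dKf.
have gP z y i : ball x r z -> `|partial i (fun z => K z y * f y) z| <= g y.
  by move=> /rP[Oz zx]; exact: gKf_near.
have [dF pF] := differentiable_under_integral r0 iP dP ig gP.
split => // i; rewrite pF.
have ip := integrable_partial r0 iP dP ig gP i.
rewrite -abse_EFin /Rintegral fineK; last exact: integrable_fin_num.
apply: (le_trans (le_abse_integral _ measurableT _)).
  exact: measurable_int ip.
apply: ge0_le_integralZ => //.
- by apply: measurableT_comp => //; apply/measurable_EFinP; exact: measurable_int ip.
- exact: measurable_heat_section.
- by move=> y; exact: heat_integrand_ge0.
- by apply: aeW => y; exact: gKf.
Qed.

End gradient_kernel.

(** * Absolute bound on the kernel *)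

Lemma is_derive_ray (R : realType) n (F : 'rV[R]_n.+1 -> R) (r s : R) (v : 'rV[R]_n) :
  differentiable F (rV_cons (r * s, v)) ->
  is_derive s 1 (fun s => F (rV_cons (r * s, v)))
    (r * partial ord0 F (rV_cons (r * s, v))).
Proof.
set x := rV_cons (r * s, v); set f := fun s => _ => dF.
have -> : r * partial ord0 F x = 'D_(r *: delta_mx ord0 ord0) F x.
  by rewrite /partial !deriveE// linearZ.
have E : (fun k : R => k^-1 *: ((f \o shift s) (k *: 1) - f s)) =
    (fun k : R => k^-1 *: ((F \o shift x) (k *: (r *: delta_mx ord0 ord0)) - F x)).
  apply/funext => k /=; congr (_ *: (_ - _)); rewrite /f; congr (F _).
  have -> : k *: (1 : R) = k by rewrite /GRing.scale/= mulr1.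
  by rewrite mulrDr addrC rV_cons_shift scalerA (mulrC k) addrC.
split; first by rewrite /derivable E; exact: diff_derivable.
by rewrite /derive E.
Qed.

Lemma ae_rV_cons (R : realType) n (P : 'rV[R]_n -> Prop) :
  {ae lebesgue_rV R n, forall v, P v} ->
  {ae lebesgue_rV R n.+1, forall x, P (rV_uncons x).2}.
Proof.
move=> [N [mN N0 NP]].
have mN' : measurable ((@rV_uncons R n) @^-1` ([set: R] `*` N)).
  rewrite -[X in measurable X]setTI; apply: measurable_rV_uncons => //.
  exact: measurableX.
exists ((@rV_uncons R n) @^-1` ([set: R] `*` N)); split => //.
  rewrite /= /lebesgue_rV_S /pushforward -comp_preimage.
  rewrite (_ : _ \o _ = id); last exact/funext/rV_consK.
  by rewrite preimage_id product_measure1E// N0 mule0.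
by move=> x /= nP; split => //; exact: NP.
Qed.

(* Moving away from the half-space containing y costs exp(- d^2 / (2 sg^2)), which is
   at most exp(1/2 - d / sg). *)
Lemma gaussian_ray (R : realType) n (c t s a : R) (r : R) (v : 'rV[R]_n) (x y : 'rV[R]_n.+1) :
  0 < c -> 0 < t -> r ^+ 2 = 1 -> x = rV_cons (r * a, v) -> a <= s ->
  r * y ord0 ord0 <= a ->
  gaussian (c * t) (rV_cons (r * s, v) - y) <=
    expR (1 / 2) * expR (- (s - a) / Num.sqrt (c * t)) * gaussian (c * t) (x - y).
Proof.
move=> c0 t0 r1 -> as_ ya.
have ct0 : 0 < c * t by rewrite mulr_gt0.
set sg := Num.sqrt (c * t); have sg0 : 0 < sg by rewrite sqrtr_gt0.
have -> : c * t = sg ^+ 2 by rewrite sqr_sqrtr// ltW.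
rewrite /gaussian [leRHS]mulrCA ler_wpM2l ?powR_ge0// -!expRD ler_expR.
rewrite -(rV_unconsK y) !rV_consB !enorm_cons/=; set b := y ord0 ord0 in ya *.
set w := enorm _.
have e1 : (r * s - b) ^+ 2 = (s - r * b) ^+ 2.
  rewrite -[LHS]mul1r -{1}r1 -exprMn; congr (_ ^+ 2).
  by rewrite mulrBr mulrA -expr2 r1 mul1r.
have e2 : (r * a - b) ^+ 2 = (a - r * b) ^+ 2.
  rewrite -[LHS]mul1r -{1}r1 -exprMn; congr (_ ^+ 2).
  by rewrite mulrBr mulrA -expr2 r1 mul1r.
rewrite e1 e2; move: (r * b) ya => b' ya {e1 e2 r1}.
rewrite -subr_ge0.
(* Completing the square; the cross term (s - a) (a - b') is nonnegative because y lies behind the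
   point of parameter a. *)
have -> : 1 / 2 + - (s - a) / sg + - ((a - b') ^+ 2 + w ^+ 2) / (2 * sg ^+ 2) -
    - ((s - b') ^+ 2 + w ^+ 2) / (2 * sg ^+ 2) =
    ((s - a - sg) ^+ 2 + 2 * (s - a) * (a - b')) / (2 * sg ^+ 2).
  by field; rewrite gt_eqF.
rewrite divr_ge0//; last by rewrite mulr_ge0// sqr_ge0.
by rewrite addr_ge0 ?sqr_ge0// mulr_ge0 ?subr_ge0// mulr_ge0// subr_ge0.
Qed.

Section exit_bound.
Context {R : realType} {n : nat}.
Variable O : domain R n.+1.
Local Notation V := 'rV[R]_n.+1.
Local Notation nu := (lebesgue_on O).
Local Notation L := (lebesgue_rV R n.+1).
Local Notation lam := (@lebesgue_measure R).
Local Notation bf := (boundary_factor O).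

Lemma heat_bound_ray (c t s a r : R) (f : V -> R) (v : 'rV[R]_n) :
  0 < c -> 0 < t -> r ^+ 2 = 1 -> measurable_fun setT f ->
  (forall y, f y != 0 -> r * y ord0 ord0 <= a) -> a <= s ->
  (heat_bound O c t f (rV_cons ((r * s)%R, v)) <=
   (expR (1 / 2) * expR (- (s - a) / Num.sqrt (c * t)))%:E *
     heat_bound O c t f (rV_cons ((r * a)%R, v)))%E.
Proof.
move=> c0 t0 r1 mf fa as_; apply: ge0_le_integralZ => //.
- exact: measurable_heat_section.
- exact: measurable_heat_section.
- by move=> y; exact: heat_integrand_ge0.
- by move=> y; exact: heat_integrand_ge0.
apply: aeW => y.
rewrite [leRHS]mulrA; have [fy|fy] := eqVneq (f y) 0.
  have e0 k : k * `|f y| = 0 by rewrite fy normr0 mulr0.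
  by rewrite [leLHS]e0 [leRHS]e0.
rewrite ler_wpM2r// [leRHS]mulrCA.
rewrite ler_wpM2l ?boundary_factor_ge0//; apply: gaussian_ray => //.
exact: fa.
Qed.

Variables (c t B r a : R) (F f : V -> R).
Hypotheses (c0 : 0 < c) (t0 : 0 < t) (B0 : 0 <= B) (r1 : r ^+ 2 = 1).
Hypothesis mf : measurable_fun setT f.
Hypothesis fa : forall y, f y != 0 -> r * y ord0 ord0 <= a.
Hypothesis hf : forall x, (heat_bound O c t f x < +oo)%E.
Hypothesis F0 : forall x, ~ O x -> F x = 0.
Hypothesis dF : forall x, O x -> differentiable F x /\
  (`|partial ord0 F x|%:E <= B%:E * heat_bound O c t f x)%E.
Hypothesis lF : {ae lebesgue_rV R n, forall v,
  continuous (fun s => F (rV_cons (s, v))) /\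
  (\int[lam]_s (F (rV_cons (s, v)) ^+ 2)%:E < +oo)%E}.

Let H x := fine (heat_bound O c t f x).

Let HE x : heat_bound O c t f x = (H x)%:E.
Proof. by rewrite fineK// ge0_fin_numE// heat_bound_ge0. Qed.

Let H0 x : 0 <= H x. Proof. by rewrite -lee_fin -HE heat_bound_ge0. Qed.

Lemma exit_bound_ae : {ae L, forall x, O x -> a <= r * x ord0 ord0 ->
  (`|F x|%:E <= (B * expR (1 / 2) * Num.sqrt (c * t))%:E * heat_bound O c t f x)%E}.
Proof.
have := ae_rV_cons lF; apply: filterS => x [cF iF] Ox ax.
set v := (rV_uncons x).2 in cF iF; set s0 := r * x ord0 ord0 in ax *.
have xE : x = rV_cons (r * s0, v).
  by rewrite /s0 mulrA -expr2 r1 mul1r -[LHS]rV_unconsK.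
set sg := Num.sqrt (c * t); have sg0 : 0 < sg by rewrite sqrtr_gt0 mulr_gt0.
pose h s := F (rV_cons (r * s, v)).
have cr : continuous (fun s : R => r * s).
  by move=> s; apply: cvgM; [exact: cvg_cst|exact: cvg_id].
have ch : continuous h.
  move=> s; apply: (@continuous_comp _ _ _ ( *%R r) (fun s => F (rV_cons (s, v)))).
    exact: cr.
  exact: cF.
pose W : set R := [set s | O (rV_cons (r * s, v))].
have oW : open W.
  apply: (@open_comp _ _ (fun s => rV_cons (r * s, v)) O); last exact: domain_open.
  move=> s _; apply: (@continuous_comp _ _ _ ( *%R r) (fun s => rV_cons (s, v))).
    exact: cr.
  exact: continuous_rV_cons.
have hW s : ~ W s -> h s = 0 by move=> nW; exact: F0.
have Ws0 : W s0 by rewrite /W/= -xE.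
(* By [heat_bound_ray] the derivative of h at s is at most B' exp(-(s - s0) / sg), so that the whole
   way to the exit costs at most B' sg. *)
pose B' := B * (expR (1 / 2) * H x).
have B'0 : 0 <= B' by rewrite mulr_ge0// mulr_ge0// expR_ge0.
have hd s : s0 <= s -> W s ->
    derivable h s 1 /\ `|'D_1 h s| <= B' * expR (- (s - s0) / sg).
  move=> ss Ws; have [d1 d2] := dF Ws.
  have hder := is_derive_ray d1; split; first exact: ex_derive.
  rewrite (@derive_val _ _ _ _ _ _ _ hder) normrM.
  have -> : `|r| = 1 by apply/eqP; rewrite -sqrp_eq1// -normrX r1 normr1.
  rewrite mul1r -lee_fin (le_trans d2)//.
  have := @heat_bound_ray c t s s0 r f v c0 t0 r1 mf _ ss.
  rewrite -xE !HE -!EFinM !lee_fin => hb.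
  rewrite /B' -!mulrA ler_wpM2l// mulrA (le_trans (hb _))//.
    by move=> y fy; rewrite (le_trans (fa fy)).
  by rewrite mulrAC.
have Fx : F x = h s0 by rewrite /h -xE.
rewrite HE -EFinM lee_fin Fx; apply/ler_addgt0Pr => e e0.
have mFv : measurable_fun setT (fun s => F (rV_cons (s, v))).
  exact: continuous_measurable_fun.
have [T sT FT] := square_integrable_small_ray s0 r1 mFv iF e0.
apply: (le_trans (line_exit oW ch hW Ws0 sT sg0 B'0 hd)).
rewrite addrC lerD ?(ltW FT)//.
by rewrite /B' -/sg -!mulrA (mulrC sg).
Qed.

(** If the bound failed at x, continuity of F would make it fail near x, in particular at a point
    where [exit_bound_ae] holds; [heat_bound_near] contradicts this. The strict inequality keeps the
    nearby points out of the half-space carrying f. *)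
Lemma exit_bound x : O x -> a < r * x ord0 ord0 ->
  (heat_bound O (2 * c) t f x < +oo)%E ->
  (`|F x|%:E <= (B * expR (1 / 2) * Num.sqrt (c * t) * shift_const n.+1 c)%:E *
     heat_bound O (2 * c) t f x)%E.
Proof.
move=> Ox ax hfx; set k := B * _ * _.
have k0 : 0 <= k by rewrite !mulr_ge0 ?expR_ge0 ?sqrtr_ge0.
have hE : heat_bound O (2 * c) t f x = (fine (heat_bound O (2 * c) t f x))%:E.
  by rewrite fineK// ge0_fin_numE// heat_bound_ge0.
rewrite leNgt; apply/negP => h.
have [r' r'0 rP] := domain_ball t0 Ox.
have h1 : \forall z \near x, a < r * (z : V) ord0 ord0.
  have cc : continuous (fun z : V => r * z ord0 ord0).
    move=> z; apply: (@continuous_comp _ _ _ (fun z : V => z ord0 ord0) ( *%R r)).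
      exact: coord_continuous.
    by apply: cvgM; [exact: cvg_cst|exact: cvg_id].
  by have := cc x; move=> /cvgr_gt/(_ _ ax).
have h2 : \forall z \near x,
    k * shift_const n.+1 c * fine (heat_bound O (2 * c) t f x) < `|F z|.
  have cc : {for x, continuous (fun z => `|F z|)}.
    apply: continuous_comp; last exact: norm_continuous.
    by apply: differentiable_continuous; have [] := dF Ox.
  by move: h; rewrite hE -EFinM lte_fin => h; move: cc => /cvgr_gt/(_ _ h).
have h3 : nbhs x (ball x r') by exact: nbhsx_ballx.
have [z [[za [zF zb]] Oz bz]] :=
  ae_open_point ((lebesgue_on_ae _ _).2 exit_bound_ae) Ox (filterI h1 (filterI h2 h3)).
have [_ zx] := rP _ zb.
have := bz (ltW za).
have hn := heat_bound_near O c0 t0 mf zx.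
move=> /le_trans/(_ (lee_wpmul2l _ hn)); rewrite lee_fin => /(_ k0).
rewrite hE -!EFinM lee_fin mulrA => /(lt_le_trans zF).
by rewrite ltxx.
Qed.

End exit_bound.

(** * Compact exhaustion of the domain *)

Section core.
Context {R : realType} {n : nat}.
Variable O : domain R n.
Local Notation nu := (lebesgue_on O).

Definition core (k : nat) : set 'rV[R]_n :=
  [set y | [/\ O y, k.+1%:R^-1 <= boundary_dist O y & `|y| <= k.+1%:R]].

Lemma core_closed k : closed (core k).
Proof.
(* Taking the closure adds nothing: a point of the closure outside [O] belongs to the boundary,
   where the distance is 0. *)
have -> : core k = closure O `&` (boundary_dist O @^-1` [set s | k.+1%:R^-1 <= s] `&`
    (fun y : 'rV[R]_n => `|y|) @^-1` [set s | s <= k.+1%:R]).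
  apply/seteqP; split => y.
    by move=> [Oy h1 h2]; split => //; exact: subset_closure.
  move=> [cy [/= h1 h2]]; split => //; apply: contrapT => nOy.
  suff : boundary_dist O y <= 0 by apply/negP; rewrite -ltNge (lt_le_trans _ h1).
  apply: ge_inf; first by exists 0 => _ [z _ <-]; exact: enorm_ge0.
  exists y; last by rewrite subrr enorm0.
  split => //; have := domain_open O; rewrite openE => h /interior_subset.
  exact: nOy.
apply: closedI; first exact: closed_closure.
apply: closedI; apply: closed_comp.
- by move=> y _; exact: continuous_boundary_dist.
- exact: closed_ge.
- by move=> y _; exact: norm_continuous.
- exact: closed_le.
Qed.

Lemma measurable_core k : measurable (core k).
Proof.
rewrite -(setCK (core k)); apply: measurableC.
by apply: open_measurable_rV; rewrite openC; exact: core_closed.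
Qed.

Lemma compact_core k : compact (core k).
Proof.
apply: bounded_closed_compact; last exact: core_closed.
exists k.+1%:R; split; first exact: num_real.
by move=> M kM y [_ _ yk] /=; rewrite (le_trans yk)// ltW.
Qed.

Lemma core_sub k : core k `<=` O.
Proof. by move=> y []. Qed.

Lemma core_near y : O y -> \forall k \near \oo, core k y.
Proof.
move=> Oy; have d0 := domain_dist_gt0 Oy.
near=> k; split => //.
  apply: ltW; near: k.
  exact: (near_infty_natSinv_lt (PosNum d0)).
apply: (@le_trans _ _ k%:R); last by rewrite ler_nat.
near: k; exact: nbhs_infty_ger.
Unshelve. all: by end_near. Qed.

Lemma heat_bound_bounded (c t M : R) (f : 'rV[R]_n -> R) x : 0 < c -> 0 < t ->
  measurable_fun setT f -> (forall y, `|f y| <= M) ->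
  (heat_bound O c t f x <= M%:E)%E.
Proof.
move=> c0 t0 mf fM; have M0 : 0 <= M by exact: le_trans (fM 0).
have ct0 : 0 < c * t by rewrite mulr_gt0.
apply: (@le_trans _ _ (M%:E * \int[nu]_y (gaussian (c * t) (x - y))%:E)%E); last first.
  by rewrite -[leRHS]mule1 lee_wpmul2l// integral_gaussian_on.
apply: ge0_le_integralZ => //.
- exact: measurable_heat_section.
- exact: measurable_gaussian_subr.
- by move=> y; exact: heat_integrand_ge0.
- by move=> y; exact: gaussian_ge0.
apply: aeW => y; rewrite [leRHS]mulrC ler_pM//.
  by rewrite mulr_ge0 ?gaussian_ge0 ?boundary_factor_ge0.
by rewrite ler_piMl ?gaussian_ge0 ?boundary_factor_le1.
Qed.

End core.

Section kernel_bound.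
Context {R : realType} {n : nat}.
Variable O : domain R n.+1.
Local Notation V := 'rV[R]_n.+1.
Local Notation nu := (lebesgue_on O).
Local Notation L := (lebesgue_rV R n.+1).
Local Notation bf := (boundary_factor O).
Variables (c t B : R) (K : V -> V -> R).
Hypotheses (c0 : 0 < c) (t0 : 0 < t) (B0 : 0 <= B).
Hypothesis mK : measurable_fun setT (fun xy : V * V => K xy.1 xy.2).
Hypothesis K0 : forall x y, ~ O x -> K x y = 0.
Hypothesis dK : forall x y, O x -> differentiable (K ^~ y) x.
Hypothesis gK : forall x y i, O x ->
  `|partial i (K ^~ y) x| <= B * (bf t y * gaussian (c * t) (x - y)).
Hypothesis hK : forall (f : V -> R) k, measurable_fun setT f ->
  (forall y, `|f y| <= 1) -> (forall y, ~ core O k y -> f y = 0) ->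
  exists (u : L2 O) (g : 'I_n.+1 -> L2 O), H10 u g /\
    {ae nu, forall x, nu.-integrable setT (EFin \o (fun y => K x y * f y)) /\
       u x = (\int[nu]_y (K x y * f y))%R}.

(** The gradient bound B is to be of order 1 / sqrt t, while the Gaussian decays along a ray over
    the length sqrt (c t): the product does not depend on t. The factor exp(1/2) comes from
    [gaussian_ray], and [shift_const] from the passage to every x. *)
Definition exit_const : R :=
  B * expR (1 / 2) * Num.sqrt (c * t) * shift_const n.+1 c.

Let Q x y := exit_const * (bf t y * gaussian (2 * c * t) (x - y)).

Let Q0 x y : 0 <= Q x y.
Proof.
rewrite /Q /exit_const mulr_ge0//; last by rewrite mulr_ge0 ?boundary_factor_ge0 ?gaussian_ge0.
by rewrite !mulr_ge0 ?expR_ge0 ?sqrtr_ge0// ltW// shift_const_gt0.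
Qed.

Lemma kernel_exit_bound (f : V -> R) k r a x : r ^+ 2 = 1 -> measurable_fun setT f ->
  (forall y, `|f y| <= 1) -> (forall y, ~ core O k y -> f y = 0) ->
  (forall y, f y != 0 -> r * y ord0 ord0 <= a) -> O x -> a < r * x ord0 ord0 ->
  nu.-integrable setT (EFin \o (fun y => K x y * f y)) /\
  (`|(\int[nu]_y (K x y * f y))%R|%:E <= exit_const%:E * heat_bound O (2 * c) t f x)%E.
Proof.
move=> r1 mf f1 fk fa Ox ax.
have [u [g [ug uK]]] := hK mf f1 fk.
have hf c' z : 0 < c' -> (heat_bound O c' t f z < +oo)%E.
  by move=> c'0; rewrite (le_lt_trans (heat_bound_bounded _ _ c'0 t0 mf f1))// ltry.
have iK z : O z -> nu.-integrable setT (EFin \o (fun y => K z y * f y)).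
  move=> Oz; apply: (integrable_kernel c0 t0 B0 mK dK gK mf) => //.
    by move=> w _; apply: hf; rewrite mulr_gt0.
  by apply: filterS uK => w [].
split; first exact: iK.
pose F z := (\int[nu]_y (K z y * f y))%R.
have mF : measurable_fun setT F.
  apply: measurable_Rintegral_param.
  by apply: measurable_funM => //; exact: (measurableT_comp mf measurable_snd).
have F0 z : ~ O z -> F z = 0.
  move=> nOz; rewrite /F /Rintegral (eq_integral (cst 0%E)) ?integral0// => y _.
  by rewrite K0// mul0r.
have dF z : O z -> differentiable F z /\
    (`|partial ord0 F z|%:E <= B%:E * heat_bound O c t f z)%E.
  move=> Oz; have [|d1 d2] := differentiable_kernel c0 t0 B0 dK gK mf _ iK Oz.
  - by apply: hf; rewrite mulr_gt0.
  - by split.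
have uF : (u : _ -> _) = F %[ae nu].
  by apply: filterS uK => z [_ ->].
have lF := ae_line_continuous ug mF F0
  (fun z Oz => differentiable_continuous (proj1 (dF z Oz))) uF.
have hf1 z : (heat_bound O c t f z < +oo)%E by exact: hf.
have hf2 : (heat_bound O (2 * c) t f x < +oo)%E by apply: hf; rewrite mulr_gt0.
exact: (exit_bound c0 t0 B0 r1 mf fa hf1 F0 dF lF Ox ax hf2).
Qed.

(* The half-space bound is applied to f = sgn (K x _) on the part of a half-space where
   the claimed inequality fails; the choice of f depends on x, which is why the bound
   on F is needed at every x and not just almost everywhere. *)
Lemma kernel_bound_core x r k : O x -> r ^+ 2 = 1 ->
  {ae nu, forall y, core O k y ->
     r * y ord0 ord0 <= r * x ord0 ord0 - k.+1%:R^-1 -> `|K x y| <= Q x y}.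
Proof.
move=> Ox r1.
have mKx : measurable_fun setT (K x) by exact: (measurableT_comp mK (pair1_measurable x)).
have mQ : measurable_fun setT (Q x).
  apply: measurable_funM; first exact: measurable_cst.
  apply: measurable_funM; first exact: measurable_boundary_factor.
  exact: measurable_gaussian_subr.
(* The margin 1 / (k + 1) separates x strictly from the half-space, as [exit_bound] requires; it
   disappears when k grows in [kernel_bound]. *)
pose a := r * x ord0 ord0 - k.+1%:R^-1.
pose A : set V := core O k `&` [set y : V | r * y ord0 ord0 <= a /\ Q x y < `|K x y|].
have mA : measurable A.
  apply: measurableI; first exact: measurable_core.
  have -> : [set y : V | r * y ord0 ord0 <= a /\ Q x y < `|K x y|] =
     [set y : V | r * y ord0 ord0 <= a] `&` [set y | Q x y < `|K x y|] by [].
  apply: measurableI.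
    rewrite -[X in measurable X]setTI.
    apply: (measurable_fun_le (D := setT)) => //.
    apply: measurable_funM; first exact: measurable_cst.
    by apply: continuous_measurable_rV; exact: coord_continuous.
  rewrite -[X in measurable X]setTI.
  have mlt : measurable_fun setT (fun y => Q x y < `|K x y|).
    by apply: measurable_fun_ltr => //; exact: measurableT_comp.
  exact: (mlt measurableT [set true]).
pose f y : R := if 0 < K x y then \1_A y else - \1_A y.
have mI : measurable_fun setT (\1_A : V -> R) by exact: measurable_indic.
have mf : measurable_fun setT f.
  apply: measurable_fun_ifT => //.
    by apply: measurable_fun_ltr => //; exact: measurable_cst.
  exact: measurable_funN.
have fE y : `|f y| = \1_A y.
  by rewrite /f; case: ifP => _; rewrite ?normrN indicE ger0_norm.
have KfE y : K x y * f y = `|K x y| * \1_A y.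
  rewrite /f; case: ltP => h; first by rewrite gtr0_norm.
  by rewrite ler0_norm// mulrN mulNr.
have f1 y : `|f y| <= 1 by rewrite fE indicE lern1 leq_b1.
have fA y : f y != 0 -> A y.
  rewrite -normr_eq0 fE indicE; have [yA _|] := boolP (y \in A); last by rewrite eqxx.
  by rewrite inE in yA.
have fk y : ~ core O k y -> f y = 0.
  by move=> nk; apply/eqP; apply: contrapT => /negP/fA[].
have fa y : f y != 0 -> r * y ord0 ord0 <= a by move=> /fA[_ []].
have ax : a < r * x ord0 ord0 by rewrite /a ltrBlDr ltrDl.
have [ifx bfx] := kernel_exit_bound r1 mf f1 fk fa Ox ax.
(* D is nonnegative by the choice of A, while its integral is at most 0 by the half-space bound; D
   is positive on A, which is therefore a null set. *)
pose D y := (`|K x y| - Q x y) * \1_A y.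
have iQ : nu.-integrable setT (EFin \o (fun y => Q x y * \1_A y)).
  have -> : EFin \o (fun y => Q x y * \1_A y) = (fun y => exit_const%:E *
     (bf t y * gaussian (2 * c * t) (x - y) * `|f y|)%:E)%E.
    by apply/funext => y; rewrite /= /Q fE -EFinM -(mulrA exit_const).
  apply: integrableZl => //; apply: integrable_heat => //.
  apply: (le_lt_trans (heat_bound_bounded _ _ _ t0 mf f1)); last by rewrite ltry.
  by rewrite mulr_gt0.
have QE : (\int[nu]_y (Q x y * \1_A y)%:E = exit_const%:E * heat_bound O (2 * c) t f x)%E.
  rewrite /heat_bound -integralZl//.
    by apply: eq_integral => y _; rewrite /Q fE -EFinM -(mulrA exit_const).
  apply: integrable_heat => //.
  apply: (le_lt_trans (heat_bound_bounded _ _ _ t0 mf f1)); last by rewrite ltry.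
  by rewrite mulr_gt0.
have iK : nu.-integrable setT (EFin \o (fun y => `|K x y| * \1_A y)).
  by apply: eq_integrable ifx => // y _ /=; rewrite KfE.
have KE : (\int[nu]_y (`|K x y| * \1_A y)%:E = (\int[nu]_y (K x y * f y))%R%:E)%E.
  rewrite /Rintegral fineK; last exact: integrable_fin_num.
  by apply: eq_integral => y _; rewrite KfE.
have D0 y : 0 <= D y.
  rewrite /D indicE; have [yA|] := boolP (y \in A); last by rewrite mulr0.
  by rewrite mulr1 subr_ge0; move: yA; rewrite inE => -[_ [_ /ltW]].
have mD : measurable_fun setT (EFin \o D).
  apply/measurable_EFinP; apply: measurable_funM => //.
  by apply: measurable_funB => //; exact: measurableT_comp.
have iD : (\int[nu]_y (D y)%:E <= 0)%E.
  have -> : (\int[nu]_y (D y)%:E =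
      \int[nu]_y (`|K x y| * \1_A y)%:E - \int[nu]_y (Q x y * \1_A y)%:E)%E.
    rewrite -integralB_EFin//; apply: eq_integral => y _.
    by rewrite /D mulrBl.
  rewrite sube_le0 KE QE.
  by apply: le_trans bfx; rewrite lee_fin ler_norm.
have : {ae nu, forall y, D y = 0}.
  have : (\int[nu]_y `|(EFin \o D) y| = 0)%E.
    apply/eqP; rewrite eq_le integral_ge0// andbT; apply: le_trans iD.
    rewrite le_eqVlt; apply/orP; left; apply/eqP; apply: eq_integral => y _ /=.
    by rewrite ger0_norm.
  move/(ae_eq_integral_abs nu measurableT mD).
  by apply: filterS => y /(_ I) [].
apply: filterS => y Dy ky ya; rewrite leNgt; apply/negP => yQ.
have yA : A y by split.
move: Dy; rewrite /D indicE mem_set// mulr1 => /eqP; rewrite subr_eq0 => /eqP h.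
by move: yQ; rewrite h ltxx.
Qed.

(** Off a null hyperplane, y lies strictly on one side of x in the first coordinate, which selects r
    = 1 or r = -1. For k large, y is in [core O k] and the margin 1 / (k + 1) is below the gap;
    countably many exceptional sets are discarded. *)
Lemma kernel_bound x : O x -> {ae nu, forall y, `|K x y| <= Q x y}.
Proof.
move=> Ox.
have h1 : {ae nu, forall y, forall k, core O k y ->
     1 * y ord0 ord0 <= 1 * x ord0 ord0 - k.+1%:R^-1 -> `|K x y| <= Q x y}.
  by apply/ae_foralln => k; apply: kernel_bound_core => //; rewrite expr1n.
have h2 : {ae nu, forall y, forall k, core O k y ->
     -1 * y ord0 ord0 <= -1 * x ord0 ord0 - k.+1%:R^-1 -> `|K x y| <= Q x y}.
  by apply/ae_foralln => k; apply: kernel_bound_core => //; rewrite sqrrN expr1n.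
have h3 : {ae nu, forall y : V, y ord0 ord0 <> x ord0 ord0}.
  apply/lebesgue_on_ae; exists [set y : V | y ord0 ord0 = x ord0 ord0].
  split; [|exact: lebesgue_rV_hyperplane|].
    have -> : [set y : V | y ord0 ord0 = x ord0 ord0] =
       setT `&` ((fun y : V => y ord0 ord0) @^-1` [set x ord0 ord0]) by rewrite setTI.
    by apply: continuous_measurable_rV => //; exact: coord_continuous.
  by move=> y /= h; apply: contrapT => h'; apply: h => _.
have h4 := ae_in_domain O.
apply: filterS (filterI (filterI h1 h2) (filterI h3 h4)) => y [[{}h1 {}h2] [{}h3 Oy]].
have [d d0 hd] : exists2 d : R, 0 < d & d = `|y ord0 ord0 - x ord0 ord0|.
  by exists `|y ord0 ord0 - x ord0 ord0| => //; rewrite normr_gt0 subr_eq0; apply/eqP.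
have H : \forall k \near \oo, core O k y /\ k.+1%:R^-1 < d.
  by apply: filterI; [exact: core_near|exact: (near_infty_natSinv_lt (PosNum d0))].
have [N _ /(_ N (leqnn N))[ck kd]] := H.
move: kd; rewrite hd ltr_normr => /orP[kd|kd].
  by apply: (h2 N) => //; rewrite !mulN1r lerBrDr -lerBrDl opprK addrC ltW.
by apply: (h1 N) => //; rewrite !mul1r lerBrDr -lerBrDl -[x _ _ - _]opprB ltW.
Qed.

End kernel_bound.

(** * Operators on weighted spaces *)

Section Lp_theory.
Context d (T : measurableType d) (R : realType).
Variables (m : {measure set T -> \bar R}) (p : R) (p1 : (1 <= p%:E)%E).
Local Notation Lp := (LfunType m p1).
Local Notation "'N' [ f ]" := ('N[m]_p%:E[EFin \o f%R])%E (at level 0).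

Let p1' : 1 <= p. Proof. by rewrite -lee_fin. Qed.
Let p0 : 0 < p. Proof. exact: lt_le_trans p1'. Qed.
Let pn0 : p != 0. Proof. by rewrite gt_eqF. Qed.

Lemma Lnorm_powE (f : T -> R) :
  (N[f] `^ p = \int[m]_x (`|f x| `^ p)%:E)%E.
Proof. by rewrite powR_Lnorm//; apply: eq_integral => x _. Qed.

Lemma Lnorm_le_pow (f g : T -> R) (k : R) : 0 <= k ->
  (\int[m]_x (`|f x| `^ p)%:E <= (k `^ p)%:E * \int[m]_x (`|g x| `^ p)%:E)%E ->
  (N[f] <= k%:E * N[g])%E.
Proof.
move=> k0 h; have pi0 : (0 <= p^-1)%R by rewrite invr_ge0 ltW.
have in0y (z : \bar R) : (0 <= z)%E -> z \in `[0%E, +oo%E].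
  by move=> z0; rewrite in_itv/= z0 leey.
have J (u : T -> R) : (0 <= \int[m]_x (`|u x| `^ p)%:E)%E.
  by apply: integral_ge0 => x _; rewrite lee_fin powR_ge0.
have := @gt0_ler_poweR _ p^-1 pi0 _ _ (in0y _ (J f))
  (in0y _ (mule_ge0 _ (J g))) h.
rewrite lee_fin powR_ge0 => /(_ isT).
rewrite poweRM ?lee_fin ?powR_ge0 ?J// -!Lnorm_powE.
by rewrite -!poweRrM !mulfV// !poweRe1 ?Lnorm_ge0// poweR_EFin -powRrM mulfV// powRr1.
Qed.

Lemma Lnorm_le_real (f : T -> R) (e : R) : 0 <= e ->
  (\int[m]_x (`|f x| `^ p)%:E <= (e `^ p)%:E)%E -> (N[f] <= e%:E)%E.
Proof.
move=> e0; rewrite -Lnorm_powE -poweR_EFin => h.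
have pi0 : (0 <= p^-1)%R by rewrite invr_ge0 ltW.
have in0y (z : \bar R) : (0 <= z)%E -> z \in `[0%E, +oo%E].
  by move=> z0; rewrite in_itv/= z0 leey.
have := @gt0_ler_poweR _ p^-1 pi0 _ _ (in0y _ (poweR_ge0 _ _)) (in0y _ (poweR_ge0 _ _)) h.
by rewrite -!poweRrM !mulfV// !poweRe1 ?Lnorm_ge0// lee_fin.
Qed.

Lemma Lfun_pow (f : T -> R) : measurable_fun setT f ->
  (\int[m]_x (`|f x| `^ p)%:E < +oo)%E -> f \in Lfun m p%:E.
Proof.
move=> mf h; rewrite inE; apply/andP; split; first by rewrite inE.
rewrite inE /= /finite_norm; apply: (@lty_poweRy _ _ p) => //.
by rewrite Lnorm_powE.
Qed.

Lemma Lfun_pow_lty (f : Lp) : (\int[m]_x (`|f x| `^ p)%:E < +oo)%E.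
Proof. by rewrite -Lnorm_powE poweR_lty//; exact: Lfunction_finite. Qed.

(* The value is 0 on functions that are not in L^p. *)
Definition to_Lfun (f : T -> R) : Lp :=
  if pselect (f \in Lfun m p%:E) is left h then Lfun_Sub p1 h else 0.

Lemma to_LfunE f : f \in Lfun m p%:E -> to_Lfun f = f :> (T -> R).
Proof. by rewrite /to_Lfun; case: pselect. Qed.

Lemma Lnorm_ae (f g : T -> R) : measurable_fun setT f -> measurable_fun setT g ->
  f = g %[ae m] -> N[f] = N[g].
Proof.
move=> mf mg fg; rewrite unlock; apply: (congr1 (fun z => z `^ p^-1)%E).
have mpow (h : T -> R) : measurable_fun setT h ->
    measurable_fun setT (fun x : T => (`|h x| `^ p)%:E).
  move=> mh; apply/measurable_EFinP.
  by apply: (measurableT_comp (measurable_powR p)); exact: measurableT_comp.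
apply: ae_eq_integral => //; [exact: mpow|exact: mpow|].
by apply: filterS fg => x h _ /=; rewrite h.
Qed.

Lemma Lnorm_eq0 (f : T -> R) : measurable_fun setT f -> N[f] = 0%E -> f = (cst 0) %[ae m].
Proof.
move=> mf h; have mEf : measurable_fun setT (EFin \o f) by exact/measurable_EFinP.
have := Lnorm_eq0_eq0 (p := p%:E) mEf.
move=> /(_ m); rewrite lte_fin => /(_ p0 h).
by apply: filterS => x + _ => /(_ I) [].
Qed.

Implicit Types (A B : Lp -> Lp) (f g : Lp).

Lemma bounded_linear_sub A f g : bounded_linear A ->
  A (f - g) = A f - A g %[ae m].
Proof.
move=> [lA _]; have := lA (-1) g f; apply: filterS => x h _.
have -> : f - g = -1 *: g + f by rewrite scaleN1r addrC.
transitivity (-1 * A g x + A f x); first exact: h.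
by rewrite mulN1r addrC.
Qed.

(** Operators act on functions rather than classes, and linearity holds only almost everywhere.
    Compatibility with almost everywhere equality comes from boundedness, applied to f - g of norm
    0. *)
Lemma bounded_linear_ae A f g : bounded_linear A ->
  (f : T -> R) = g %[ae m] -> (A f : T -> R) = A g %[ae m].
Proof.
move=> bA fg; have [lA [K hK]] := bA.
have fg0 : N[(f - g : Lp)] = 0%E.
  have -> : N[(f - g : Lp)] = N[cst 0].
    apply: Lnorm_ae => //; apply: filterS fg => x h _.
    by transitivity (f x - g x); rewrite // h// subrr.
  exact: Lnorm0.
have Afg0 : N[A (f - g)] = 0%E.
  by apply/eqP; rewrite eq_le Lnorm_ge0 andbT (le_trans (hK _))// fg0 mule0.
have := Lnorm_eq0 _ Afg0 => /(_ (@measurable_funPT _ _ _ _ _)) H.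
have H' := bounded_linear_sub f g bA.
apply: filterS2 H H' => x h1 h2 _; have := h2 I; rewrite (h1 I)/= => /esym/eqP.
by rewrite subr_eq0 => /eqP.
Qed.

Lemma bounded_linear_id : bounded_linear (@id Lp).
Proof. by split; [move=> k f g; exact: aeW|exists 1 => f; rewrite mul1e]. Qed.

Lemma bounded_linear_comp A B : bounded_linear A -> bounded_linear B ->
  bounded_linear (A \o B).
Proof.
move=> bA bB; have [lA [K hK]] := bA; have [lB [K' hK']] := bB; split.
  move=> k f g.
  have h1 : (A (B (k *: f + g)) : T -> R) = A (k *: B f + B g) %[ae m].
    by apply: bounded_linear_ae => //; exact: lB.
  by apply: filterS2 h1 (lA k (B f) (B g)) => x h1 h2 _; rewrite h1// h2.
exists (`|K| * `|K'|) => f /=; apply: (le_trans (hK _)).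
apply: (@le_trans _ _ (`|K|%:E * N[B f])%E).
  by rewrite lee_wpmul2r ?Lnorm_ge0// lee_fin ler_norm.
rewrite EFinM -muleA lee_wpmul2l ?lee_fin//.
apply: (le_trans (hK' _)); rewrite lee_wpmul2r ?Lnorm_ge0// lee_fin.
exact: ler_norm.
Qed.

Lemma bounded_linear_iter A k : bounded_linear A -> bounded_linear (iter k A).
Proof.
move=> bA; elim: k => [|k IH]; first exact: bounded_linear_id.
exact: (bounded_linear_comp bA IH).
Qed.

Lemma LnormD_le (f g : T -> R) : measurable_fun setT f -> measurable_fun setT g ->
  (N[fun x => f x + g x] <= N[f] + N[g])%E.
Proof. by move=> mf mg; exact: minkowski_EFin. Qed.

Lemma bounded_linear_dense_eq (P : Lp -> Prop) A B :
  (forall f (e : R), 0 < e -> exists2 g, P g & (N[(f - g : Lp)] <= e%:E)%E) ->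
  bounded_linear A -> bounded_linear B ->
  (forall g, P g -> (A g : T -> R) = B g %[ae m]) ->
  forall f, (A f : T -> R) = B f %[ae m].
Proof.
move=> dP bA bB AB f; have [lA [K hK]] := bA; have [lB [K' hK']] := bB.
have AfBf0 : N[(A f - B f : Lp)] = 0%E.
  apply/eqP; rewrite eq_le Lnorm_ge0 andbT; apply/lee_addgt0Pr => e e0.
  (* The sign of [K] and [K'] is unknown, hence the absolute values; the additional 1 prevents a
     division by zero. *)
  rewrite add0e; pose e' := e / (`|K| + `|K'| + 1).
  have k0 : 0 < `|K| + `|K'| + 1 by rewrite ltr_wpDl// addr_ge0.
  have [g Pg gf] := dP f e' (divr_gt0 e0 k0).
  have -> : N[(A f - B f : Lp)] = N[fun x => A (f - g) x + (- B (f - g)) x].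
    apply: Lnorm_ae => //; first exact: measurable_funD.
    have h1 := bounded_linear_sub f g bA; have h2 := bounded_linear_sub f g bB.
    apply: filterS (filterI (filterI h1 h2) (AB g Pg)) => x [[{}h1 {}h2] h3] _ /=.
    transitivity (A (f - g) x - B (f - g) x); last by [].
    rewrite h1// h2//; transitivity (A f x - B f x); first by [].
    transitivity (A f x - A g x - (B f x - B g x)); last by [].
    by rewrite h3// opprB addrA subrK.
  apply: (le_trans (LnormD_le _ _)) => //.
  have -> : N[- B (f - g)] = N[B (f - g)] by rewrite -[RHS]oppe_Lnorm.
  apply: (@le_trans _ _ (`|K|%:E * e'%:E + `|K'|%:E * e'%:E)%E).
    apply: leeD.
      apply: (le_trans (hK _)).
      apply: (@le_trans _ _ (`|K|%:E * N[(f - g : Lp)])%E).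
        by rewrite lee_wpmul2r ?Lnorm_ge0// lee_fin ler_norm.
      by rewrite lee_wpmul2l.
    apply: (le_trans (hK' _)).
    apply: (@le_trans _ _ (`|K'|%:E * N[(f - g : Lp)])%E).
      by rewrite lee_wpmul2r ?Lnorm_ge0// lee_fin ler_norm.
    by rewrite lee_wpmul2l.
  rewrite -!EFinM -EFinD lee_fin -mulrDl /e' mulrCA ler_piMr ?(ltW e0)//.
  by rewrite ler_pdivrMr// mul1r lerDl.
have := Lnorm_eq0 _ AfBf0 => /(_ (@measurable_funPT _ _ _ _ _)).
by apply: filterS => x h _; apply/eqP; rewrite -subr_eq0; apply/eqP; exact: h.
Qed.

End Lp_theory.

Section restricted_integral.
Context {R : realType} {n : nat}.
Variable O : domain R n.
Local Notation V := 'rV[R]_n.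
Local Notation nu := (lebesgue_on O).
Local Notation L := (lebesgue_rV R n).

Lemma integral_lebesgue_on (h : V -> \bar R) : measurable_fun setT h ->
  (\int[nu]_y h y = \int[L]_(y in O) h y)%E.
Proof.
move=> mh; rewrite integralE [RHS]integralE; congr (_ - _)%E;
  apply: ge0_integral_lebesgue_on => //.
- exact: measurable_funepos.
- exact: measurable_funeneg.
Qed.

Lemma integrable_lebesgue_on (h : V -> R) : measurable_fun setT h ->
  nu.-integrable setT (EFin \o h) <-> L.-integrable O (EFin \o h).
Proof.
move=> mh; have mE : measurable_fun setT (EFin \o h) by exact/measurable_EFinP.
have E : (\int[nu]_y `|(EFin \o h) y| = \int[L]_(y in O) `|(EFin \o h) y|)%E.
  by apply: ge0_integral_lebesgue_on => //; exact: measurableT_comp.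
split=> /integrableP[_ hi]; apply/integrableP; split => //.
- exact: measurable_funTS.
- by rewrite -E.
- by rewrite E.
Qed.

(** The Green kernel is only measurable on the product of [O] with itself. Its extension by zero is
    measurable everywhere, as needed by Tonelli's theorem for [lebesgue_on O] on the whole space. *)
Definition domain_kernel (K : V -> V -> R) (x y : V) : R :=
  ((fun xy : V * V => K xy.1 xy.2) \_ (O `*` O)) (x, y).

Lemma domain_kernel_in K x y : O x -> O y -> domain_kernel K x y = K x y.
Proof. by move=> Ox Oy; rewrite /domain_kernel patchE mem_set. Qed.

Lemma domain_kernel_outl K x y : ~ O x -> domain_kernel K x y = 0.
Proof. by move=> Ox; rewrite /domain_kernel patchE memNset// => -[]. Qed.

Lemma domain_kernel_outr K x y : ~ O y -> domain_kernel K x y = 0.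
Proof. by move=> Ox; rewrite /domain_kernel patchE memNset// => -[]. Qed.

Lemma measurable_domain_kernel K :
  measurable_fun (O `*` O) (fun xy : V * V => K xy.1 xy.2) ->
  measurable_fun setT (fun xy : V * V => domain_kernel K xy.1 xy.2).
Proof.
move=> mK; have mO := measurable_domain O.
have -> : (fun xy : V * V => domain_kernel K xy.1 xy.2) =
    (fun xy : V * V => K xy.1 xy.2) \_ (O `*` O).
  by apply/funext => -[].
by apply/(measurable_restrictT _ _).1 => //; exact: measurableX.
Qed.

Lemma kernel_integralP K f v :
  measurable_fun (O `*` O) (fun xy : V * V => K xy.1 xy.2) ->
  measurable_fun setT f ->
  kernel_integral O K f v <-> {ae nu, forall x,
    nu.-integrable setT (EFin \o (fun y => domain_kernel K x y * f y)) /\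
    v x = (\int[nu]_y (domain_kernel K x y * f y))%R}.
Proof.
move=> mK mf; have mO := measurable_domain O.
have mKf x : measurable_fun setT (fun y => domain_kernel K x y * f y).
  apply: measurable_funM => //.
  exact: (measurableT_comp (measurable_domain_kernel mK) (pair1_measurable x)).
have E x : O x -> (\int[nu]_y (domain_kernel K x y * f y) =
    \int[L]_(y in O) (K x y * f y))%R.
  move=> Ox; rewrite /Rintegral integral_lebesgue_on; last exact/measurable_EFinP.
  by congr fine; apply: eq_integral => y /[!inE] Oy; rewrite domain_kernel_in.
have I x : O x -> nu.-integrable setT (EFin \o (fun y => domain_kernel K x y * f y)) <->
    L.-integrable O (EFin \o (fun y => K x y * f y)).
  move=> Ox; rewrite integrable_lebesgue_on//.
  by split; apply: eq_integrable => // y /[!inE] Oy /=; rewrite domain_kernel_in.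
rewrite /kernel_integral lebesgue_on_ae.
by split; apply: filterS => x h Ox; have [h1 h2] := h Ox; split;
  rewrite ?h2 ?E//; apply/I.
Qed.

End restricted_integral.

Section kernel_operator.
Context {R : realType} {n : nat}.
Variable O : domain R n.
Local Notation V := 'rV[R]_n.
Local Notation nu := (lebesgue_on O).
Local Notation L := (lebesgue_rV R n).
Local Notation bf := (boundary_factor O).
Implicit Types (K : V -> V -> R) (f g : V -> R) (c C t : R).

Definition kernel_op K f x : R := (\int[nu]_y (K x y * f y))%R.

(** The bound is asked for every x but only almost every y, with an exceptional set depending on x:
    testing against functions of y gives no more. *)
Definition heat_kernel c C t K :=
  [/\ measurable_fun setT (fun xy : V * V => K xy.1 xy.2),
      forall x y, ~ O x -> K x y = 0 &
      forall x, O x ->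
        {ae nu, forall y, `|K x y| <= C * (bf t y * gaussian (c * t) (x - y))}].

Lemma kernel_op_out c C t K f x : heat_kernel c C t K -> ~ O x -> kernel_op K f x = 0.
Proof.
move=> [_ K0 _] nOx; rewrite /kernel_op /Rintegral (eq_integral (cst 0%E)).
  by rewrite integral0.
by move=> y _; rewrite K0// mul0r.
Qed.

Lemma measurable_kernelM K f : measurable_fun setT (fun xy : V * V => K xy.1 xy.2) ->
  measurable_fun setT f ->
  measurable_fun setT (fun xy : V * V => K xy.1 xy.2 * f xy.2).
Proof.
move=> mK mf; apply: measurable_funM => //.
exact: (measurableT_comp mf measurable_snd).
Qed.

Lemma measurable_kernelM1 K f x : measurable_fun setT (fun xy : V * V => K xy.1 xy.2) ->
  measurable_fun setT f -> measurable_fun setT (fun y => K x y * f y).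
Proof.
move=> mK mf; exact: (measurableT_comp (measurable_kernelM mK mf) (pair1_measurable x)).
Qed.

Lemma measurable_kernel_op K f :
  measurable_fun setT (fun xy : V * V => K xy.1 xy.2) ->
  measurable_fun setT f -> measurable_fun setT (kernel_op K f).
Proof. by move=> mK mf; apply: measurable_Rintegral_param; exact: measurable_kernelM. Qed.

Lemma kernel_op_ae c C t K f g x : heat_kernel c C t K ->
  measurable_fun setT f -> measurable_fun setT g -> f = g %[ae nu] ->
  kernel_op K f x = kernel_op K g x.
Proof.
move=> [mK _ _] mf mg fg; rewrite /kernel_op /Rintegral; congr fine.
apply: ae_eq_integral => //.
- by apply/measurable_EFinP; exact: measurable_kernelM1.
- by apply/measurable_EFinP; exact: measurable_kernelM1.
- by apply: filterS fg => y h _ /=; rewrite h.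
Qed.

Lemma integrable_kernel_op c C t K f x : heat_kernel c C t K ->
  measurable_fun setT f -> O x -> (heat_bound O c t f x < +oo)%E ->
  nu.-integrable setT (EFin \o (fun y => K x y * f y)).
Proof.
move=> [mK _ bK] mf Ox hf; have ih := integrable_heat mf hf.
have iC : nu.-integrable setT
    (fun y => C%:E * (bf t y * gaussian (c * t) (x - y) * `|f y|)%:E)%E.
  exact: integrableZl.
have mKf := measurable_kernelM1 x mK mf.
apply/integrableP; split; first exact/measurable_EFinP.
have /integrableP[_] := iC; apply: le_lt_trans.
apply: ae_ge0_le_integral => //.
- by apply: measurableT_comp => //; exact/measurable_EFinP.
- by apply: measurableT_comp => //; exact: measurable_int iC.
apply: filterS (bK x Ox) => y h _ /=.
rewrite lee_fin normrM [leRHS]ger0_norm.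
  by rewrite mulrA ler_wpM2r.
have C0 : 0 <= C * (bf t y * gaussian (c * t) (x - y)) by exact: le_trans h.
by rewrite mulrA mulr_ge0.
Qed.

Lemma kernel_op_le c C t K f x : heat_kernel c C t K -> 0 < C ->
  measurable_fun setT f -> O x ->
  (`|kernel_op K f x|%:E <= C%:E * heat_bound O c t f x)%E.
Proof.
move=> hK Cp mf Ox; have [mK _ bK] := hK; have C0 := ltW Cp.
have [hf|hf] := ltP (heat_bound O c t f x) +oo%E; last first.
  move: hf; rewrite leye_eq => /eqP ->.
  by rewrite gt0_muley ?leey// lte_fin.
have iK := integrable_kernel_op hK mf Ox hf.
rewrite /kernel_op /Rintegral -abse_EFin fineK; last exact: integrable_fin_num.
apply: (le_trans (le_abse_integral _ measurableT _)).
  exact: measurable_int iK.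
apply: ge0_le_integralZ => //.
- by apply: measurableT_comp => //; apply/measurable_EFinP; exact: measurable_int iK.
- exact: measurable_heat_section.
- by move=> y; exact: heat_integrand_ge0.
by apply: filterS (bK x Ox) => y h; rewrite normrM [leRHS]mulrA ler_wpM2r.
Qed.

End kernel_operator.

(** * Boundedness on the weighted space *)

Section weighted_operator.
Context {R : realType} {n : nat}.
Variable O : domain R n.
Local Notation V := 'rV[R]_n.
Local Notation nu := (lebesgue_on O).
Local Notation L := (lebesgue_rV R n).
Local Notation bf := (boundary_factor O).
Variables (p theta delta : R) (p1 : (1 <= p%:E)%E).
Hypotheses (htheta : 0 <= theta < 2 * p - 1) (hdelta : 0 <= delta).
Hypothesis hgauss : weighted_Gaussian_bound O.
Local Notation w := (weight O theta delta).
Local Notation mu := (weighted_lebesgue O theta delta).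
Local Notation Lw := (Lw O theta delta p1).
Local Notation "'N' [ f ]" := ('N[mu]_p%:E[EFin \o f%R])%E (at level 0).

Let p1' : 1 <= p. Proof. by rewrite -lee_fin. Qed.
Let p0 : 0 < p. Proof. exact: lt_le_trans p1'. Qed.

Lemma measurable_powR_norm (f : V -> R) : measurable_fun setT f ->
  measurable_fun setT (fun x => `|f x| `^ p).
Proof.
by move=> mf; apply: (measurableT_comp (measurable_powR p)); exact: measurableT_comp.
Qed.

Lemma measurable_powR_weight (f : V -> R) : measurable_fun setT f ->
  measurable_fun setT (fun x => `|f x| `^ p * w x).
Proof.
move=> mf; apply: measurable_funM; last exact: measurable_weight.
exact: measurable_powR_norm.
Qed.

Lemma weighted_powE (f : V -> R) : measurable_fun setT f ->
  (\int[mu]_x (`|f x| `^ p)%:E = \int[nu]_x (`|f x| `^ p * w x)%:E)%E.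
Proof.
move=> mf; rewrite ge0_integral_weighted.
- by apply: eq_integral => x _; rewrite EFinM.
- by apply/measurable_EFinP; exact: measurable_powR_norm.
- by move=> x; rewrite lee_fin powR_ge0.
Qed.

Lemma Lw_pow_lty (f : Lw) : (\int[nu]_x (`|f x| `^ p * w x)%:E < +oo)%E.
Proof. by rewrite -weighted_powE//; exact: Lfun_pow_lty. Qed.

(** The weighted estimate gives finiteness almost everywhere only; it is applied with the constant 2
    c so that [heat_bound_near] can carry finiteness to every point of the domain. *)
Lemma heat_bound_lty (c t : R) (f : V -> R) x : 0 < c -> 0 < t <= 1 ->
  measurable_fun setT f -> (\int[nu]_x (`|f x| `^ p * w x)%:E < +oo)%E -> O x ->
  (heat_bound O c t f x < +oo)%E.
Proof.
move=> c0 t01 mf hf Ox; have /andP[t0 _] := t01.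
have c20 : 0 < 2 * c by rewrite mulr_gt0.
have [C C0 hC] := heat_bound_powR hgauss p1' htheta hdelta c20.
have fin : (\int[nu]_x (heat_bound O (2 * c) t f x `^ p * (w x)%:E) < +oo)%E.
  by apply: (le_lt_trans (hC t f t01 mf)); rewrite lte_mul_pinfty// ?lee_fin ltW.
have mh : measurable_fun setT (fun x => heat_bound O (2 * c) t f x `^ p * (w x)%:E)%E.
  apply: emeasurable_funM; last by apply/measurable_EFinP; exact: measurable_weight.
  by apply: (measurableT_comp (measurable_poweR p)); exact: measurable_heat_bound.
have hp0 z : (0 <= heat_bound O (2 * c) t f z `^ p * (w z)%:E)%E.
  by rewrite mule_ge0 ?poweR_ge0// lee_fin weight_ge0.
have hae := ae_lty_of_integral mh hp0 fin.
have [r r0 rP] := domain_ball t0 Ox.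
have [z [xz Oz hz]] := ae_open_point hae Ox (nbhsx_ballx x r r0).
have [_ zx] := rP z xz.
rewrite enormC in zx; apply: (le_lt_trans (heat_bound_near O c0 t0 mf zx)).
rewrite lte_mul_pinfty ?lee_fin//; first exact/ltW/shift_const_gt0.
rewrite ltNge leye_eq; apply/negP => /eqP hoo; move: hz.
by rewrite hoo poweRyr ?gt_eqF// gt0_mulye ?ltxx// lte_fin weight_gt0.
Qed.

(** Stated for an arbitrary v below the heat bound, in order to serve for the operator and for its
    derivatives, with B = C and B of order 1 / sqrt t respectively. *)
Lemma heat_dominated (c : R) : 0 < c -> exists2 D : R, 0 < D &
  forall t B (f : Lw) (v : V -> R), 0 < t <= 1 -> 0 <= B -> measurable_fun setT v ->
    (forall x, O x -> (`|v x|%:E <= B%:E * heat_bound O c t f x)%E) ->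
    v \in Lfun mu p%:E /\ (N[v] <= (B * D)%:E * N[f])%E.
Proof.
move=> c0; have [C C0 hC] := heat_bound_powR hgauss p1' htheta hdelta c0.
exists (C `^ p^-1) => [|t B f v t01 B0 mv hv]; first exact: powR_gt0.
have Cp : C = (C `^ p^-1) `^ p by rewrite -powRrM mulVf ?gt_eqF// powRr1 ?ltW.
have key : (\int[mu]_x (`|v x| `^ p)%:E <=
    ((B * C `^ p^-1) `^ p)%:E * \int[mu]_x (`|f x| `^ p)%:E)%E.
  rewrite !weighted_powE// powRM ?powR_ge0// -Cp EFinM -muleA.
  have mhp : measurable_fun setT
      (fun x => heat_bound O c t f x `^ p * (w x)%:E)%E.
    apply: emeasurable_funM; last by apply/measurable_EFinP; exact: measurable_weight.
    by apply: (measurableT_comp (measurable_poweR p)); exact: measurable_heat_bound.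
  have hp0 x : (0 <= heat_bound O c t f x `^ p * (w x)%:E)%E.
    by rewrite mule_ge0 ?poweR_ge0// lee_fin weight_ge0.
  apply: (@le_trans _ _ ((B `^ p)%:E *
      \int[nu]_x (heat_bound O c t f x `^ p * (w x)%:E))%E); last first.
    by rewrite lee_wpmul2l ?lee_fin ?powR_ge0// hC.
  rewrite -ge0_integralZl_EFin ?powR_ge0//.
  apply: ae_ge0_le_integral => //.
  - by move=> x _; rewrite lee_fin mulr_ge0 ?powR_ge0 ?weight_ge0.
  - by apply/measurable_EFinP; exact: measurable_powR_weight.
  - by move=> x _; rewrite mule_ge0 ?lee_fin ?powR_ge0.
  - by apply: emeasurable_funM => //; exact: measurable_cst.
  apply: filterS (ae_in_domain O) => x Ox _.
  rewrite EFinM muleA lee_wpmul2r ?lee_fin ?weight_ge0//.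
  rewrite -!poweR_EFin -poweRM ?lee_fin ?heat_bound_ge0//.
  apply: gt0_ler_poweR; rewrite ?(ltW p0)// ?in_itv/= ?leey ?lee_fin ?normr_ge0//.
    by rewrite mule_ge0// heat_bound_ge0.
  exact: hv.
split; last by apply: Lnorm_le_pow => //; rewrite mulr_ge0 ?powR_ge0.
apply: Lfun_pow => //; apply: (le_lt_trans key).
by rewrite lte_mul_pinfty ?lee_fin ?powR_ge0//; exact: Lfun_pow_lty.
Qed.

Definition kernel_Lw (K : V -> V -> R) (f : Lw) : Lw := to_Lfun mu p1 (kernel_op O K f).

Section heat_kernel.
Variables (c : R).
Hypothesis c0 : 0 < c.

Lemma kernel_Lw_bound : exists2 D : R, 0 < D &
  forall t C K (f : Lw), 0 < t <= 1 -> 0 < C -> heat_kernel O c C t K ->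
    (kernel_Lw K f = kernel_op O K f :> (V -> R)) /\
    (N[kernel_Lw K f] <= (C * D)%:E * N[f])%E.
Proof.
have [D D0 hD] := heat_dominated c0; exists D => // t C K f t01 C0 hK.
have [mK _ _] := hK.
have [||h1 h2] := hD t C f (kernel_op O K f) t01 (ltW C0).
- exact: measurable_kernel_op.
- by move=> x Ox; exact: kernel_op_le hK C0 _ Ox.
have e : kernel_Lw K f = kernel_op O K f :> (V -> R) by rewrite /kernel_Lw to_LfunE.
by split => //; rewrite e.
Qed.

Variables (t C : R) (K : V -> V -> R).
Hypotheses (t01 : 0 < t <= 1) (C0 : 0 < C) (hK : heat_kernel O c C t K).

Lemma kernel_LwE f : kernel_Lw K f = kernel_op O K f :> (V -> R).
Proof. by have [D _ /(_ t C K f t01 C0 hK)[]] := kernel_Lw_bound. Qed.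

Lemma integrable_kernel_Lw (f : Lw) x : O x ->
  nu.-integrable setT (EFin \o (fun y => K x y * f y)).
Proof.
move=> Ox; apply: (integrable_kernel_op hK) => //.
by apply: heat_bound_lty => //; exact: Lw_pow_lty.
Qed.

Lemma bounded_linear_kernel_Lw : bounded_linear (kernel_Lw K).
Proof.
split; last first.
  have [D _ hD] := kernel_Lw_bound; exists (C * D) => f.
  by have [] := hD t C K f t01 C0 hK.
move=> k f g; apply: aeW => x _; rewrite kernel_LwE.
transitivity (k * kernel_op O K f x + kernel_op O K g x); last by rewrite -!kernel_LwE.
have [Ox|nOx] := pselect (O x); last first.
  by rewrite !(kernel_op_out _ hK nOx) mulr0 addr0.
have i1 := integrable_kernel_Lw f Ox; have i2 := integrable_kernel_Lw g Ox.
rewrite /kernel_op -RintegralZl// -RintegralD//; last first.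
  have -> : EFin \o (fun y => k * (K x y * f y)) =
    (fun y => k%:E * (EFin \o (fun y => (K x y * f y)%R)) y)%E by apply/funext.
  exact: integrableZl.
by congr fine; apply: eq_integral => y _; congr EFin; rewrite mulrDr mulrCA.
Qed.

End heat_kernel.

End weighted_operator.

(** * Bounded functions supported in a core *)

Section core_bounded.
Context {R : realType} {n : nat}.
Variable O : domain R n.
Local Notation V := 'rV[R]_n.
Local Notation nu := (lebesgue_on O).
Local Notation L := (lebesgue_rV R n).

Lemma measurable_enorm_le (r : R) : measurable [set x : V | enorm x <= r].
Proof.
rewrite -[X in measurable X]setTI; apply: (measurable_fun_le (D := setT)) => //.
by apply: continuous_measurable_rV; exact: continuous_enorm.
Qed.

(** On the ball the Gaussian of variance 1 is at least its value [k] at radius r, and its total mass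
    is 1. *)
Lemma lebesgue_rV_bounded_lty (r : R) : (L [set x : V | (enorm x <= r)%R] < +oo)%E.
Proof.
have [r0|r0] := ltP r 0.
  rewrite (_ : [set _ | _] = set0) ?measure0//; apply/seteqP; split => // x /= xr.
  by have := le_lt_trans xr r0; rewrite ltNge enorm_ge0.
pose k : R := (2 * pi * 1) `^ (- (n%:R / 2)) * expR (- r ^+ 2 / (2 * 1)).
have k0 : 0 < k by rewrite mulr_gt0 ?expR_gt0// powR_gt0// !mulr_gt0// pi_gt0.
have mA := measurable_enorm_le r.
apply: (@le_lt_trans _ _ (k^-1%:E * \int[L]_y (gaussian 1 (0 - y))%:E)%E); last first.
  by rewrite integral_gaussian// mule1 ltry.
rewrite -[leLHS]mul1e -integral_cst// integral_mkcond.
have -> : (cst 1%E : V -> \bar R) \_ [set x : V | enorm x <= r] =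
    (fun x => (\1_[set x : V | enorm x <= r] x)%:E).
  by apply/funext => x; rewrite patchE indicE; case: ifP.
apply: ge0_le_integralZ => //.
- exact: measurable_gaussian_subr.
- by move=> y; exact: gaussian_ge0.
- by rewrite invr_ge0 ltW.
apply: aeW => x; rewrite indicE; have [xr|_] := boolP (x \in _); last first.
  by rewrite mulr_ge0 ?gaussian_ge0// invr_ge0 ltW.
rewrite inE/= in xr; rewrite ler_pdivlMl// mulr1 /gaussian.
rewrite ler_wpM2l ?powR_ge0// ler_expR ler_pM2r ?invr_gt0 ?mulr_gt0// lerN2.
by rewrite sub0r enormN ler_sqr ?nnegrE ?enorm_ge0.
Qed.

Lemma core_lty k : (nu (core O k) < +oo)%E.
Proof.
apply: (le_lt_trans _ (lebesgue_rV_bounded_lty (n.+1%:R * k.+1%:R))).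
rewrite /lebesgue_on /mrestr le_measure ?inE//.
- by apply: measurableI; [exact: measurable_core|exact: measurable_domain].
- exact: measurable_enorm_le.
- move=> x [[_ _ xk] _] /=; apply: (le_trans (enorm_le_norm _)).
  by rewrite ler_wpM2l.
Qed.

Definition core_bounded (f : V -> R) := exists (k : nat) (M : R),
  (forall y, `|f y| <= M) /\ (forall y, ~ core O k y -> f y = 0).

Lemma core_bounded_pow_lty (f : V -> R) (q : R) : 0 < q -> measurable_fun setT f ->
  core_bounded f -> (\int[nu]_x (`|f x| `^ q)%:E < +oo)%E.
Proof.
move=> q0 mf [k [M [fM fk]]].
have M0 : 0 <= M by exact: le_trans (fM 0).
apply: (@le_lt_trans _ _ ((M `^ q)%:E * nu (core O k))%E); last first.
  by rewrite lte_mul_pinfty ?lee_fin ?powR_ge0//; exact: core_lty.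
rewrite -integral_cst; last exact: measurable_core.
rewrite [leRHS]integral_mkcond; apply: ge0_le_integral => //.
- by apply/measurable_EFinP; exact: measurable_powR_norm.
- apply/(measurable_restrictT _ _).1 => //; exact: measurable_core.
move=> x _; rewrite patchE; case: ifPn => [_|].
  by rewrite /= lee_fin ge0_ler_powR ?nnegrE// ltW.
by rewrite notin_setE => /fk ->; rewrite normr0 powR0// gt_eqF.
Qed.

Lemma compact_core_sub (K : set V) : compact K -> K `<=` O ->
  exists k, K `<=` core O k.
Proof.
move=> cK KO; have [/eqP K0|/set0P K0] := boolP (K == set0).
  by exists 0%N; rewrite K0.
have [M [_ KM]] := compact_bounded cK.
have [|x Kx xmin] := @compact_EVT_min _ _ (boundary_dist O) K K0 cK.
  by apply: continuous_subspaceT; exact: continuous_boundary_dist.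
rewrite inE in Kx; have d0 := domain_dist_gt0 (KO _ Kx).
(* [compact_bounded] bounds |y| by every number above M, hence M + 1. *)
have [k [k1 k2]] : exists k : nat, k.+1%:R^-1 < boundary_dist O x /\ M + 1 <= k%:R.
  have H : \forall k \near \oo, k.+1%:R^-1 < boundary_dist O x /\ M + 1 <= k%:R.
    by apply: filterI; [exact: (near_infty_natSinv_lt (PosNum d0))|exact: nbhs_infty_ger].
  by have [N _ /(_ N (leqnn N))] := H; exists N.
exists k => y Ky; split; first exact: KO.
  by rewrite (le_trans (ltW k1))// xmin// inE.
rewrite (le_trans (KM (M + 1) _ _ Ky)) ?ltrDl//.
by rewrite (le_trans k2)// ler_nat.
Qed.

End core_bounded.

(** * The semigroup on a core *)

Section density.
Context {R : realType} {n : nat}.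
Variable O : domain R n.
Local Notation V := 'rV[R]_n.
Local Notation nu := (lebesgue_on O).
Variables (p theta delta : R) (p1 : (1 <= p%:E)%E).
Hypothesis hdelta : 0 <= delta.
Local Notation w := (weight O theta delta).
Local Notation mu := (weighted_lebesgue O theta delta).
Local Notation Lw := (Lw O theta delta p1).
Local Notation "'N' [ f ]" := ('N[mu]_p%:E[EFin \o f%R])%E (at level 0).

Let p1' : 1 <= p. Proof. by rewrite -lee_fin. Qed.
Let p0 : 0 < p. Proof. exact: lt_le_trans p1'. Qed.

Lemma core_bounded_Lw (f : V -> R) : measurable_fun setT f -> core_bounded O f ->
  f \in Lfun mu p%:E.
Proof.
move=> mf fb; apply: (Lfun_pow p1) => //; rewrite weighted_powE//.
apply: le_lt_trans (core_bounded_pow_lty p0 mf fb).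
apply: ge0_le_integral => //.
- by move=> x _; rewrite lee_fin mulr_ge0 ?powR_ge0 ?weight_ge0.
- by apply/measurable_EFinP; exact: measurable_powR_weight.
- by apply/measurable_EFinP; exact: measurable_powR_norm.
- by move=> x _; rewrite lee_fin ler_piMr ?powR_ge0// weight_le1.
Qed.

Lemma core_bounded_L2 (f : V -> R) : measurable_fun setT f -> core_bounded O f ->
  f \in Lfun nu 2%:E.
Proof.
move=> mf fb; apply: (Lfun_pow (lee1n 2)) => //.
exact: core_bounded_pow_lty fb.
Qed.

(** Truncation both to [core O k] and to the set where |f| <= k; dominated convergence, with
    majorant |f|^p, concludes. *)
Lemma core_bounded_dense (f : Lw) (e : R) : 0 < e ->
  exists2 g : Lw, core_bounded O g & (N[(f - g : Lw)] <= e%:E)%E.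
Proof.
move=> e0.
pose A (k : nat) : set V := core O k `&` [set x | `|f x| <= k%:R].
have mA k : measurable (A k).
  apply: measurableI; first exact: measurable_core.
  rewrite -[X in measurable X]setTI.
  apply: (measurable_fun_le (D := setT)) => //.
  exact: measurableT_comp.
pose h k : V -> R := fun x => f x * \1_(A k) x.
have mh k : measurable_fun setT (h k).
  by apply: measurable_funM => //; exact: measurable_indic.
have hA k x : ~ A k x -> h k x = 0.
  by move=> nA; rewrite /h indicE memNset// mulr0.
have hA1 k x : A k x -> h k x = f x.
  by move=> nA; rewrite /h indicE mem_set// mulr1.
have hb k : core_bounded O (h k).
  exists k, k%:R; split => y.
    have [Ay|nAy] := pselect (A k y); last by rewrite hA// normr0.
    by rewrite hA1//; have [] := Ay.
  by move=> nk; apply: hA => -[].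
have hLw k := core_bounded_Lw (mh k) (hb k).
have cv : (\int[mu]_x (`|f x - h k x| `^ p)%:E @[k --> \oo] --> 0%E)%E.
  have mpw (g : V -> R) : measurable_fun setT g ->
      measurable_fun setT (fun x => (`|g x| `^ p)%:E).
    by move=> mg; apply/measurable_EFinP; exact: measurable_powR_norm.
  have [|||||_ _ H] := @dominated_convergence _ _ _ mu setT measurableT
    (fun k x => (`|f x - h k x| `^ p)%:E) (cst 0%E) (fun x => (`|f x| `^ p)%:E).
  - by move=> k; apply: (mpw (fun x => f x - h k x)); exact: measurable_funB.
  - exact: measurable_cst.
  - apply/weighted_ae; apply: filterS (ae_in_domain O) => x Ox _.
    have H : \forall k \near \oo, A k x.
      by apply: filterI; [exact: core_near|exact: nbhs_infty_ger].
    apply: cvg_near_cst; apply: filterS H => k Akx.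
    by rewrite hA1// subrr normr0 powR0// gt_eqF.
  - apply/integrableP; split; first exact: mpw.
    under eq_integral do rewrite gee0_abs ?lee_fin ?powR_ge0//.
    exact: Lfun_pow_lty.
  - apply: aeW => x k _; rewrite gee0_abs ?lee_fin ?powR_ge0//.
    rewrite ge0_ler_powR ?nnegrE ?(ltW p0)//.
    have [Ay|nAy] := pselect (A k x); last by rewrite hA// subr0.
    by rewrite hA1// subrr normr0.
  by move: H; rewrite integral0.
have ep : (0 < (e `^ p)%:E)%E by rewrite lte_fin powR_gt0.
have [k _ /(_ k (leqnn k)) hk] := cvge0_near_lt cv ep.
exists (to_Lfun mu p1 (h k)); first by rewrite to_LfunE.
have -> : N[(f - to_Lfun mu p1 (h k) : Lw)] = N[fun x => f x - h k x].
  apply: eq_Lnorm => x; congr EFin.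
  by transitivity (f x - to_Lfun mu p1 (h k) x); rewrite // to_LfunE.
by apply: (Lnorm_le_real p1) => //; exact: ltW.
Qed.

End density.

(** * Strong continuity *)

Lemma cvge0_of_le (T : Type) (F : set_system T) (FF : Filter F) (R : realType)
    (f : T -> \bar R) : (forall x, (0 <= f x)%E) ->
  (forall e : R, 0 < e -> \forall x \near F, (f x <= e%:E)%E) -> f @ F --> 0%E.
Proof.
move=> f0 fe; apply/fine_cvgP; split.
  apply: filterS (fe 1 ltr01) => x fx.
  by rewrite ge0_fin_numE// (le_lt_trans fx)// ltry.
apply/cvgr0Pnorm_le => e e0; apply: filterS (fe e e0) => x fx /=.
rewrite ger0_norm ?fine_ge0// -lee_fin fineK//.
by rewrite ge0_fin_numE// (le_lt_trans fx)// ltry.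
Qed.

(** Values below e are paid by e^p, and above e the ratio s^2 / e^2 is at least 1. Hence, for
    uniformly bounded functions on a set of finite measure, L^2 convergence gives L^p convergence
    even when p < 2. *)
Lemma powR_le_sqr (R : realType) (p e M s : R) : 1 <= p -> 0 < e -> 0 <= s <= M ->
  s `^ p <= e `^ p + M `^ p / e ^+ 2 * s ^+ 2.
Proof.
move=> p1 e0 /andP[s0 sM]; have p0 : 0 <= p by exact: le_trans p1.
have M0 : 0 <= M by exact: le_trans sM.
have [se|es] := leP s e.
  apply: (@le_trans _ _ (e `^ p)).
    by apply: ge0_ler_powR; rewrite // nnegrE ltW.
  by rewrite lerDl mulr_ge0 ?sqr_ge0// divr_ge0 ?powR_ge0 ?sqr_ge0.
apply: (@le_trans _ _ (M `^ p / e ^+ 2 * s ^+ 2)); last by rewrite lerDr powR_ge0.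
apply: (@le_trans _ _ (M `^ p)); first by apply: ge0_ler_powR; rewrite // nnegrE.
rewrite mulrAC ler_pdivlMr ?exprn_gt0// ler_wpM2l ?powR_ge0//.
by rewrite ler_sqr ?nnegrE ?(ltW es)// ltW.
Qed.

Section strong_continuity.
Context {R : realType} {n : nat}.
Variable O : domain R n.
Local Notation V := 'rV[R]_n.
Local Notation nu := (lebesgue_on O).
Local Notation L := (lebesgue_rV R n).
Local Notation bf := (boundary_factor O).

(** Gaussian average of |f| without boundary factor. Its integral is at most the L^1 norm of f
    whatever s, which controls the part of S(t) f far from the support of f. *)
Definition mass (s : R) (f : V -> R) (x : V) : \bar R :=
  (\int[nu]_y (gaussian s (x - y) * `|f y|)%:E)%E.

Lemma measurable_mass_integrand (s : R) (f : V -> R) : measurable_fun setT f ->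
  measurable_fun setT (fun xy : V * V => (gaussian s (xy.1 - xy.2) * `|f xy.2|)%:E).
Proof.
move=> mf; apply/measurable_EFinP; apply: measurable_funM.
  exact: measurable_gaussian_sub.
by apply: measurableT_comp => //; exact: (measurableT_comp mf measurable_snd).
Qed.

Lemma measurable_mass_section (s : R) (f : V -> R) (x : V) : measurable_fun setT f ->
  measurable_fun setT (fun y : V => (gaussian s (x - y) * `|f y|)%:E).
Proof.
move=> mf.
exact: (measurableT_comp (measurable_mass_integrand s mf) (pair1_measurable x)).
Qed.

Lemma mass_ge0 s f x : (0 <= mass s f x)%E.
Proof. by apply: integral_ge0 => y _; rewrite lee_fin mulr_ge0 ?gaussian_ge0. Qed.

Lemma measurable_mass (s : R) (f : V -> R) : measurable_fun setT f ->
  measurable_fun setT (mass s f).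
Proof.
move=> mf; apply: (measurable_fun_fubini_tonelli_F (m2 := nu)
  (fun xy : V * V => (gaussian s (xy.1 - xy.2) * `|f xy.2|)%:E)).
  exact: measurable_mass_integrand.
by move=> xy; rewrite lee_fin mulr_ge0 ?gaussian_ge0.
Qed.

Lemma integral_mass_le (s : R) (f : V -> R) : 0 < s -> measurable_fun setT f ->
  (\int[nu]_x mass s f x <= \int[nu]_y `|f y|%:E)%E.
Proof.
move=> s0 mf; rewrite /mass.
rewrite (fubini_tonelli (m1 := nu) (m2 := nu)
  (fun xy : V * V => (gaussian s (xy.1 - xy.2) * `|f xy.2|)%:E)); last 2 first.
- exact: measurable_mass_integrand.
- by move=> xy; rewrite lee_fin mulr_ge0 ?gaussian_ge0.
apply: ge0_le_integral => //.
- by move=> y _; apply: integral_ge0 => x _; rewrite lee_fin mulr_ge0 ?gaussian_ge0.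
- apply: (measurable_fun_fubini_tonelli_G (m1 := nu)
    (fun xy : V * V => (gaussian s (xy.1 - xy.2) * `|f xy.2|)%:E)).
    exact: measurable_mass_integrand.
  by move=> xy; rewrite lee_fin mulr_ge0 ?gaussian_ge0.
- by apply/measurable_EFinP; exact: measurableT_comp.
move=> y _ /=; under eq_integral do rewrite mulrC EFinM.
rewrite ge0_integralZl_EFin//; last 2 first.
- by move=> x _; rewrite lee_fin gaussian_ge0.
- by apply/measurable_EFinP; exact: measurable_gaussian_subl.
by rewrite -[leRHS]mule1 lee_wpmul2l ?lee_fin// integral_gaussian_onl.
Qed.

(** Uses exp(-r) <= 1 / r with r = |z|^2 / (4 s) >= 1 / (4 s). The gain of a factor s makes the tail
    vanish as t tends to 0. *)
Lemma gaussian_far (s : R) (z : V) : 0 < s -> 1 <= enorm z ->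
  gaussian s z <= 2 `^ (n%:R / 2) * (4 * s) * gaussian (2 * s) z.
Proof.
move=> s0 z1; rewrite gaussian_double// ler_wpM2r ?gaussian_ge0//.
rewrite ler_pM2l ?powR_gt0//.
have s40 : 0 < 4 * s by rewrite mulr_gt0.
set r := enorm z ^+ 2 / (4 * s).
have r0 : (4 * s)^-1 <= r.
  by rewrite -[leLHS]mul1r ler_pM2r ?invr_gt0// exprn_ege1.
have ri : 0 < r by rewrite (lt_le_trans _ r0)// invr_gt0.
rewrite expRN (@le_trans _ _ r^-1)//; last first.
  by rewrite -[leRHS]invrK lef_pV2 ?posrE ?invr_gt0.
rewrite lef_pV2 ?posrE ?expR_gt0//.
by rewrite (le_trans _ (expR_ge1Dx _))// lerDr.
Qed.

Lemma heat_bound_far (c t r : R) (f : V -> R) x : 0 < c -> 0 < t ->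
  measurable_fun setT f -> (forall y, f y != 0 -> enorm y <= r) -> r + 1 <= enorm x ->
  (heat_bound O c t f x <=
   (2 `^ (n%:R / 2) * (4 * (c * t)))%:E * mass (2 * (c * t)) f x)%E.
Proof.
move=> c0 t0 mf fr rx; have ct0 : 0 < c * t by rewrite mulr_gt0.
have k0 : 0 <= 2 `^ (n%:R / 2) * (4 * (c * t)) by rewrite mulr_ge0 ?powR_ge0 ?mulr_ge0 ?ltW.
apply: ge0_le_integralZ => //.
- exact: measurable_heat_section.
- by apply/measurable_EFinP; exact: measurable_mass_section.
- by move=> y; exact: heat_integrand_ge0.
- by move=> y; rewrite mulr_ge0 ?gaussian_ge0.
apply: aeW => y; rewrite [leRHS]mulrA.
have e0 k : f y = 0 -> k * `|f y| = 0 by move=> ->; rewrite normr0 mulr0.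
have [fy|fy] := eqVneq (f y) 0; first by rewrite [leLHS]e0// [leRHS]e0.
rewrite ler_wpM2r//.
apply: (@le_trans _ _ (gaussian (c * t) (x - y))).
  by rewrite ler_piMl ?gaussian_ge0 ?boundary_factor_le1.
apply: gaussian_far => //.
have := ler_enorm_sub x y 0; rewrite !subr0 => h.
by rewrite -(lerD2r r) addrC (le_trans rx)// (le_trans h)// lerD2l fr.
Qed.

End strong_continuity.

(** * Kernels for large times *)

Section kernel_composition.
Context d (T : measurableType d) (R : realType).
Variable m : {sigma_finite_measure set T -> \bar R}.
Implicit Types (A H : T -> T -> R) (f : T -> R).

Definition kernel_comp A H (x y : T) : R := (\int[m]_z (A x z * H z y))%R.

Lemma measurable_kernel_comp A H :
  measurable_fun setT (fun xy => A xy.1 xy.2) ->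
  measurable_fun setT (fun xy => H xy.1 xy.2) ->
  measurable_fun setT (fun xy => kernel_comp A H xy.1 xy.2).
Proof.
move=> mA mH.
apply: (@measurable_Rintegral_param _ _ _ _ _ _ (fun (xy : T * T) z => A xy.1 z * H z xy.2)).
apply: measurable_funM.
  apply: (measurableT_comp mA (g := fun w : (T * T) * T => (w.1.1, w.2))).
  apply: measurable_fun_pair; last exact: measurable_snd.
  exact: (measurableT_comp measurable_fst measurable_fst).
apply: (measurableT_comp mH (g := fun w : (T * T) * T => (w.2, w.1.2))).
apply: measurable_fun_pair; first exact: measurable_snd.
exact: (measurableT_comp measurable_snd measurable_fst).
Qed.

Lemma measurable_kernel_row H x : measurable_fun setT (fun xy => H xy.1 xy.2) ->
  measurable_fun setT (H x).
Proof. by move=> mH; exact: (measurableT_comp mH (pair1_measurable x)). Qed.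

Lemma measurable_kernel_col H y : measurable_fun setT (fun xy => H xy.1 xy.2) ->
  measurable_fun setT (H ^~ y).
Proof. by move=> mH; exact: (measurableT_comp mH (pair2_measurable y)). Qed.

Lemma integrable_bounded_mul (h f : T -> R) (M : R) : measurable_fun setT h ->
  (forall y, `|h y| <= M) -> m.-integrable setT (EFin \o f) ->
  m.-integrable setT (EFin \o (fun y => h y * f y)).
Proof.
move=> mh hM fi; have mf : measurable_fun setT f by apply/measurable_EFinP; exact: measurable_int fi.
have iM : m.-integrable setT (fun y => M%:E * `|(EFin \o f) y|)%E.
  by apply: integrableZl => //; exact: integrable_abse.
apply: (le_integrable measurableT _ _ iM).
  by apply/measurable_EFinP; exact: measurable_funM.
move=> y _ /=; rewrite lee_fin normrM [leRHS]ger0_norm ?ler_wpM2r//.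
by rewrite mulr_ge0// (le_trans _ (hM y)).
Qed.

Variables (A H : T -> T -> R) (a M : R).
Hypothesis mA : measurable_fun setT (fun xy => A xy.1 xy.2).
Hypothesis mH : measurable_fun setT (fun xy => H xy.1 xy.2).
Hypothesis Aa : forall x, (\int[m]_z `|A x z|%:E <= a%:E)%E.
Hypothesis HM : forall x y, `|H x y| <= M.

Let iA x : m.-integrable setT (EFin \o A x).
Proof.
apply/integrableP; split; first by apply/measurable_EFinP; exact: measurable_kernel_row.
by rewrite (le_lt_trans (Aa x))// ltry.
Qed.

Lemma kernel_comp_le x y : `|kernel_comp A H x y| <= a * M.
Proof.
have M0 : 0 <= M by exact: le_trans (HM x y).
have i1 : m.-integrable setT (EFin \o (fun z => A x z * H z y)).
  under [X in _.-integrable _ (EFin \o X)]eq_fun do rewrite mulrC.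
  by apply: (@integrable_bounded_mul (H ^~ y) (A x) M) => //; exact: measurable_kernel_col.
rewrite /kernel_comp; apply: (le_trans (le_normr_Rintegral measurableT i1)).
rewrite -lee_fin /Rintegral fineK; last first.
  by apply: integrable_fin_num => //; exact: (integrable_norm i1).
apply: (@le_trans _ _ (M%:E * \int[m]_z `|A x z|%:E)%E); last first.
  by rewrite mulrC EFinM lee_wpmul2l.
have mAx : measurable_fun setT (A x) by exact: measurable_kernel_row.
have mHy : measurable_fun setT (H ^~ y) by exact: measurable_kernel_col.
apply: ge0_le_integralZ => //.
- by apply: measurableT_comp => //; exact: measurable_funM.
- exact: measurableT_comp.
by apply: aeW => z; rewrite normrM mulrC ler_wpM2r.
Qed.

(** Fubini's theorem: the absolute value of the integrand has integral at most a M times the L^1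
    norm of f. No square integrability of f is involved. *)
Lemma kernel_comp_op f x : m.-integrable setT (EFin \o f) ->
  (\int[m]_z (A x z * \int[m]_y (H z y * f y)))%R =
  (\int[m]_y (kernel_comp A H x y * f y))%R.
Proof.
move=> fi; have mf : measurable_fun setT f by apply/measurable_EFinP; exact: measurable_int fi.
have M0 : 0 <= M by exact: le_trans (HM x x).
pose F (w : T * T) : R := A x w.1 * (H w.1 w.2 * f w.2).
have mAx : measurable_fun setT (A x) by exact: measurable_kernel_row.
have mF : measurable_fun setT F.
  apply: measurable_funM; first exact: (measurableT_comp mAx measurable_fst).
  by apply: measurable_funM => //; exact: (measurableT_comp mf measurable_snd).
have f_lty : (\int[m]_y `|f y|%:E < +oo)%E by have /integrableP[_] := fi.
have fE : (\int[m]_y `|f y|%:E = (fine (\int[m]_y `|f y|%:E))%:E)%E.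
  by rewrite fineK// ge0_fin_numE// integral_ge0.
set I := fine _ in fE; have I0 : 0 <= I by rewrite fine_ge0// integral_ge0.
have inner z : (\int[m]_y `|(EFin \o F) (z, y)| <= (M * I)%:E * `|A x z|%:E)%E.
  have -> : ((M * I)%:E * `|A x z|%:E = (`|A x z| * M)%:E * \int[m]_y `|f y|%:E)%E.
    by rewrite fE -!EFinM mulrC mulrA.
  apply: ge0_le_integralZ => //.
  - apply: measurableT_comp => //.
    exact: (measurableT_comp mF (pair1_measurable z)).
  - exact: measurableT_comp.
  - exact: mulr_ge0.
  by apply: aeW => y; rewrite /F !normrM -mulrA ler_wpM2l// ler_wpM2r.
have iF : (m \x m)%E.-integrable setT (EFin \o F).
  apply/integrable12ltyP; first exact/measurable_EFinP.
  apply: (@le_lt_trans _ _ ((M * I)%:E * a%:E)%E); last by rewrite -EFinM ltry.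
  apply: (@le_trans _ _ ((M * I)%:E * \int[m]_z `|A x z|%:E)%E); last first.
    by rewrite lee_wpmul2l// lee_fin mulr_ge0.
  rewrite -ge0_integralZl_EFin//; last 2 first.
  - by apply/measurable_EFinP; exact: measurableT_comp.
  - exact: mulr_ge0.
  apply: ge0_le_integral => //.
  - by move=> z _; exact: integral_ge0.
  - apply: (measurable_fun_fubini_tonelli_F (m2 := m) (fun w => `|(EFin \o F) w|%E)) => //.
    by apply: measurableT_comp => //; exact/measurable_EFinP.
  - by apply/measurable_EFinP; apply: measurable_funM => //; exact: measurableT_comp.
have iHf z : m.-integrable setT (EFin \o (fun y => H z y * f y)).
  by apply: (@integrable_bounded_mul _ _ M) => //; exact: measurable_kernel_row.
have iAH y : m.-integrable setT (EFin \o (fun z => A x z * H z y)).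
  under [X in _.-integrable _ (EFin \o X)]eq_fun do rewrite mulrC.
  by apply: (@integrable_bounded_mul (H ^~ y) (A x) M) => //; exact: measurable_kernel_col.
rewrite /Rintegral; congr fine.
transitivity (\int[m]_z \int[m]_y (EFin \o F) (z, y))%E.
  apply: eq_integral => z _; rewrite EFinM fineK; last exact: integrable_fin_num (iHf z).
  by rewrite -integralZl//; exact: iHf z.
rewrite Fubini//; apply: eq_integral => y _.
rewrite mulrC EFinM /kernel_comp fineK; last exact: integrable_fin_num (iAH y).
rewrite -integralZl//; last exact: iAH y.
apply: eq_integral => z _.
transitivity ((f y * (A x z * H z y))%:E); last by [].
by rewrite /= /F /= mulrA mulrC.
Qed.

End kernel_composition.

Section truncated_kernel.
Context {R : realType} {n : nat}.
Variable O : domain R n.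
Local Notation V := 'rV[R]_n.
Local Notation nu := (lebesgue_on O).
Local Notation bf := (boundary_factor O).
Variables (c C t : R) (K : V -> V -> R).
Hypotheses (c0 : 0 < c) (C0 : 0 < C) (t0 : 0 < t).
Hypothesis hK : heat_kernel O c C t K.

Let Q (x y : V) : R := C * (bf t y * gaussian (c * t) (x - y)).

Let Q0 x y : 0 <= Q x y.
Proof. by rewrite mulr_ge0 ?(ltW C0)// mulr_ge0 ?boundary_factor_ge0 ?gaussian_ge0. Qed.

(** Setting the kernel to zero where the bound fails does not change the operator, but makes the
    bound valid at every pair of points. The composition of kernels needs it, since the exceptional
    sets of y vary with x. *)
Definition truncated_kernel (x y : V) : R :=
  if `|K x y| <= C * (bf t y * gaussian (c * t) (x - y)) then K x y else 0.
Local Notation K' := truncated_kernel.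

Lemma truncated_kernel_le x y : `|K' x y| <= C * (bf t y * gaussian (c * t) (x - y)).
Proof. by rewrite /K'; case: ifPn => // _; rewrite normr0; exact: Q0. Qed.

Lemma measurable_truncated_kernel :
  measurable_fun setT (fun xy : V * V => K' xy.1 xy.2).
Proof.
have [mK _ _] := hK.
apply: (measurable_fun_ifT (f := fun xy : V * V => `|K xy.1 xy.2| <= Q xy.1 xy.2)) => //.
apply: measurable_fun_ler; first exact: measurableT_comp.
apply: measurable_funM => //; apply: measurable_funM; last exact: measurable_gaussian_sub.
exact: (measurableT_comp (measurable_boundary_factor O t) measurable_snd).
Qed.

Lemma truncated_kernel_op (f : V -> R) x : measurable_fun setT f ->
  kernel_op O K f x = kernel_op O K' f x.
Proof.
move=> mf; have [mK K0 bK] := hK; rewrite /kernel_op /Rintegral; congr fine.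
apply: ae_eq_integral => //.
- by apply/measurable_EFinP; exact: measurable_kernelM1.
- by apply/measurable_EFinP; apply: measurable_kernelM1 => //; exact: measurable_truncated_kernel.
have [Ox|nOx] := pselect (O x).
  by apply: filterS (bK x Ox) => y h _ /=; rewrite /K' h.
by apply: aeW => y _ /=; rewrite /K' K0// if_same.
Qed.

Lemma integral_truncated_kernel_le x : (\int[nu]_y `|K' x y|%:E <= C%:E)%E.
Proof.
have ct0 : 0 < c * t by rewrite mulr_gt0.
have mKx := measurable_kernel_row x measurable_truncated_kernel.
apply: (@le_trans _ _ (C%:E * \int[nu]_y (gaussian (c * t) (x - y))%:E)%E); last first.
  by rewrite -[leRHS]mule1 lee_wpmul2l ?lee_fin ?(ltW C0)// integral_gaussian_on.
apply: ge0_le_integralZ => //.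
- exact: measurableT_comp.
- exact: measurable_gaussian_subr.
- by move=> y; exact: gaussian_ge0.
- exact: ltW.
apply: aeW => y; rewrite (le_trans (truncated_kernel_le x y))//.
by rewrite ler_wpM2l ?(ltW C0)// ler_piMl ?gaussian_ge0 ?boundary_factor_le1.
Qed.

Lemma truncated_kernel_bounded : exists M : R, forall x y, `|K' x y| <= M.
Proof.
have ct0 : 0 < 2 * (c * t) by rewrite !mulr_gt0.
exists (C * (2 * pi * (c * t)) `^ (- (n%:R / 2))) => x y.
apply: (le_trans (truncated_kernel_le x y)).
rewrite ler_wpM2l ?(ltW C0)//.
apply: (@le_trans _ _ (gaussian (c * t) (x - y))).
  by rewrite ler_piMl ?gaussian_ge0 ?boundary_factor_le1.
rewrite /gaussian ler_piMr ?powR_ge0// -[leRHS]expR0 ler_expR mulNr oppr_le0.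
by rewrite divr_ge0 ?sqr_ge0 ?ltW.
Qed.

End truncated_kernel.

Lemma ae_forall_countable d (T : measurableType d) (R : realType)
    (m : {measure set T -> \bar R}) (I : countType) (P : I -> T -> Prop) :
  (forall i, {ae m, forall x, P i x}) -> {ae m, forall x i, P i x}.
Proof.
move=> h.
have : {ae m, forall x k, if unpickle k is Some i then P i x else True}.
  apply/ae_foralln => k; case: (unpickle k) => [i|]; first exact: h.
  exact: aeW.
by apply: filterS => x H i; have := H (pickle i); rewrite pickleK.
Qed.

(** * The semigroup on the weighted space *)

Section semigroup.
Context {R : realType} {n : nat}.
Variable O : domain R n.
Local Notation V := 'rV[R]_n.
Local Notation nu := (lebesgue_on O).
Variables (p theta delta : R) (p1 : (1 <= p%:E)%E).
Hypotheses (htheta : 0 <= theta < 2 * p - 1) (hdelta : 0 <= delta).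
Hypothesis hgauss : weighted_Gaussian_bound O.
Local Notation mu := (weighted_lebesgue O theta delta).
Local Notation Lw := (Lw O theta delta p1).
Local Notation "'N' [ f ]" := ('N[mu]_p%:E[EFin \o f%R])%E (at level 0).
Variables (c C : R) (K : R -> V -> V -> R) (S2 : R -> L2 O -> L2 O).
Hypotheses (c0 : 0 < c) (C0 : 0 < C).
Hypothesis hK : forall t, 0 < t <= 1 -> heat_kernel O c C t (K t).
Hypothesis hS2 : C0_semigroup S2.
Hypothesis mK : forall t, 0 < t -> measurable_fun setT (fun xy : V * V => K t xy.1 xy.2).
Hypothesis S2K : forall t (f : L2 O), 0 < t -> {ae nu, forall x,
  nu.-integrable setT (EFin \o (fun y => K t x y * f y)) /\
  S2 t f x = kernel_op O (K t) f x}.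

Definition steps (t : R) : nat := if t <= 1 then 1%N else (Num.truncn t).+1.

(* The kernel bounds hold up to time 1 only, so that S t is the N-th power of the
   integral operator at time t / N <= 1; one step suffices for t <= 1. *)
Definition weighted_semigroup (t : R) (f : Lw) : Lw :=
  if t <= 0 then f
  else iter (steps t) (kernel_Lw (K (t / (steps t)%:R))) f.
Local Notation S := weighted_semigroup.

Lemma steps_gt0 t : 0 < (steps t)%:R :> R.
Proof. by rewrite ltr0n /steps; case: ifP. Qed.

Lemma div_steps t : 0 < t -> 0 < t / (steps t)%:R <= 1.
Proof.
move=> t0; rewrite divr_gt0 ?steps_gt0//= ler_pdivrMr ?steps_gt0// mul1r /steps.
case: ifP => // _; have /andP[_ /ltW//] := truncn_itv (ltW t0).
Qed.

Lemma weighted_semigroup01 t f : 0 < t <= 1 -> S t f = kernel_Lw (K t) f.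
Proof.
move=> /andP[t0 t1]; rewrite /S leNgt t0/=.
have -> : steps t = 1%N by rewrite /steps t1.
by rewrite /= divr1.
Qed.

Lemma weighted_semigroup_bounded t : bounded_linear (S t).
Proof.
have [t0|t0] := leP t 0.
  have -> : S t = id by apply/funext => f; rewrite /S t0.
  exact: bounded_linear_id.
have -> : S t = iter (steps t) (kernel_Lw (K (t / (steps t)%:R))).
  by apply/funext => f; rewrite /S leNgt t0.
have h := div_steps t0; apply: bounded_linear_iter.
exact: bounded_linear_kernel_Lw (hK h).
Qed.

(** The semigroup law of [S2] splits off one step of length t / N; on it both operators integrate
    against the same kernel, and such integrals do not see null sets. Through this identity the
    properties of [S2] are transferred on functions common to both spaces. *)
Lemma weighted_semigroup_L2 t (f : Lw) (g : L2 O) : 0 <= t ->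
  (f : V -> R) = g %[ae nu] -> (S t f : V -> R) = S2 t g %[ae nu].
Proof.
have [_ S20 S2D _] := hS2.
rewrite le_eqVlt => /predU1P[<-|t0] fg.
  by rewrite /S lexx; apply: filterS2 fg (S20 g) => x h1 h2 _; rewrite h1// h2.
rewrite /S leNgt t0/=; set N := steps t; set s := t / N%:R.
have s01 : 0 < s <= 1 by exact: div_steps.
have /andP[s0 _] := s01.
have -> : t = N%:R * s by rewrite /s mulrCA divff ?mulr1// gt_eqF// steps_gt0.
clearbody s; elim: N => [|k IH] /=.
  by rewrite mul0r; apply: filterS2 fg (S20 g) => x h1 h2 _; rewrite h1// h2.
have e : k.+1%:R * s = s + k%:R * s by rewrite mulrS mulrDl mul1r.
have ks0 : 0 <= k%:R * s by rewrite mulr_ge0// ltW.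
have h1 := S2D s (k%:R * s) (ltW s0) ks0 g.
have h2 := S2K (S2 (k%:R * s) g) s0.
rewrite e; apply: filterS2 h1 h2 => x h1 [_ h2] _; rewrite h1// h2//.
rewrite (kernel_LwE htheta hdelta hgauss c0 s01 C0 (hK s01)).
exact: kernel_op_ae (hK s01) _ _ IH.
Qed.

Lemma core_bounded_toL2 (g : Lw) : core_bounded O g ->
  (g : V -> R) = to_Lfun nu (lee1n 2) g %[ae nu].
Proof.
by move=> gb; apply: aeW => x _; rewrite to_LfunE//; exact: core_bounded_L2.
Qed.

Lemma ae_weighted (f g : V -> R) : f = g %[ae nu] -> f = g %[ae mu].
Proof. by move=> /weighted_ae. Qed.

Lemma weighted_semigroupD s t (f : Lw) : 0 <= s -> 0 <= t ->
  (S (s + t) f : V -> R) = S s (S t f) %[ae mu].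
Proof.
move=> s0 t0; have [_ _ S2D _] := hS2.
apply: (@bounded_linear_dense_eq _ _ _ mu p p1 (fun g => core_bounded O g)
  (S (s + t)) (S s \o S t)).
- by move=> g e e0; exact: core_bounded_dense.
- exact: weighted_semigroup_bounded.
- by apply: bounded_linear_comp; exact: weighted_semigroup_bounded.
move=> g gb; apply: ae_weighted.
have h0 := core_bounded_toL2 gb; set g2 := to_Lfun _ _ _ in h0.
have h1 := weighted_semigroup_L2 (addr_ge0 s0 t0) h0.
have h2 := weighted_semigroup_L2 s0 (weighted_semigroup_L2 t0 h0).
apply: filterS (filterI (filterI h1 h2) (S2D s t s0 t0 g2)) => x [[{}h1 {}h2] h3] _ /=.
by rewrite h1// h2// h3.
Qed.

Lemma weighted_semigroup_uniform : exists2 D : R, 0 < D &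
  forall t f, 0 < t <= 1 -> (N[S t f] <= D%:E * N[f])%E.
Proof.
have [D D0 hD] := kernel_Lw_bound p1 htheta hdelta hgauss c0.
exists (C * D) => [|t f t01]; first exact: mulr_gt0.
by rewrite weighted_semigroup01//; have [] := hD t C (K t) f t01 C0 (hK t01).
Qed.

(* On a ball |u|^p is compared with e^p + a u^2, to use strong continuity in L^2; outside
   of it g vanishes and S t g is a Gaussian tail of order t. *)
Lemma semigroup_increment_le (g : Lw) k M : (forall y, `|g y| <= M) ->
  (forall y, ~ core O k y -> g y = 0) -> exists2 a : R, 0 <= a &
  forall t e x, 0 < t <= 1 -> 0 < e -> O x ->
  ((`|S t g x - g x| `^ p)%:E <=
    (e `^ p * \1_[set y | enorm y <= n.+1%:R * k.+1%:R + 1] x)%:E +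
    ((((C + 1) * M) `^ p / e ^+ 2) * (S t g x - g x) ^+ 2)%:E +
    (a * t)%:E * mass O (2 * (c * t)) g x)%E.
Proof.
move=> gM gk; have M0 : 0 <= M by exact: le_trans (gM 0).
have p1' : 1 <= p by rewrite -lee_fin.
(* C M bounds [S t g], since the Gaussian has mass at most 1, and M bounds g. *)
set M' := (C + 1) * M; have M'0 : 0 <= M' by rewrite mulr_ge0// addr_ge0// ltW.
pose kap := 2 `^ (n%:R / 2) * (4 * c).
have kap0 : 0 <= kap by rewrite mulr_ge0 ?powR_ge0// mulr_ge0// ltW.
pose a := M' `^ (p - 1) * (C * kap).
have a0 : 0 <= a by rewrite !mulr_ge0 ?powR_ge0// ltW.
exists a => // t e x t01 e0 Ox; have /andP[t0 _] := t01.
set u := S t g x - g x; set r := n.+1%:R * k.+1%:R.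
have Stg : S t g x = kernel_op O (K t) g x.
  by rewrite weighted_semigroup01// (kernel_LwE htheta hdelta hgauss c0 t01 C0 (hK t01)).
have Sle : (`|S t g x|%:E <= C%:E * heat_bound O c t g x)%E.
  by rewrite Stg; exact: kernel_op_le (hK t01) C0 _ Ox.
have SM : `|S t g x| <= C * M.
  rewrite -lee_fin (le_trans Sle)// EFinM lee_wpmul2l ?lee_fin ?(ltW C0)//.
  exact: heat_bound_bounded.
have uM : `|u| <= M'.
  by rewrite (le_trans (ler_normB _ _))// /M' mulrDl mul1r lerD.
have mass0 : (0 <= (a * t)%:E * mass O (2 * (c * t)) g x)%E.
  by rewrite mule_ge0 ?mass_ge0// lee_fin mulr_ge0// ltW.
have [xr|xr] := leP (enorm x) (r + 1).
  rewrite indicE mem_set// mulr1 -[leLHS]adde0; apply: leeD => //.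
  rewrite -EFinD lee_fin -[u ^+ 2]real_normK ?num_real//.
  by apply: powR_le_sqr => //; rewrite normr_ge0 uM.
have gx : g x = 0.
  apply: gk => -[_ _ xk]; move: xr; apply/negP; rewrite -leNgt.
  rewrite (le_trans (enorm_le_norm _))// (le_trans (ler_wpM2l _ xk))//.
  by rewrite lerDl.
apply: (@le_trans _ _ ((a * t)%:E * mass O (2 * (c * t)) g x)%E); last first.
  rewrite -[leLHS]add0e; apply: leeD => //.
  rewrite -EFinD lee_fin addr_ge0//.
    by rewrite mulr_ge0 ?powR_ge0// indicE.
  by rewrite mulr_ge0 ?sqr_ge0// divr_ge0 ?powR_ge0 ?sqr_ge0.
have far : (heat_bound O c t g x <= (kap * t)%:E * mass O (2 * (c * t)) g x)%E.
  have -> : kap * t = 2 `^ (n%:R / 2) * (4 * (c * t)) by rewrite /kap !mulrA.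
  apply: (@heat_bound_far _ _ _ _ _ r) => //; last exact: ltW.
  move=> y gy; have [_ _ yk] : core O k y.
    by apply: contrapT => nk; move: gy; rewrite gk// eqxx.
  by rewrite (le_trans (enorm_le_norm _))// (le_trans (ler_wpM2l _ yk)).
have uE : u = S t g x by rewrite /u gx subr0.
(* Far away, one factor |u| of |u|^p has the Gaussian tail of order t, and the remaining |u|^(p - 1)
   is bounded through M'. *)
rewrite -(mulr_powRB1 (normr_ge0 u) (lt_le_trans ltr01 p1')) mulrC EFinM.
apply: (@le_trans _ _ ((M' `^ (p - 1))%:E * (C%:E * heat_bound O c t g x))%E).
  apply: lee_pmul; rewrite ?lee_fin ?powR_ge0//; last by rewrite uE.
  by apply: ge0_ler_powR; rewrite // ?nnegrE// subr_ge0.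
rewrite -[a * t]mulrA EFinM -muleA lee_wpmul2l ?lee_fin ?powR_ge0//.
rewrite -mulrA EFinM -muleA lee_wpmul2l ?lee_fin ?(ltW C0)//.
Qed.

(** The order of quantifiers matters: [k] does not depend on e, whereas [a] contains a multiple of 1
    / e^2. First e is fixed, then t tends to 0. *)
Lemma integral_semigroup_increment (g : Lw) : core_bounded O g ->
  exists2 k : R, 0 <= k & forall e : R, 0 < e -> exists2 a : R, 0 <= a &
  forall t, 0 < t <= 1 ->
    (\int[nu]_x (`|S t g x - g x| `^ p)%:E <= (k * e `^ p)%:E +
      a%:E * (\int[nu]_x ((S t g x - g x) ^+ 2)%:E + t%:E))%E.
Proof.
move=> gb; have [k [M [gM gk]]] := gb.
have M0 : 0 <= M by exact: le_trans (gM 0).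
have [a a0 ha] := semigroup_increment_le gM gk.
set B := [set y : V | _] in ha.
have mB : measurable B by exact: measurable_enorm_le.
have B_lty : (nu B < +oo)%E.
  apply: (le_lt_trans _ (@lebesgue_rV_bounded_lty R n (n.+1%:R * k.+1%:R + 1))).
  rewrite /lebesgue_on /mrestr le_measure ?inE//.
  by apply: measurableI => //; exact: measurable_domain.
have BE : nu B = (fine (nu B))%:E by rewrite fineK// ge0_fin_numE.
have I1 : (\int[nu]_y `|g y|%:E < +oo)%E.
  have := core_bounded_pow_lty ltr01 (@measurable_funPT _ _ _ _ g) gb.
  by under eq_integral do rewrite powRr1//.
set J := (\int[nu]_y `|g y|%:E)%E in I1.
have J0 : (0 <= J)%E by apply: integral_ge0 => y _; rewrite lee_fin.
have JE : J = (fine J)%:E by rewrite fineK// ge0_fin_numE.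
exists (fine (nu B)); first by rewrite fine_ge0.
move=> e e0; set M' := (C + 1) * M in ha *.
have M'0 : 0 <= M' by rewrite mulr_ge0// addr_ge0// ltW.
pose b := M' `^ p / e ^+ 2.
have b0 : 0 <= b by rewrite divr_ge0 ?powR_ge0 ?sqr_ge0.
have aJ : 0 <= a * fine J by rewrite mulr_ge0 ?fine_ge0.
exists (b + a * fine J); first exact: addr_ge0.
move=> t t01; have /andP[t0 _] := t01.
pose u x := S t g x - g x.
have mu2 : measurable_fun setT (fun x => (u x ^+ 2)%:E).
  by apply/measurable_EFinP; apply: measurable_funX; exact: measurable_funB.
have m1 : measurable_fun setT (fun x : V => (e `^ p * \1_B x)%:E).
  by apply/measurable_EFinP; apply: measurable_funM => //; exact: measurable_indic.
have m2 : measurable_fun setT (fun x => (b * u x ^+ 2)%:E).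
  by apply/measurable_EFinP; apply: measurable_funM => //; exact/measurable_EFinP.
have m3 : measurable_fun setT (fun x => (a * t)%:E * mass O (2 * (c * t)) g x)%E.
  by apply: emeasurable_funM => //; exact: measurable_mass.
have p1x x : (0 <= (e `^ p * \1_B x)%:E)%E.
  by rewrite lee_fin mulr_ge0 ?powR_ge0// indicE.
have p2x x : (0 <= (b * u x ^+ 2)%:E)%E by rewrite lee_fin mulr_ge0 ?sqr_ge0.
have p3x x : (0 <= (a * t)%:E * mass O (2 * (c * t)) g x)%E.
  by rewrite mule_ge0 ?mass_ge0// lee_fin mulr_ge0// ltW.
apply: (@le_trans _ _ (\int[nu]_x ((e `^ p * \1_B x)%:E + (b * u x ^+ 2)%:E +
    (a * t)%:E * mass O (2 * (c * t)) g x))%E).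
  apply: ae_ge0_le_integral => //.
  - by apply/measurable_EFinP; apply: (@measurable_powR_norm _ _ p u); exact: measurable_funB.
  - by move=> x _; rewrite !adde_ge0.
  - by apply: emeasurable_funD => //; exact: emeasurable_funD.
  - by apply: filterS (ae_in_domain O) => x Ox _; exact: ha.
rewrite ge0_integralD//; last 2 first.
- by move=> x _; rewrite adde_ge0.
- exact: emeasurable_funD.
rewrite ge0_integralD// -addeA; apply: leeD.
  under eq_integral do rewrite EFinM.
  rewrite ge0_integralZl_EFin ?powR_ge0//; last first.
    by apply/measurable_EFinP; exact: measurable_indic.
  by rewrite integral_indic// setIT muleC EFinM -BE.
have i2 : (\int[nu]_x (b * u x ^+ 2)%:E = b%:E * \int[nu]_x (u x ^+ 2)%:E)%E.
  under eq_integral do rewrite EFinM.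
  by rewrite ge0_integralZl_EFin// => x _; rewrite lee_fin sqr_ge0.
have i3 : (\int[nu]_x ((a * t)%:E * mass O (2 * (c * t)) g x) <=
    (a * fine J)%:E * t%:E)%E.
  rewrite ge0_integralZl_EFin//; last 3 first.
  - by move=> x _; exact: mass_ge0.
  - exact: measurable_mass.
  - by rewrite mulr_ge0// ltW.
  have -> : ((a * fine J)%:E * t%:E = (a * t)%:E * J)%E.
    by rewrite [X in (_ = _ * X)%E]JE -!EFinM mulrAC.
  rewrite lee_wpmul2l ?lee_fin ?mulr_ge0 ?(ltW t0)//.
  by apply: integral_mass_le; rewrite // !mulr_gt0.
have u0 : (0 <= \int[nu]_x (u x ^+ 2)%:E)%E.
  by apply: integral_ge0 => x _; rewrite lee_fin sqr_ge0.
have t0E : (0 <= t%:E :> \bar R)%E by rewrite lee_fin ltW.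
rewrite i2 (ge0_muleDr _ u0 t0E).
apply: leeD.
  by rewrite lee_wpmul2r ?lee_fin// lerDl.
apply: (le_trans i3); rewrite lee_wpmul2r ?lee_fin ?(ltW t0)//.
by rewrite lerDr.
Qed.

Lemma weighted_semigroup_cvg_core (g : Lw) : core_bounded O g ->
  N[(S t g - g : Lw)] @[t --> 0^'+] --> 0%E.
Proof.
move=> gb; have p1' : 1 <= p by rewrite -lee_fin.
have p0 : 0 < p by exact: lt_le_trans p1'.
have [k k0 hk] := integral_semigroup_increment gb.
apply: cvge0_of_le => [t|e e0]; first exact: Lnorm_ge0.
(* q makes k (e q)^p at most e^p / 3, and d below makes a (d + d) at most 2 e^p / 3. The additions
   of 1 cover k = 0 and a = 0. *)
pose q := (3 * (k + 1))^-1 `^ p^-1.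
have k1 : 0 < 3 * (k + 1) by rewrite mulr_gt0// ltr_wpDl.
have q0 : 0 < q by rewrite powR_gt0// invr_gt0.
have qp : q `^ p = (3 * (k + 1))^-1 by rewrite -powRrM mulVf ?gt_eqF// powRr1// invr_ge0 ltW.
have [a a0 ha] := hk _ (mulr_gt0 e0 q0).
have ep : 0 < e `^ p by rewrite powR_gt0.
pose d := e `^ p / (3 * (a + 1)).
have d0 : 0 < d by rewrite divr_gt0// mulr_gt0// ltr_wpDl.
have h0 := core_bounded_toL2 gb; set g2 := to_Lfun _ _ _ in h0.
have [_ _ _ cS2] := hS2.
have d0' : (0 < (Num.sqrt d)%:E)%E by rewrite lte_fin sqrtr_gt0.
have near1 : \forall t \near 0^'+,
    ('N[nu]_2%:E[EFin \o (S2 t g2 - g2)%R] < (Num.sqrt d)%:E)%E.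
  exact: (cS2 g2 _ (open_ereal_lt' d0')).
have near2 : \forall t \near (0 : R)^'+, 0 < t <= 1 /\ t <= d.
  near=> t; split; last by near: t; exact: nbhs_right_le.
  apply/andP; split; first by near: t; exact: nbhs_right_gt.
  by near: t; apply: nbhs_right_le; exact: ltr01.
apply: filterS2 near1 near2 => t h1 [t01 td]; have /andP[t0 _] := t01.
have h2 := weighted_semigroup_L2 (ltW t0) h0.
have sq : (\int[nu]_x ((S t g x - g x) ^+ 2)%:E <= d%:E)%E.
  apply: (le_trans _ (ltW (integral_sqr_lt d0 h1))).
  rewrite le_eqVlt; apply/orP; left; apply/eqP; apply: ae_eq_integral => //.
  - by apply/measurable_EFinP; apply: measurable_funX; exact: measurable_funB.
  - by apply/measurable_EFinP; apply: measurable_funX.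
  by apply: filterS2 h0 h2 => x e1 e2 _ /=; rewrite e1// e2.
apply: (Lnorm_le_real p1); first exact: ltW.
have mS : measurable_fun setT (S t g - g : Lw) by [].
rewrite weighted_powE//.
(* The weight is at most 1, so that the unweighted integral suffices. *)
apply: (@le_trans _ _ (\int[nu]_x (`|S t g x - g x| `^ p)%:E)%E).
  apply: ge0_le_integral => //.
  - by move=> x _; rewrite lee_fin mulr_ge0 ?powR_ge0 ?weight_ge0.
  - by apply/measurable_EFinP; exact: measurable_powR_weight.
  - by apply/measurable_EFinP; exact: measurable_powR_norm.
  - by move=> x _; rewrite lee_fin ler_piMr ?powR_ge0// weight_le1.
apply: (le_trans (ha t t01)).
have -> : k * (e * q) `^ p = k * e `^ p / (3 * (k + 1)).
  by rewrite powRM ?(ltW e0) ?(ltW q0)// qp mulrA.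
apply: (@le_trans _ _ ((k * e `^ p / (3 * (k + 1)))%:E + a%:E * (d%:E + d%:E))%E).
  apply: leeD => //; rewrite lee_wpmul2l ?lee_fin//.
  by apply: leeD => //; rewrite lee_fin.
rewrite -(EFinD d d) -(EFinM a) -EFinD lee_fin /d.
have r1 : k * e `^ p / (3 * (k + 1)) <= e `^ p / 3.
  rewrite ler_pdivrMr// mulrAC ler_pdivlMr//.
  by nra.
have r2 : a * (e `^ p / (3 * (a + 1)) + e `^ p / (3 * (a + 1))) <= 2 * (e `^ p / 3).
  have -> : a * (e `^ p / (3 * (a + 1)) + e `^ p / (3 * (a + 1))) =
    (2 * (e `^ p / 3)) * (a / (a + 1)).
    by field; rewrite gt_eqF// ltr_wpDl.
  rewrite ler_piMr//; first by rewrite mulr_ge0// divr_ge0// ltW.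
  by rewrite ler_pdivrMr ?ltr_wpDl// mul1r lerDl.
apply: (le_trans (lerD r1 r2)); lra.
Unshelve. all: by end_near. Qed.

Lemma weighted_semigroup_cvg (f : Lw) : N[(S t f - f : Lw)] @[t --> 0^'+] --> 0%E.
Proof.
have [D D0 hD] := weighted_semigroup_uniform.
apply: cvge0_of_le => [t|e e0]; first exact: Lnorm_ge0.
(* S t f - f is split into S t (f - g), S t g - g and -(f - g), which cost D e', e' and e'. *)
pose e' := e / (D + 2).
have D2 : 0 < D + 2 by rewrite addr_gt0.
have e'0 : 0 < e' by rewrite divr_gt0.
have [g gb fg] := core_bounded_dense hdelta f e'0.
have cg := weighted_semigroup_cvg_core gb.
have e'E : (0 < e'%:E)%E by rewrite lte_fin.
have near1 : \forall t \near 0^'+, (N[(S t g - g : Lw)] < e'%:E)%E.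
  exact: (cg _ (open_ereal_lt' e'E)).
have near2 : \forall t \near (0 : R)^'+, 0 < t <= 1.
  near=> t; apply/andP; split; first by near: t; exact: nbhs_right_gt.
  by near: t; apply: nbhs_right_le; exact: ltr01.
apply: filterS2 near1 near2 => t h1 h2.
have bS := weighted_semigroup_bounded t.
have -> : N[(S t f - f : Lw)] =
    N[fun x => S t (f - g) x + ((S t g - g : Lw) x + (- (f - g : Lw)) x)].
  apply: Lnorm_ae => //.
    by apply: measurable_funD => //; exact: measurable_funD.
  apply: filterS (bounded_linear_sub f g bS) => x h _.
  transitivity (S t f x - f x); first by [].
  transitivity (S t (f - g) x + ((S t g x - g x) - (f x - g x))); last by [].
  rewrite h//; transitivity (S t f x - S t g x + ((S t g x - g x) - (f x - g x))); last by [].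
  by ring.
pose g1 x := (S t g - g : Lw) x + (- (f - g : Lw)) x.
have mg1 : measurable_fun setT g1 by exact: measurable_funD.
apply: (le_trans (@LnormD_le _ _ _ mu p p1 (S t (f - g)) g1 _ mg1)) => //.
apply: (@le_trans _ _ ((D * e')%:E + (e'%:E + e'%:E))%E).
  apply: leeD.
    by rewrite (le_trans (hD t _ h2))// EFinM lee_wpmul2l ?lee_fin ?(ltW D0).
  apply: (le_trans (@LnormD_le _ _ _ mu p p1 (S t g - g : Lw) (- (f - g : Lw)) _ _)) => //.
  apply: leeD; first exact: ltW.
  have -> : N[- (f - g : Lw)] = N[(f - g : Lw)] by rewrite -[RHS]oppe_Lnorm.
  exact: fg.
rewrite -!EFinD lee_fin; have -> : D * e' + (e' + e') = (D + 2) * e' by ring.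
by rewrite /e' mulrC divfK ?gt_eqF.
Unshelve. all: by end_near. Qed.

(** A bounded kernel stays bounded when composed with one whose rows have mass at most C.
    Boundedness is what lets the iterate be evaluated on every integrable f. At least one step is
    needed, as the identity has no kernel. *)
Lemma iter_kernel_Lw s j : 0 < s <= 1 -> exists (H : V -> V -> R) (M : R),
  [/\ measurable_fun setT (fun xy : V * V => H xy.1 xy.2),
      forall x y, `|H x y| <= M &
      forall f : Lw, nu.-integrable setT (EFin \o f) ->
        iter j.+1 (kernel_Lw (K s)) f = kernel_op O H f :> (V -> R)].
Proof.
move=> s01; have /andP[s0 _] := s01; have hKs := hK s01.
set A := truncated_kernel O c C s (K s).
have mA := measurable_truncated_kernel hKs.
have KA (f : Lw) : kernel_Lw (K s) f = kernel_op O A f :> (V -> R).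
  rewrite (kernel_LwE htheta hdelta hgauss c0 s01 C0 hKs).
  by apply/funext => x; exact: (truncated_kernel_op hKs).
elim: j => [|j [H [M [mH HM IH]]]].
  have [M HM] := truncated_kernel_bounded O (K s) c0 C0 s0.
  by exists A, M; split => // f _; rewrite -KA.
exists (kernel_comp nu A H), (C * M); split.
- exact: measurable_kernel_comp.
- move=> x y; apply: kernel_comp_le => //.
  by move=> z; exact: (integral_truncated_kernel_le c0 C0 s0 hKs).
move=> f fi; rewrite iterS KA IH//; apply/funext => x; rewrite /kernel_op.
apply: (@kernel_comp_op _ _ _ nu A H C M) => //.
by move=> z; exact: (integral_truncated_kernel_le c0 C0 s0 hKs).
Qed.

Lemma weighted_semigroup_iter t : 0 < t -> exists (H : V -> V -> R) (M : R),
  [/\ measurable_fun setT (fun xy : V * V => H xy.1 xy.2),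
      forall x y, `|H x y| <= M &
      forall f : Lw, nu.-integrable setT (EFin \o f) ->
        S t f = kernel_op O H f :> (V -> R)].
Proof.
move=> t0; have [H [M [mH HM HS]]] := iter_kernel_Lw (steps t).-1 (div_steps t0).
have st : (0 < steps t)%N by have := steps_gt0 t; rewrite ltr0n.
exists H, M; split => // f fi; rewrite -HS// (prednK st).
by rewrite /S leNgt t0.
Qed.

Lemma core_bounded_integrable (f : V -> R) : measurable_fun setT f ->
  core_bounded O f -> nu.-integrable setT (EFin \o f).
Proof.
move=> mf fb; apply/integrableP; split; first exact/measurable_EFinP.
have := core_bounded_pow_lty ltr01 mf fb.
by under eq_integral do rewrite powRr1//.
Qed.

(* For t > 1 nothing is known about [K t] beyond its action on L^2; it is identified with
   the bounded iterated kernel [H] by testing on countably many indicators. *)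
Lemma semigroup_kernel_ae t (H : V -> V -> R) M : 0 < t ->
  measurable_fun setT (fun xy : V * V => H xy.1 xy.2) ->
  (forall x y, `|H x y| <= M) ->
  (forall f : Lw, nu.-integrable setT (EFin \o f) -> S t f = kernel_op O H f :> (V -> R)) ->
  {ae nu, forall x, {ae nu, forall y, K t x y = H x y}}.
Proof.
move=> t0 mH HM HS.
(* These indicators belong to both L^2 and the weighted space, so that [K t], known through [S2],
   and [H], known through [S], can be compared on them. *)
pose phi k (B : set V) : V -> R := \1_(core O k `&` B).
have mphi k B : measurable B -> measurable_fun setT (phi k B).
  by move=> mB; apply: measurable_indic; apply: measurableI => //; exact: measurable_core.
have bphi k B : core_bounded O (phi k B).
  exists k, 1; split => y; first by rewrite /phi indicE ger0_norm// lern1 leq_b1.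
  by move=> nk; rewrite /phi indicE memNset// => -[].
have key k B : measurable B -> {ae nu, forall x,
    nu.-integrable setT (EFin \o (fun y => K t x y * phi k B y)) /\
    kernel_op O (K t) (phi k B) x = kernel_op O H (phi k B) x}.
  move=> mB; have mp := mphi k B mB; have bp := bphi k B.
  have pL := core_bounded_Lw theta p1 hdelta mp bp; have p2 := core_bounded_L2 mp bp.
  have e : (to_Lfun mu p1 (phi k B) : V -> R) = to_Lfun nu (lee1n 2) (phi k B) %[ae nu].
    by apply: aeW => x _; rewrite !to_LfunE.
  have h1 := weighted_semigroup_L2 (ltW t0) e.
  have h2 := S2K (to_Lfun nu (lee1n 2) (phi k B)) t0.
  have h3 := HS (to_Lfun mu p1 (phi k B)).
  rewrite !to_LfunE// in h1 h2 h3.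
  apply: filterS2 h1 h2 => x {}h1 [h2 h4]; split => //.
  by rewrite -h4 -h1// h3//; exact: core_bounded_integrable.
have hT : {ae nu, forall x k, nu.-integrable setT (EFin \o (fun y => K t x y * phi k setT y)) /\
    kernel_op O (K t) (phi k setT) x = kernel_op O H (phi k setT) x}.
  by apply: ae_forall_countable => k; exact: key.
have hB : {ae nu, forall x (i : nat * ('rV[rat]_n * 'rV[rat]_n)),
    kernel_op O (K t) (phi i.1 (rational_box i.2.1 i.2.2)) x =
    kernel_op O H (phi i.1 (rational_box i.2.1 i.2.2)) x}.
  apply: ae_forall_countable => -[k [q r]]/=.
  by apply: filterS (key k _ (measurable_rational_box q r)) => x [].
apply: filterS2 hT hB => x hT hB.
have mKx : measurable_fun setT (K t x) by exact: measurable_kernel_row (mK t0).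
have mHx : measurable_fun setT (H x) by exact: measurable_kernel_row mH.
have H1 : {ae nu, forall y k, (K t x y - H x y) * phi k setT y = 0}.
  apply: ae_forall_countable => k.
  have [iK eK] := hT k.
  have iH : nu.-integrable setT (EFin \o (fun y => H x y * phi k setT y)).
    apply: integrable_bounded_mul => //.
    apply: core_bounded_integrable; first exact: mphi.
    exact: bphi.
  have E : EFin \o (fun y => (K t x y - H x y) * phi k setT y) =
      ((EFin \o (fun y => (K t x y * phi k setT y)%R)) \-
       (EFin \o (fun y => (H x y * phi k setT y)%R)))%E.
    by apply/funext => y /=; rewrite mulrBl.
  have iD : nu.-integrable setT (EFin \o (fun y => (K t x y - H x y) * phi k setT y)).
    by rewrite E; exact: integrableB.
  have zero B : measurable B ->
      kernel_op O (K t) (phi k B) x = kernel_op O H (phi k B) x ->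
      (\int[nu]_(y in B) ((K t x y - H x y) * phi k setT y)%:E = 0)%E.
    move=> mB eB; rewrite integral_mkcond.
    have iKB : nu.-integrable setT (EFin \o (fun y => K t x y * phi k B y)).
      apply: (le_integrable measurableT _ _ iK).
        by apply/measurable_EFinP; apply: measurable_funM => //; exact: mphi.
      move=> y _ /=; rewrite lee_fin !normrM ler_wpM2l// /phi !indicE.
      have [yB|] := boolP (y \in core O k `&` B); last by rewrite normr0.
      by rewrite setIT mem_set//; move: yB; rewrite inE => -[].
    have iHB : nu.-integrable setT (EFin \o (fun y => H x y * phi k B y)).
      apply: integrable_bounded_mul => //.
      apply: core_bounded_integrable; first exact: mphi.
      exact: bphi.
    transitivity (\int[nu]_y ((K t x y * phi k B y)%:E - (H x y * phi k B y)%:E))%E.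
      apply: eq_integral => y _; rewrite patchE /phi !indicE setIT -EFinB -mulrBl in_setI.
      by case: ifPn => yB; rewrite ?andbT ?andbF ?mulr0.
    rewrite integralB_EFin//.
    move: eB; rewrite /kernel_op /Rintegral => eB.
    rewrite -[X in (X - _)%E]fineK; last exact: integrable_fin_num iKB.
    rewrite -[X in (_ - X)%E]fineK; last exact: integrable_fin_num iHB.
    by rewrite eB -EFinB subrr.
  apply: ae_eq0_of_box_integral => //; first exact: zero.
  move=> q r; apply: zero; first exact: measurable_rational_box.
  exact: (hB (k, (q, r))).
apply: filterS2 H1 (ae_in_domain O) => y hy Oy.
have [N _ /(_ N (leqnn N)) cN] := core_near Oy.
have := hy N; rewrite /phi indicE setIT mem_set// mulr1 => /eqP.
by rewrite subr_eq0 => /eqP.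
Qed.

(** f need not be square integrable, so the formula cannot be read off from L^2. Once K t x agrees
    almost everywhere with the bounded function H x, integrability of f suffices for both
    assertions. *)
Lemma weighted_semigroup_kernel t (f : Lw) : 0 < t -> nu.-integrable setT (EFin \o f) ->
  {ae nu, forall x, nu.-integrable setT (EFin \o (fun y => K t x y * f y)) /\
    S t f x = kernel_op O (K t) f x}.
Proof.
move=> t0 fi; have [H [M [mH HM HS]]] := weighted_semigroup_iter t0.
apply: filterS (semigroup_kernel_ae t0 mH HM HS) => x KH.
have mKx : measurable_fun setT (K t x) by exact: measurable_kernel_row (mK t0).
have mHx : measurable_fun setT (H x) by exact: measurable_kernel_row mH.
have iH : nu.-integrable setT (EFin \o (fun y => H x y * f y)).
  exact: integrable_bounded_mul.
have mKf : measurable_fun setT (EFin \o (fun y => K t x y * f y)).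
  by apply/measurable_EFinP; exact: measurable_funM.
have E : ae_eq nu setT (EFin \o (fun y => K t x y * f y)) (EFin \o (fun y => H x y * f y)).
  by apply: filterS KH => y h _ /=; rewrite h.
split; last first.
  rewrite HS// /kernel_op /Rintegral; congr fine; apply: ae_eq_integral => //.
  - exact: measurable_int iH.
  - exact: ae_eq_sym.
apply/integrableP; split => //; have /integrableP[_] := iH.
rewrite (ae_eq_integral (abse \o (EFin \o (fun y => K t x y * f y))))//.
- by apply: measurableT_comp => //; exact: measurable_int iH.
- by apply: measurableT_comp.
- by apply: ae_eq_abse; exact: ae_eq_sym.
Qed.

(** On the core containing the support the weight is at least w0 > 0, and |f| <= 1 + |f|^p since p
    >= 1. *)
Lemma compactly_supported_integrable (f : Lw) : compactly_supported O f ->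
  nu.-integrable setT (EFin \o f).
Proof.
move=> [Ks [cKs KsO Ks0]]; have [k Kk] := compact_core_sub cKs KsO.
have p1' : 1 <= p by rewrite -lee_fin.
have th0 : 0 <= theta by have /andP[] := htheta.
pose r : R := n.+1%:R * k.+1%:R.
pose w0 := Num.min ((k.+1%:R^-1 : R) `^ theta) ((1 + r ^+ 2) `^ (- delta)).
have w00 : 0 < w0.
  by rewrite lt_min !powR_gt0 ?invr_gt0// ltr_wpDr// sqr_ge0.
have w0w y : core O k y -> w0 <= weight O theta delta y.
  move=> [Oy ky yk]; rewrite /weight le_min !ge_min; apply/andP; split; apply/orP.
    left; apply: ge0_ler_powR; rewrite // ?nnegrE ?invr_ge0//.
    by rewrite ltW// domain_dist_gt0.
  right; rewrite !powRN lef_pV2 ?posrE ?powR_gt0 ?ltr_wpDr ?sqr_ge0//.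
  apply: ge0_ler_powR; rewrite // ?nnegrE ?addr_ge0 ?sqr_ge0// lerD2l.
  rewrite ler_sqr ?nnegrE ?enorm_ge0 ?mulr_ge0//.
  by rewrite (le_trans (enorm_le_norm _))// ler_wpM2l.
have fle y : O y -> `|f y| <= \1_(core O k) y + w0^-1 * (`|f y| `^ p * weight O theta delta y).
  move=> Oy; have wf0 : 0 <= w0^-1 * (`|f y| `^ p * weight O theta delta y).
    by rewrite mulr_ge0 ?invr_ge0 ?(ltW w00)// mulr_ge0 ?powR_ge0 ?weight_ge0.
  have [ky|nky] := pselect (core O k y); last first.
    apply: (@le_trans _ _ 0); last by rewrite addr_ge0// indicE.
    by rewrite Ks0 ?normr0// => /Kk.
  rewrite indicE mem_set//.
  have [f1|f1] := leP `|f y| 1; first by rewrite (le_trans f1)// lerDl.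
  apply: (@le_trans _ _ (`|f y| `^ p)).
    by rewrite -[leLHS]powRr1//; apply: ler_powR => //; exact: ltW.
  rewrite -[leLHS]add0r lerD// mulrCA ler_peMr ?powR_ge0//.
  by rewrite mulrC ler_pdivlMr// mul1r w0w.
apply/integrableP; split; first exact/measurable_EFinP.
have m1 : measurable_fun setT (fun y : V => (\1_(core O k) y : R)%:E).
  by apply/measurable_EFinP; apply: measurable_indic; exact: measurable_core.
have m2 : measurable_fun setT (fun y => (`|f y| `^ p * weight O theta delta y)%:E).
  by apply/measurable_EFinP; exact: measurable_powR_weight.
apply: (@le_lt_trans _ _ (\int[nu]_y ((\1_(core O k) y)%:E +
    (w0^-1)%:E * (`|f y| `^ p * weight O theta delta y)%:E))%E).
  apply: ae_ge0_le_integral => //.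
  - by apply: measurableT_comp => //; exact/measurable_EFinP.
  - move=> y _; rewrite -EFinM -EFinD lee_fin addr_ge0 ?indicE//.
    by rewrite mulr_ge0 ?invr_ge0 ?(ltW w00)// mulr_ge0 ?powR_ge0 ?weight_ge0.
  - by apply: emeasurable_funD => //; apply: emeasurable_funM.
  - apply: filterS (ae_in_domain O) => y Oy _ /=.
    by rewrite -EFinM -EFinD lee_fin; exact: fle.
rewrite ge0_integralD//; last 2 first.
- move=> y _; rewrite -EFinM lee_fin.
  by rewrite mulr_ge0 ?invr_ge0 ?(ltW w00)// mulr_ge0 ?powR_ge0 ?weight_ge0.
- exact: emeasurable_funM.
rewrite integral_indic ?setIT//; last exact: measurable_core.
rewrite lte_add_pinfty//; first exact: core_lty.
rewrite ge0_integralZl_EFin ?invr_ge0 ?(ltW w00)//; last first.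
  by move=> y _; rewrite lee_fin mulr_ge0 ?powR_ge0 ?weight_ge0.
by rewrite lte_mul_pinfty ?lee_fin ?invr_ge0 ?(ltW w00)//; exact: Lw_pow_lty.
Qed.

Lemma weighted_semigroup_unique t (A : Lw -> Lw) : 0 < t -> bounded_linear A ->
  (forall g : Lw, core_bounded O g -> (A g : V -> R) = kernel_op O (K t) g %[ae nu]) ->
  forall f, (A f : V -> R) = S t f %[ae mu].
Proof.
move=> t0 bA hA; apply: (bounded_linear_dense_eq (P := fun g => core_bounded O g)) => //.
- by move=> g e e0; exact: core_bounded_dense.
- exact: weighted_semigroup_bounded.
move=> g gb; apply: ae_weighted.
have gi := core_bounded_integrable (@measurable_funPT _ _ _ _ g) gb.
by apply: filterS2 (hA g gb) (weighted_semigroup_kernel t0 gi) => x h1 [_ h2] _; rewrite h1// h2.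
Qed.

Section gradient.
Variables (cg B : R).
Hypotheses (cg0 : 0 < cg) (B0 : 0 < B).
Hypothesis dK : forall t x y, 0 < t <= 1 -> O x -> differentiable (K t ^~ y) x.
Hypothesis gK : forall t x y i, 0 < t <= 1 -> O x ->
  `|partial i (K t ^~ y) x| <=
  B / Num.sqrt t * (boundary_factor O t y * gaussian (cg * t) (x - y)).

Lemma measurable_shift (h : V) : measurable_fun setT (fun x : V => h + x).
Proof.
apply: measurable_fun_rV => i; under eq_fun do rewrite mxE.
apply: measurable_funD => //.
by apply: continuous_measurable_rV; exact: coord_continuous.
Qed.

(** Outside the domain the difference quotients need not converge, hence the indicator; inside, the
    sequence of [derive_harmonic] is used. *)
Lemma measurable_partial_in (u : V -> R) i : measurable_fun setT u ->
  (forall x, O x -> differentiable u x) ->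
  measurable_fun setT (fun x => \1_(O : set V) x * partial i u x).
Proof.
move=> mf du.
pose q (k : nat) x := \1_(O : set V) x *
  ((harmonic k)^-1 * (u (harmonic k *: delta_mx ord0 i + x) - u x)).
apply: (@measurable_fun_cvg _ _ _ _ q) => [k|x _].
  apply: measurable_funM; first by apply: measurable_indic; exact: measurable_domain.
  apply: measurable_funM => //; apply: measurable_funB => //.
  exact: (measurableT_comp mf (measurable_shift _)).
rewrite /q indicE; have [Ox|nOx] := boolP (x \in (O : set V)); last first.
  under eq_fun do rewrite mul0r.
  by rewrite mul0r; exact: cvg_cst.
under eq_fun do rewrite mul1r.
rewrite mul1r; apply: derive_harmonic; apply: diff_derivable; apply: du.
by rewrite inE in Ox.
Qed.

Lemma weighted_semigroup_gradient : exists2 D : R, 0 < D & forall t (f : Lw),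
  0 < t <= 1 ->
  (forall x, O x -> differentiable (S t f) x) /\
  forall i, exists2 v : Lw, forall x, O x -> v x = partial i (S t f) x &
    (N[v] <= (D / Num.sqrt t)%:E * N[f])%E.
Proof.
have [D D0 hD] := heat_dominated p1 htheta hdelta hgauss cg0.
exists (B * D) => [|t f t01]; first exact: mulr_gt0.
have /andP[t0 _] := t01.
have SE : S t f = kernel_op O (K t) f :> (V -> R).
  by rewrite weighted_semigroup01// (kernel_LwE htheta hdelta hgauss c0 t01 C0 (hK t01)).
have B'0 : 0 <= B / Num.sqrt t by rewrite divr_ge0 ?sqrtr_ge0// ltW.
have main x : O x -> differentiable (S t f) x /\
    forall i, (`|partial i (S t f) x|%:E <= (B / Num.sqrt t)%:E * heat_bound O cg t f x)%E.
  move=> Ox; rewrite SE; apply: (differentiable_kernel cg0 t0 B'0) => //.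
  - by move=> z y Oz; exact: dK.
  - by move=> z y i Oz; exact: gK.
  - apply: (heat_bound_lty p1 htheta hdelta hgauss) => //; first by rewrite mulr_gt0.
    exact: Lw_pow_lty.
  - by move=> z Oz; exact: (integrable_kernel_Lw htheta hdelta hgauss c0 t01 (hK t01)).
split => [x /main[]//|i].
pose v x := \1_(O : set V) x * partial i (S t f) x.
have vE x : O x -> v x = partial i (S t f) x.
  by move=> Ox; rewrite /v indicE mem_set// mul1r.
have mv : measurable_fun setT v.
  by apply: measurable_partial_in => // x /main[].
have [||vL vN] := hD t (B / Num.sqrt t) f v t01 B'0.
- exact: mv.
- by move=> x Ox; rewrite vE//; have [_] := main x Ox.
exists (to_Lfun mu p1 v) => [x Ox|]; first by rewrite to_LfunE// vE.
rewrite to_LfunE//; apply: (le_trans vN).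
by rewrite mulrAC.
Qed.

End gradient.

End semigroup.

(** * The Green kernel *)

Lemma near_eq_differentiable (R : realType) n (f g : 'rV[R]_n -> R) x :
  (\forall z \near x, f z = g z) -> differentiable f x -> differentiable g x.
Proof.
move=> fg df; have fgx := nbhs_singleton fg.
suff [] : differentiable g x /\ grad g x = grad f x by [].
apply: differentiable_of_le => e e0.
have /diff_locallyP[_ /eqaddoP/(_ e e0) H] := df.
have cs : (fun h => h + x) @ (0 : 'rV[R]_n) --> x.
  rewrite -[X in _ --> X]add0r.
  exact: (@cvgD _ _ _ (nbhs (0 : 'rV[R]_n)) _ id (cst x) 0 x cvg_id (cvg_cst x)).
have fg0 : \forall h \near (0 : 'rV[R]_n), f (h + x) = g (h + x) := cs _ fg.
apply: filterS2 H fg0 => h Hh fgh.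
by rewrite -fgh -fgx -diff_dot// -addrA -opprD.
Qed.

Section Green.
Context {R : realType} {n : nat}.
Variable O : domain R n.+1.
Local Notation V := 'rV[R]_n.+1.
Local Notation nu := (lebesgue_on O).
Variables (a : V -> 'M[R]_n.+1) (b : V -> V) (S2 : R -> L2 O -> L2 O).
Variables (G : R -> V -> V -> R) (B c : R).
Hypotheses (B0 : 0 < B) (c0 : 0 < c).
Hypothesis hS : Dirichlet_semigroup a b S2.
Hypothesis hG : Green_kernel S2 G.
Hypothesis hB : forall t x y, 0 < t <= 1 -> O x -> O y ->
  [/\ G t x y <= B * boundary_factor O t y * gaussian (c * t) (x - y),
      differentiable (fun x' => G t x' y) x &
      enorm (grad (fun x' => G t x' y) x) <=
        B * (boundary_factor O t y / Num.sqrt t) * gaussian (c * t) (x - y)].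

Let K t := domain_kernel O (G t).

Lemma measurable_Green t : 0 < t -> measurable_fun setT (fun xy : V * V => K t xy.1 xy.2).
Proof. by move=> t0; apply: measurable_domain_kernel; have [] := hG t0. Qed.

Lemma Green_L2 t (f : L2 O) : 0 < t -> {ae nu, forall x,
  nu.-integrable setT (EFin \o (fun y => K t x y * f y)) /\
  S2 t f x = kernel_op O (K t) f x}.
Proof.
move=> t0; have [mG hf] := hG t0.
exact: (kernel_integralP _ mG (@measurable_funPT _ _ _ _ f)).1 (hf f).
Qed.

Lemma Green_gradient t x y : 0 < t <= 1 -> O x ->
  differentiable (K t ^~ y) x /\ forall i, `|partial i (K t ^~ y) x| <=
    B / Num.sqrt t * (boundary_factor O t y * gaussian (c * t) (x - y)).
Proof.
move=> t01 Ox.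
have [Oy|nOy] := pselect (O y); last first.
  have -> : K t ^~ y = cst 0 by apply/funext => z; rewrite /K domain_kernel_outr.
  split => [|i]; first exact: differentiable_cst.
  rewrite /partial derive_cst normr0 mulr_ge0 ?divr_ge0 ?sqrtr_ge0 ?(ltW B0)//.
  by rewrite mulr_ge0 ?boundary_factor_ge0 ?gaussian_ge0.
have E : \forall z \near x, G t z y = K t z y.
  have : \forall z \near x, O z by have := domain_open O; rewrite openE => /(_ x Ox).
  by apply: filterS => z Oz; rewrite /K domain_kernel_in.
have [_ dG gG] := hB t01 Ox Oy.
split; first exact: near_eq_differentiable E dG.
move=> i; have -> : partial i (K t ^~ y) x = grad (fun x' => G t x' y) x ord0 i.
  rewrite mxE /partial; apply/esym; exact: near_eq_derive.
rewrite (le_trans (coord_le_enorm _ _))// (le_trans gG)//.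
by rewrite le_eqVlt; apply/orP; left; apply/eqP; ring.
Qed.

Lemma Green_heat_kernel : exists2 C : R, 0 < C &
  forall t, 0 < t <= 1 -> heat_kernel O (2 * c) C t (K t).
Proof.
exists (B * expR (1 / 2) * Num.sqrt c * shift_const n.+1 c).
  by rewrite !mulr_gt0 ?expR_gt0 ?sqrtr_gt0 ?shift_const_gt0.
move=> t t01; have /andP[t0 _] := t01.
have CE : @exit_const R n c t (B / Num.sqrt t) =
    B * expR (1 / 2) * Num.sqrt c * shift_const n.+1 c.
  rewrite /exit_const sqrtrM ?(ltW c0)//; congr (_ * _).
  have st : Num.sqrt t != 0 by rewrite gt_eqF// sqrtr_gt0.
  by field.
have B'0 : 0 <= B / Num.sqrt t by rewrite divr_ge0 ?sqrtr_ge0// ltW.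
split; [exact: measurable_Green|exact: domain_kernel_outl|].
rewrite -CE; apply: kernel_bound => //.
- exact: measurable_Green.
- exact: domain_kernel_outl.
- by move=> x y Ox; have [] := Green_gradient y t01 Ox.
- by move=> x y i Ox; have [_] := Green_gradient y t01 Ox.
(* Such an f is square integrable, and the Dirichlet problem puts [S2 t f] in H^1_0, which supplies
   the boundary condition. *)
move=> f k mf f1 fk; have [_ hH] := hS.
have fL : f \in Lfun nu 2%:E by apply: core_bounded_L2 => //; exists k, 1.
have [g gH _] := hH (to_Lfun nu (lee1n 2) f) t t0.
exists (S2 t (to_Lfun nu (lee1n 2) f)), g; split => //.
by have := Green_L2 (to_Lfun nu (lee1n 2) f) t0; rewrite to_LfunE.
Qed.

End Green.

Theorem theorem4p6 (R : realType) (n : nat) (p theta delta : R)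
  (p1 : (1 <= p%:E)%E) (htheta : 0 <= theta < 2 * p - 1) (hdelta : 0 <= delta)
  (O : domain R n.+1)
  (a : 'rV[R]_n.+1 -> 'M[R]_n.+1) (b : 'rV[R]_n.+1 -> 'rV[R]_n.+1)
  (S2 : R -> L2 O -> L2 O) (G : R -> 'rV[R]_n.+1 -> 'rV[R]_n.+1 -> R)
  (hdomain : exists2 alpha : R, 0 < alpha < 1 & C1alpha_domain alpha O)
  (hline : connected_line_condition O)
  (hsemigroup : Dirichlet_semigroup a b S2)
  (hkernel : Green_kernel S2 G)
  (helliptic : elliptic a)
  (hbounds : Gaussian_bounds O G)
  (hgauss : weighted_Gaussian_bound O) :
  let mu := weighted_lebesgue O theta delta in
  let extends t (A : Lw O theta delta p1 -> Lw O theta delta p1) :=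
    forall psi : Lw O theta delta p1, compactly_supported O psi ->
      kernel_integral O (G t) psi (A psi) in
  exists S : R -> Lw O theta delta p1 -> Lw O theta delta p1,
    [/\ forall t, 0 < t ->
          [/\ bounded_linear (S t), extends t (S t) &
              forall A, bounded_linear A -> extends t A ->
                forall psi, A psi = S t psi %[ae mu]],
        C0_semigroup S &
        exists2 C : R, 0 < C &
          forall (t : R) (psi : Lw O theta delta p1), 0 < t <= 1 ->
            exists u : Lw O theta delta p1,
              [/\ u = S t psi %[ae mu],
                  forall x, O x -> differentiable u x &
                  forall i, exists2 v : Lw O theta delta p1,
                    forall x, O x -> v x = partial i u x &
                    ('N[mu]_p%:E[EFin \o v] <=
                       (C / Num.sqrt t)%:E * 'N[mu]_p%:E[EFin \o psi])%E]].
Proof.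
move=> mu extends; have [B [c [B0 c0 hB]]] := hbounds.
have [C C0 hK] := Green_heat_kernel B0 c0 hsemigroup hkernel hB.
have [hS2 _] := hsemigroup.
pose K t := domain_kernel O (G t).
have c20 : 0 < 2 * c by rewrite mulr_gt0.
have mK t (t0 : 0 < t) := measurable_Green hkernel t0.
have S2K t (f : L2 O) (t0 : 0 < t) := Green_L2 hkernel f t0.
pose S := @weighted_semigroup R n.+1 O p theta delta p1 K.
exists S; split.
- move=> t t0; have [mG _] := hkernel t t0; split.
  + exact: (weighted_semigroup_bounded p1 htheta hdelta hgauss c20 C0 hK).
  + move=> psi cpsi; apply/kernel_integralP => //.
    apply: (weighted_semigroup_kernel htheta hdelta hgauss c20 C0 hK hS2 mK S2K t0).
    exact: compactly_supported_integrable.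
  move=> A bA eA psi.
  apply: (weighted_semigroup_unique htheta hdelta hgauss c20 C0 hK hS2 mK S2K t0 bA).
  (* Bounded functions supported in a core are admissible test functions for [extends], and they are
     dense. *)
  move=> g gb; have cg : compactly_supported O g.
    have [k [M [_ gk]]] := gb; exists (core O k); split.
    - exact: compact_core.
    - exact: core_sub.
    - by move=> x _; exact: gk.
  have /kernel_integralP := eA g cg => /(_ mG (@measurable_funPT _ _ _ _ g)).
  by apply: filterS => x [_ h] _.
- split.
  + by move=> t _; exact: (weighted_semigroup_bounded p1 htheta hdelta hgauss c20 C0 hK).
  + by move=> f; apply: aeW => x _; rewrite /S /weighted_semigroup lexx.
  + move=> s t s0 t0 f.
    exact: (weighted_semigroupD htheta hdelta hgauss c20 C0 hK hS2 S2K).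
  + move=> f.
    exact: (weighted_semigroup_cvg htheta hdelta hgauss c20 C0 hK hS2 S2K).
have gK t x y : 0 < t <= 1 -> O x -> _ := @Green_gradient _ _ _ _ _ _ B0 hB t x y.
have [||D D0 hD] := weighted_semigroup_gradient p1 htheta hdelta hgauss c20 C0 hK c0 B0.
- by move=> t x y t01 Ox; have [] := gK t x y t01 Ox.
- by move=> t x y i t01 Ox; have [_] := gK t x y t01 Ox.
exists D => // t psi t01; have [dS vS] := hD t psi t01.
(* For t <= 1 the kernel formula defines [S t psi] at each point, so that it is its own
   differentiable representative. *)
by exists (S t psi); split => //; exact: aeW.
Qed.
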